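(* Let $1\le p_0<\infty$ and let $\mathcal F$ be a collection of pairs $(f,g)$ of nonnegative measurable functions on $\mathbb R^n$. Assume that for every $(f,g)\in\mathcal F$ and every $w\in A_{p_0}$, $$\|g\|_{L^{p_0}(w)}\le C\,\|f\|_{L^{p_0}(w)},$$ where $C$ does not depend on the pair $(f,g)$ and depends on $w$ only in terms of $[w]_{A_{p_0}}$. (i) Let $1<p<\infty$, $1<\sigma<\infty$ and $w\in A_p\cap RH_\sigma$, and let $0\le\lambda<n/\sigma'$ and $0\le\alpha<\lambda$. Then there is a constant $C$ such that for all $(f,g)\in\mathcal F$ $$\|g\|_{\mathcal L^{p,\lambda}(|x|^\alpha w)}\le C\,\|f\|_{\mathcal L^{p,\lambda}(|x|^\alpha w)}.$$ (ii) In particular, for power weights: if $1<p<\infty$, $0\le\lambda<n$ and $\lambda-n<\beta<\lambda+n(p-1)$, then there is a constant $C$ such that $\|g\|_{\mathcal L^{p,\lambda}(|x|^\beta)}\le C\|f\|_{\mathcal L^{p,\lambda}(|x|^\beta)}$ for all $(f,g)\in\mathcal F$. (iii) If the hypothesis holds for $p_0=1$, then the conclusion of (i) also holds for $p=1$ (with $w\in A_1\cap RH_\sigma$, $0\le\lambda<n/\sigma'$, $0\le\alpha<\lambda$), and the power-weight conclusion of (ii) also holds for $p=1$, $0\le\lambda<n$ and $\lambda-n<\beta<\lambda$.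
   Context: A weight is a locally integrable function $w$ on $\mathbb R^n$ with $w>0$ a.e.; $w(A)=\int_A w$, and $\sigma'$ denotes the conjugate exponent, $1/\sigma+1/\sigma'=1$. $\|f\|_{L^{q}(w)}=(\int|f|^q w)^{1/q}$. Morrey space: for $1\le p<\infty$, $0\le\lambda<n$ and a nonnegative measurable $u$, $\mathcal L^{p,\lambda}(u)$ is the set of measurable $f$ with $$\|f\|_{\mathcal L^{p,\lambda}(u)}=\sup_{x\in\mathbb R^n,\,r>0}\Big(\frac1{r^\lambda}\int_{B(x,r)}|f|^p u\Big)^{1/p}<\infty .$$ Muckenhoupt classes: for $1<p<\infty$, $w\in A_p$ iff $[w]_{A_p}=\sup_B\frac{w(B)}{|B|}\big(\frac{w^{1-p'}(B)}{|B|}\big)^{p-1}<\infty$, the supremum being over all Euclidean balls; $w\in A_1$ iff there is $c$ with $\frac{w(B)}{|B|}\le c\,w(x)$ for every ball $B$ and a.e. $x\in B$, and $[w]_{A_1}$ is the smallest such $c$. Reverse Hölder class: for $1<\sigma<\infty$, $w\in RH_\sigma$ iff there is $c$ with $\big(\frac1{|B|}\int_B w^\sigma\big)^{1/\sigma}\le\frac c{|B|}\int_B w$ for all balls $B$. Conventions: ''$C$ depends on $w$ only in terms of $[w]_{A_{p_0}}$'' means $C=\varphi([w]_{A_{p_0}})$ for some nondecreasing function $\varphi:[1,\infty)\to(0,\infty)$ independent of $w$ and of the pair. A norm inequality in the hypothesis or the conclusion means: if the right-hand side is finite, then so is the left-hand side (for the same weight) and the inequality holds. The constants $C$ in the conclusions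 do not depend on the pair $(f,g)$. *)

(* Defs.v *)
From HB Require Import structures.
From mathcomp Require Import all_boot all_order all_algebra.
From mathcomp Require Import all_classical all_reals all_analysis.
From mathcomp Require Import measurable_realfun.

Set Implicit Arguments.
Unset Strict Implicit.
Unset Printing Implicit Defensive.
Import Order.TTheory GRing.Theory Num.Theory.
Import numFieldNormedType.Exports.

Local Open Scope classical_set_scope.
Local Open Scope ring_scope.

(* Lebesgue measure on R^n: the library only has it on R, so the space of row
   vectors is given the outer measure defined by covers by countable families
   of half-open boxes, and the sigma-algebra of its Caratheodory measurable
   (that is, Lebesgue measurable) sets. *)
Section lebesgue_measure_rV.
Context {R : realType} {n : nat}.
Implicit Types (A : set 'rV[R]_n) (Q : 'rV[R]_n * 'rV[R]_n).

Definition box Q : set 'rV[R]_n :=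
  [set x | forall i, Q.1 0 i < x 0 i <= Q.2 0 i].

Definition box_volume Q : R := \prod_i Num.max 0 (Q.2 0 i - Q.1 0 i).

Definition box_cover A : set (set ('rV[R]_n * 'rV[R]_n)) :=
  [set C | countable C /\ A `<=` \bigcup_(Q in C) box Q].

Definition lebesgue_outer_rV A : \bar R :=
  ereal_inf [set \esum_(Q in C) (box_volume Q)%:E | C in box_cover A].

Local Open Scope ereal_scope.

Lemma box_volume_ge0 Q : 0 <= (box_volume Q)%:E.
Proof. by rewrite lee_fin prodr_ge0// => i _; rewrite le_max lexx. Qed.

Lemma lebesgue_outer_rV_ge0 A : 0 <= lebesgue_outer_rV A.
Proof.
by apply: le_ereal_inf_tmp => _ [C _ <-]; apply: esum_ge0 => Q _;
  exact: box_volume_ge0.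
Qed.

Lemma lebesgue_outer_rV0 : lebesgue_outer_rV set0 = 0.
Proof.
apply/eqP; rewrite eq_le lebesgue_outer_rV_ge0 andbT.
apply: ereal_inf_lbound; exists set0; last by rewrite esum_set0.
by split => //; exact: countable0.
Qed.

Lemma le_lebesgue_outer_rV :
  {homo lebesgue_outer_rV : A B / A `<=` B >-> A <= B}.
Proof.
move=> A B AB; apply/ereal_inf_le_tmp => _ [C [cC BC] <-].
by exists C => //; split => //; apply: subset_trans BC.
Qed.

Lemma esum_bigcup_le (C : (set ('rV[R]_n * 'rV[R]_n))^nat) :
  \esum_(Q in \bigcup_k C k) (box_volume Q)%:E <=
  \sum_(k <oo) \esum_(Q in C k) (box_volume Q)%:E.
Proof.
rewrite seqDU_bigcup_eq nneseries_sum_bigcup//; last first.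
  by move=> Q; exact: box_volume_ge0.
apply: lee_nneseries => [k _ _|k _].
  by apply: esum_ge0 => Q _; exact: box_volume_ge0.
rewrite esum_mkcond [leRHS]esum_mkcond; apply: le_esum => Q _.
case: ifPn => [/set_mem/(@subset_seqDU _ C k) CQ|_]; first by rewrite mem_set.
by case: ifPn => // _; exact: box_volume_ge0.
Qed.

Lemma lebesgue_outer_rV_sigma_subadditive : sigma_subadditive lebesgue_outer_rV.
Proof.
move=> A; have [[i ioo]|] := pselect (exists i, lebesgue_outer_rV (A i) = +oo).
  rewrite (eseries_pinfty _ _ ioo) ?leey// => k _.
  by rewrite -ltNye (lt_le_trans _ (lebesgue_outer_rV_ge0 _)).
rewrite -forallNE => Aoo; apply/lee_addgt0Pr => e e0.
rewrite (le_trans _ (epsilon_trick _ _ (ltW e0)))//; last first.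
  by move=> k; exact: lebesgue_outer_rV_ge0.
have /choice[C HC] k : exists C, box_cover (A k) C /\
    \esum_(Q in C) (box_volume Q)%:E <=
    lebesgue_outer_rV (A k) + (e / (2 ^ k.+1)%:R)%:E.
  have Afin : lebesgue_outer_rV (A k) \is a fin_num.
    by rewrite ge0_fin_numE ?lebesgue_outer_rV_ge0// ltey; exact/eqP/Aoo.
  have ek : (0 < e / (2 ^ k.+1)%:R)%R by rewrite divr_gt0// ltr0n expn_gt0.
  have [_ [C AC <-] /ltW leC] := lb_ereal_inf_adherent ek Afin.
  by exists C.
apply: (@le_trans _ _ (\esum_(Q in \bigcup_k C k) (box_volume Q)%:E)).
  apply: ereal_inf_lbound; exists (\bigcup_k C k) => //; split.
    by apply: bigcup_countable => // k _; exact: (HC k).1.1.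
  by move=> x [k _ /(HC k).1.2[Q CQ Qx]]; exists Q => //; exists k.
apply: (le_trans (esum_bigcup_le C)); apply: lee_nneseries => [k _ _|k _].
  by apply: esum_ge0 => Q _; exact: box_volume_ge0.
exact: (HC k).2.
Qed.

HB.instance Definition _ := isOuterMeasure.Build R 'rV[R]_n lebesgue_outer_rV
  lebesgue_outer_rV0 lebesgue_outer_rV_ge0 le_lebesgue_outer_rV
  lebesgue_outer_rV_sigma_subadditive.

Let mu : {outer_measure set 'rV[R]_n -> \bar R} := lebesgue_outer_rV.

HB.instance Definition _ :=
  @isMeasurable.Build (caratheodory_display lebesgue_outer_rV)
    'rV[R]_n (caratheodory_measurable mu)
    (caratheodory_measurable_set0 mu)
    (@caratheodory_measurable_setC _ _ mu)
    (@caratheodory_measurable_bigcup _ _ mu).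

Definition lebesgue_rV : set 'rV[R]_n -> \bar R := lebesgue_outer_rV.

HB.instance Definition _ := isMeasure.Build _ 'rV[R]_n R lebesgue_rV
  (@caratheodory_measure0 _ _ mu) (@caratheodory_measure_ge0 _ _ mu)
  (@caratheodory_measure_sigma_additive _ _ mu).

End lebesgue_measure_rV.

Section weights.
Context {R : realType} {n : nat}.
Implicit Types (x : 'rV[R]_n) (r p q c sigma lambda : R).
Implicit Types (w u : 'rV[R]_n -> R) (f g : 'rV[R]_n -> \bar R).

Local Notation leb := (@lebesgue_rV R n).

(* The library norm and balls of 'rV[R]_n are those of the sup norm. *)
Definition enorm x : R := Num.sqrt (\sum_i x 0 i ^+ 2).

Definition eball x r : set 'rV[R]_n := [set y | enorm (y - x) < r].

Definition conj_exp p : R := p / (p - 1).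

Local Open Scope ereal_scope.

Definition weight w : Prop :=
  [/\ measurable_fun [set: 'rV[R]_n] w,
      forall K, compact K -> \int[leb]_(x in K) `|(w x)%:E| < +oo &
      {ae leb, forall x, (0 < w x)%R}].

Definition mass w (A : set 'rV[R]_n) : \bar R := \int[leb]_(x in A) (w x)%:E.

Definition avg w (A : set 'rV[R]_n) : \bar R := mass w A / leb A.

Definition A1_bound w c : Prop := forall x r, (0 < r)%R ->
  {ae leb, forall y, eball x r y -> avg w (eball x r) <= (c * w y)%:E}.

Definition A1_const w : \bar R := ereal_inf [set c%:E | c in A1_bound w].

(* for 1 < p *)
Definition Ap_const p w : \bar R :=
  ereal_sup [set avg w (eball b.1 b.2) *
                 avg (fun y => w y `^ (1 - conj_exp p))%R (eball b.1 b.2)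
                   `^ (p - 1)
            | b in [set b : 'rV[R]_n * R | (0 < b.2)%R]].

Definition muckenhoupt_const p w : \bar R :=
  if p == 1%R then A1_const w else Ap_const p w.

Definition muckenhoupt p w : Prop :=
  weight w /\ (if p == 1%R then exists c, A1_bound w c else Ap_const p w < +oo).

Definition reverse_hoelder sigma w : Prop :=
  exists c : R, forall x r, (0 < r)%R ->
    avg (fun y => w y `^ sigma)%R (eball x r) `^ (sigma^-1)
      <= c%:E * avg w (eball x r).

Definition Lnorm_weight q w f : \bar R :=
  (\int[leb]_x (`|f x| `^ q * (w x)%:E)) `^ (q^-1).

Definition morrey_norm p lambda u f : \bar R :=
  ereal_sup [set (((b.2 `^ lambda)^-1)%:E *
                  \int[leb]_(x in eball b.1 b.2) (`|f x| `^ p * (u x)%:E))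
                 `^ (p^-1)
            | b in [set b : 'rV[R]_n * R | (0 < b.2)%R]].

Implicit Types F : set (('rV[R]_n -> \bar R) * ('rV[R]_n -> \bar R)).

Definition nonneg_measurable f : Prop :=
  measurable_fun [set: 'rV[R]_n] f /\ forall x, 0 <= f x.

(* In the two definitions below the constant is positive, so the inequality
   holds trivially when its right-hand side is +oo, and otherwise says that
   its left-hand side is finite too. *)
Definition weighted_bound (p0 : R) F : Prop :=
  exists phi : R -> R,
    [/\ forall t, (1 <= t)%R -> (0 < phi t)%R,
        forall s t, (1 <= s)%R -> (s <= t)%R -> (phi s <= phi t)%R &
        forall f g w, F (f, g) -> muckenhoupt p0 w ->
          Lnorm_weight p0 w g <=
          (phi (fine (muckenhoupt_const p0 w)))%:E * Lnorm_weight p0 w f].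

Definition morrey_bound p lambda u F : Prop :=
  exists2 C : R, (0 < C)%R &
    forall f g, F (f, g) ->
      morrey_norm p lambda u g <= C%:E * morrey_norm p lambda u f.

End weights.

(* Main.v *)
Require Import Defs.
From HB Require Import structures.
From mathcomp Require Import finmap.
From mathcomp Require Import all_boot all_order all_algebra.
From mathcomp Require Import all_classical all_reals all_analysis.
From mathcomp Require Import measurable_realfun.
From mathcomp Require Import ring lra.

(** The Morrey norm of g is a supremum over balls of weighted L^p norms on the
    ball.  Up to constants, the characteristic function of the ball of centre z
    and radius r is bounded by r^gamma (r + |x - z|)^(- gamma), so it is enough to
    have, with a constant independent of z and r, the inequality in L^p for the
    weight w(x) (r + |x - z|)^(- gamma).  Conversely, the norm of f for this weight
    is a sum over the dyadic balls about z, on each of which the Morrey norm of f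
    applies, and the sum converges as soon as gamma > lambda.  The factor
    |x|^alpha is dealt with by the same kind of dyadic sum, this time over balls
    that shrink to the origin, which converges as alpha < lambda
    (morrey_local, morrey_of_radial).

    The weight w(x) (r + |x - z|)^(- gamma) is in A_p uniformly in z and r if
    gamma sigma' < n: by Hoelder's inequality with exponents sigma and sigma', the
    reverse Hoelder condition on w allows the radial factor to be replaced, on
    each ball, by a multiple of its infimum there (rh_radial_mass,
    ap_balls_mul_radial, a1_balls_mul_radial).  As lambda < n / sigma', there is a
    gamma that satisfies both constraints.  For p = 1 the hypothesis with exponent
    1 then applies directly.  For p > 1, the inequality in L^p for these weights is
    Rubio de Francia's extrapolation theorem, whose constant depends on the weight
    only through its A_p constant (extrapolation_balls).

    Extrapolation is proved for a measure and a countable family of sets that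
    satisfy the engulfing and doubling properties of balls.  Vitali's selection
    and Marcinkiewicz interpolation bound the maximal operator with respect to a
    doubling weight (strong_type); Lerner's argument deduces Muckenhoupt's theorem
    from two such bounds (muckenhoupt_bound).  Iterating the maximal operator then produces A_1 majorants
    H of f in L^p(w) and V of g^(p - 1) w in the dual space (rubio_de_francia).
    The hypothesis is applied to the weight H^(1 - p0) V, which is in A_p0 because
    H and V are in A_1; two pointwise inequalities convert the exponent p0 to p,
    and leave a multiple of the norm of g that can be absorbed
    (extrapolation_finite).

    The balls with rational centres and radii are such a family for Lebesgue
    measure.  That balls are measurable, and have a volume comparable with r^n,
    is proved from the definition of the outer measure by covers by boxes
    (measurable_half_space, lebesgue_outer_cube_ge).

    For a power weight |x|^beta, beta is split as alpha + g with |x|^g in A_p, and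
    sigma is chosen large enough for lambda < n / sigma' to hold, yet such that
    |x|^(g sigma) is locally integrable, which gives the reverse Hoelder condition
    (power_weight_exponent, morrey_bound_power_ap). *)


Set Implicit Arguments.
Unset Strict Implicit.
Unset Printing Implicit Defensive.
Import Order.TTheory GRing.Theory Num.Theory.
Import numFieldNormedType.Exports.

Local Open Scope classical_set_scope.
Local Open Scope ring_scope.

(** * Powers of extended reals and level sets *)

Section powers.
Context {R : realType}.
Local Open Scope ereal_scope.

Lemma le_poweR (r : R) (x y : \bar R) :
  (0 <= r)%R -> 0 <= x -> x <= y -> x `^ r <= y `^ r.
Proof.
move=> r0 x0 xy; apply: gt0_ler_poweR => //; rewrite in_itv/= leey andbT//.
exact: le_trans xy.
Qed.

Lemma poweRK (r : R) (x : \bar R) : r != 0%R -> 0 <= x -> (x `^ r) `^ r^-1 = x.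
Proof. by move=> r0 x0; rewrite -poweRrM divff// poweRe1. Qed.

Lemma poweRVK (r : R) (x : \bar R) : r != 0%R -> 0 <= x -> (x `^ r^-1) `^ r = x.
Proof. by move=> r0 x0; rewrite -poweRrM mulVf// poweRe1. Qed.

Lemma poweR_ereal_sup_le (r : R) (u : nat -> \bar R) (s : \bar R) :
  (0 < r)%R -> (forall i, 0 <= u i) -> 0 <= s ->
  (forall i, u i `^ r <= s) -> ereal_sup (range u) `^ r <= s.
Proof.
move=> r0 u0 s0 us; have rN0 : r != 0%R by rewrite gt_eqF.
rewrite -(poweRVK rN0 s0); apply: le_poweR; first exact: ltW.
  by apply: (le_trans (u0 0%N)); apply: ereal_sup_ubound; exists 0%N.
apply: ge_ereal_sup => _ [i _ <-]; rewrite -(poweRK rN0 (u0 i)).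
by apply: le_poweR; rewrite ?invr_ge0 ?poweR_ge0// ltW.
Qed.

End powers.

Section dyadic_levels.
Context {R : realType}.

Lemma powR_gt1 (a r : R) : 1 < a -> 0 < r -> 1 < a `^ r.
Proof.
move=> a1 r0; rewrite [ltLHS](_ : 1 = 1 `^ r); last by rewrite powR1.
by rewrite gt0_ltr_powR ?nnegrE ?ler01// ltW// (lt_trans ltr01).
Qed.

(** A geometric sum of ratio greater than 1 is comparable with its last term. *)
Lemma geometric_levels_le (q e z : R) K : 1 < q -> 0 < e -> 0 <= z ->
  \sum_(k < K) (e * 2 ^+ k) `^ (q - 1) * (e * 2 ^+ k < z)%R%:R <=
  2 `^ (q - 1) / (2 `^ (q - 1) - 1) * z `^ (q - 1).
Proof.
move=> q1 e0 z0; set rho := 2 `^ (q - 1).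
have q10 : 0 < q - 1 by rewrite subr_gt0.
have rho1 : 1 < rho by rewrite powR_gt1 ?ltr1n.
have rho10 : 0 < rho - 1 by rewrite subr_gt0.
have E k : (e * 2 ^+ k) `^ (q - 1) = e `^ (q - 1) * rho ^+ k.
  rewrite powRM ?exprn_ge0 ?(ltW e0)//; congr (_ * _).
  by rewrite -powR_mulrn// powRAC powR_mulrn// powR_ge0.
have G k : \sum_(i < k) rho ^+ i <= rho ^+ k / (rho - 1).
  rewrite ler_pdivlMr// mulrC -subrX1 lerBlDr lerDl//.
have A0 : 0 <= rho / (rho - 1) by rewrite divr_ge0// ltW// (lt_trans _ rho1).
elim: K => [|K IH]; first by rewrite big_ord0 mulr_ge0 ?powR_ge0.
rewrite big_ord_recr/=; case: (ltP (e * 2 ^+ K) z) => [ltz|_]; last first.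
  by rewrite mulr0 addr0.
rewrite mulr1; apply: (@le_trans _ _ (\sum_(k < K.+1) e `^ (q - 1) * rho ^+ k)).
  rewrite big_ord_recr/= E lerD2r; apply: ler_sum => k _; rewrite E.
  by rewrite ler_piMr ?mulr_ge0 ?powR_ge0 ?exprn_ge0 ?(ltW (lt_trans _ rho1))//; case: (_ < _).
rewrite -mulr_sumr; apply: (@le_trans _ _ (rho / (rho - 1) * (e * 2 ^+ K) `^ (q - 1))).
  rewrite E mulrCA ler_wpM2l ?powR_ge0//.
  by apply: (le_trans (G _)); rewrite exprS mulrAC.
rewrite ler_wpM2l// ge0_ler_powR ?nnegrE ?(ltW q10)// ?(ltW ltz)//.
by rewrite mulr_ge0 ?exprn_ge0// ltW.
Qed.

Lemma dyadic_level_exists (e y : R) : 0 < e -> e < y ->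
  exists k, e * 2 ^+ k < y /\ y <= e * 2 ^+ k.+1.
Proof.
move=> e0 ey.
have [m ym] : exists m, y / e < 2 ^+ m.
  exists (Num.truncn (y / e)).+1; apply: (lt_trans (truncnS_gt _)).
  by rewrite -natrX ltr_nat ltn_expl.
have ex : exists k, y <= e * 2 ^+ k.
  by exists m; rewrite mulrC -ler_pdivrMr// ltW.
case: (ex_minnP ex) => -[|k] yk kmin; first by move: yk; rewrite mulr1 leNgt ey.
exists k; split => //; rewrite ltNge; apply/negP => /kmin.
by rewrite ltnn.
Qed.
End dyadic_levels.

Section dyadic_levels_ereal.
Context {R : realType}.
Local Open Scope ereal_scope.

(** A discrete layer cake formula: dyadic levels replace the integral over all
    levels by a countable sum, at the cost of a factor 2^q, and the term e^q
    accounts for the values of y below the lowest level. *)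
Lemma poweR_le_levels (q e : R) (y : \bar R) : (0 < q)%R -> (0 < e)%R -> 0 <= y ->
  y `^ q <= (e `^ q)%:E +
    \sum_(k <oo) (if (e * 2 ^+ k)%:E < y then ((e * 2 ^+ k.+1) `^ q)%:E else 0).
Proof.
move=> q0 e0 y0.
have sum0 k : 0 <= if (e * 2 ^+ k)%:E < y then ((e * 2 ^+ k.+1) `^ q)%:E else 0.
  by case: ifP; rewrite ?lee_fin ?powR_ge0.
have term k : (e * 2 ^+ k)%:E < y ->
    ((e * 2 ^+ k.+1) `^ q)%:E <= (e `^ q)%:E +
    \sum_(k <oo) (if (e * 2 ^+ k)%:E < y then ((e * 2 ^+ k.+1) `^ q)%:E else 0).
  move=> ky; rewrite -[leLHS]add0e; apply: leeD; first by rewrite lee_fin powR_ge0.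
  apply: le_trans (nneseries_lim_ge k.+1 (fun n _ _ => sum0 n)).
  rewrite big_nat_recr//= ky leeDr//; exact: sume_ge0.
have e2k k : (0 <= e * 2 ^+ k)%R by rewrite mulr_ge0 ?exprn_ge0// ltW.
case: y y0 sum0 term => [y| |]// y0 sum0 term; last first.
  rewrite poweRyr ?gt_eqF// leye_eq; apply/eqP/eqyP => A A0.
  apply: (le_trans _ (term (Num.truncn (A `^ q^-1 / e)) (ltry _))).
  have {1}-> : A = ((A `^ q^-1) `^ q)%R.
    by rewrite -powRrM mulVf ?gt_eqF// powRr1// ltW.
  rewrite lee_fin ge0_ler_powR ?nnegrE ?powR_ge0 ?(ltW q0)//.
  rewrite [leRHS]mulrC -ler_pdivrMr// (le_trans (ltW (truncnS_gt _)))//.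
  by rewrite -natrX ler_nat ltnW// ltn_expl.
have [ye|ey] := leP y e.
  apply: (@le_trans _ _ (e `^ q)%:E).
    by rewrite poweR_EFin lee_fin ge0_ler_powR ?nnegrE ?(ltW q0)// ltW.
  by rewrite leeDl// nneseries_ge0.
have [k [ky yk]] := dyadic_level_exists e0 ey.
apply: le_trans (term k ky).
by rewrite poweR_EFin lee_fin ge0_ler_powR ?nnegrE ?(ltW q0).
Qed.

(** The sum produced by Marcinkiewicz interpolation, once the order of the sum
    over the levels and of the integral is exchanged.  Only the levels below 2 y
    contribute, and as 1 < q their contributions grow geometrically. *)
Lemma levels_le_poweR (q e D : R) (y : \bar R) : (1 < q)%R -> (0 < e)%R ->
  (0 < D)%R -> 0 <= y ->
  \sum_(k <oo) ((e * 2 ^+ k.+1) `^ q * (D / (e * 2 ^+ k / 2)))%:E *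
     (if (e * 2 ^+ k / 2)%:E < y then y else 0) <=
  (D * 2 * 2 `^ q * (2 `^ (q - 1) / (2 `^ (q - 1) - 1)) * 2 `^ (q - 1))%:E *
    y `^ q.
Proof.
move=> q1 e0 D0 y0; set C := (D * 2 * _ * _ * _)%R.
have q0 : (0 < q)%R by rewrite (lt_trans _ q1).
have rho1 : (1 < 2 `^ (q - 1) :> R)%R by rewrite powR_gt1 ?ltr1n ?subr_gt0.
have C0 : (0 < C)%R.
  by rewrite !mulr_gt0 ?invr_gt0 ?powR_gt0// subr_gt0.
case: y y0 => [y| |]// y0; last by rewrite poweRyr ?gt_eqF// gt0_muley ?lte_fin// leey.
rewrite lee_fin in y0; apply: lime_le.
  apply: is_cvg_nneseries => k _ _; rewrite mule_ge0//.
    by rewrite lee_fin mulr_ge0 ?powR_ge0// divr_ge0 ?divr_ge0 ?mulr_ge0 ?exprn_ge0// ltW.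
  by case: ifP.
apply: nearW => K; rewrite big_mkord.
under eq_bigr => k _.
  rewrite (_ : _ * _ = ((D * 2 * 2 `^ q * y) *
     ((e * 2 ^+ k) `^ (q - 1) * (e * 2 ^+ k < 2 * y)%R%:R))%:E); last first.
    rewrite lte_fin ltr_pdivrMr// [(y * 2)%R]mulrC; case: ifP => _; last by rewrite mule0 !mulr0.
    have e2k : (0 < e * 2 ^+ k)%R by rewrite mulr_gt0 ?exprn_gt0.
    rewrite -EFinM; congr EFin; rewrite exprS mulr1 (mulrCA e).
    set x := (e * 2 ^+ k)%R in e2k *.
    rewrite powRM ?(ltW e2k)// -[(x `^ q)%R]mulr_powRB1 ?(ltW e2k)//.
    by field; rewrite gt_eqF.
  over.
rewrite sumEFin poweR_EFin -EFinM lee_fin -mulr_sumr.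
apply: le_trans (_ : (D * 2 * 2 `^ q * y * (2 `^ (q - 1) / (2 `^ (q - 1) - 1) *
  (2 * y) `^ (q - 1)) <= _)%R).
  rewrite ler_wpM2l ?geometric_levels_le ?mulr_ge0 ?powR_ge0//; exact: ltW.
rewrite powRM// -[(y `^ q)%R]mulr_powRB1// /C le_eqVlt; apply/orP; left; apply/eqP.
by ring.
Qed.

End dyadic_levels_ereal.

Section geometric_eseries.
Context {R : realType}.
Local Open Scope ereal_scope.

Lemma geometric_eseries_le (a x : R) : (0 <= a)%R -> (0 <= x < 1)%R ->
  \sum_(k <oo) (a * x ^+ k)%:E <= (a / (1 - x))%:E.
Proof.
move=> a0 /andP[x0 x1]; apply: lime_le.
  by apply: is_cvg_nneseries => k _ _; rewrite lee_fin mulr_ge0// exprn_ge0.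
apply: nearW => K; rewrite sumEFin lee_fin -mulr_sumr ler_wpM2l//.
rewrite -[leRHS]mul1r ler_pdivlMr ?subr_gt0// mulrC big_mkord.
have -> : ((1 - x) * (\sum_(i < K) x ^+ i) = 1 - x ^+ K)%R.
  by rewrite -opprB mulNr -subrX1 opprB.
by rewrite gerBl exprn_ge0.
Qed.

End geometric_eseries.

(** * The weighted maximal operator of a countable family *)

Section vitali.
Context {R : realType} {T : Type}.
Variables (B Bs : nat -> set T) (rad : nat -> R).
Hypothesis engulf : forall i j, B i `&` B j !=set0 -> rad i <= rad j ->
  B i `<=` Bs j.

(** Vitali's greedy selection: a set of largest radius is kept, and the sets that
    it meets are discarded, since its enlargement covers them. *)
Lemma vitali_finite (s : seq nat) : exists D : seq nat,
  [/\ uniq D, {subset D <= s}, trivIset [set` D] B &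
      forall i, i \in s -> exists2 j, j \in D & B i `<=` Bs j].
Proof.
have [m] := ubnP (size s); elim: m s => // m IH s /ltnSE sm.
case: s sm => [|i0 s0] sm.
  by exists [::]; split => // x y; rewrite /= in_nil.
have [i1 i1s i1max] : exists2 i, i \in i0 :: s0 &
    forall j, j \in i0 :: s0 -> rad j <= rad i.
  elim: (s0) => [|a s1 [i is1 imax]].
    by exists i0; rewrite ?mem_head// => j; rewrite mem_seq1 => /eqP ->.
  have [ai|ia] := leP (rad a) (rad i).
    exists i; first by move: is1; rewrite !inE => /orP[->|->]//; rewrite ?orbT.
    move=> j; rewrite !inE => /or3P[/eqP ->|/eqP->//|js]; rewrite ?imax ?mem_head//.
    by rewrite inE js orbT.
  exists a; first by rewrite !inE eqxx orbT.
  move=> j; rewrite !inE => /or3P[/eqP ->|/eqP->//|js].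
    by rewrite (le_trans _ (ltW ia))// imax// mem_head.
  by rewrite (le_trans _ (ltW ia))// imax// inE js orbT.
set s := i0 :: s0 in sm i1s i1max *.
pose s' := [seq i <- s | (i != i1) && ~~ `[< B i `&` B i1 !=set0 >]].
have s'm : (size s' < m)%N.
  apply: leq_trans sm; rewrite size_filter -(count_predC (pred1 i1) s).
  have c1 : (0 < count (pred1 i1) s)%N by rewrite -has_count has_pred1.
  by rewrite -add1n leq_add// sub_count// => i /= /andP[].
have [D [uD Ds' tD cD]] := IH _ s'm.
have Di1 j : j \in D -> j != i1 /\ ~ (B j `&` B i1 !=set0).
  by move=> /Ds'; rewrite mem_filter => /andP[/andP[-> /asboolPn]].
exists (i1 :: D); split.
- by rewrite /= uD andbT; apply/negP => /Di1[]; rewrite eqxx.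
- move=> x; rewrite inE => /orP[/eqP->//|/Ds'].
  by rewrite mem_filter => /andP[].
- move=> x y /=; rewrite !inE => /orP[/eqP->|xD] /orP[/eqP->|yD] //.
  + by rewrite setIC => /((Di1 _ yD).2).
  + by move=> /((Di1 _ xD).2).
  + exact: tD.
- move=> i si; have [ii1|ii1] := pselect (B i `&` B i1 !=set0).
    by exists i1; rewrite ?mem_head//; apply: engulf => //; exact: i1max.
  have [ei|ni] := eqVneq i i1.
    exists i1; rewrite ?mem_head// => x Bx; exfalso; apply: ii1.
    by exists x; split => //; rewrite -ei.
  have [|j jD Bij] := cD i; last by exists j; rewrite // inE jD orbT.
  by rewrite mem_filter ni si andbT /=; exact/asboolPn.
Qed.

End vitali.

Section weighted_maximal.
Context d (T : measurableType d) (R : realType).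
Variable mu : {measure set T -> \bar R}.
Local Open Scope ereal_scope.

Lemma integral_cover_le (nu : T -> \bar R) (A : set T) (F : nat -> set T)
    (D : seq nat) : (forall x, 0 <= nu x) -> measurable_fun [set: T] nu ->
  measurable A -> (forall i, measurable (F i)) ->
  (forall x, A x -> exists2 j, j \in D & F j x) ->
  \int[mu]_(x in A) nu x <= \sum_(j <- D) \int[mu]_(x in F j) nu x.
Proof.
move=> nu0 mnu mA mF AF; rewrite integral_mkcond.
under eq_bigr do rewrite integral_mkcond.
have mr E : measurable E -> measurable_fun setT (nu \_ E).
  by move=> mE; apply/(measurable_restrictT _ mE)/measurable_funTS.
have r0 E x : 0 <= (nu \_ E) x by apply: erestrict_ge0.
rewrite -ge0_integral_sum//; last by move=> j; exact: mr.
apply: ge0_le_integral => //; [exact: mr|by apply: emeasurable_sum => j; exact: mr|].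
move=> x _; rewrite {1}/patch; case: ifPn => [|_]; last exact: sume_ge0.
rewrite inE => /AF[j jD Fjx]; rewrite (big_rem j)//=.
rewrite {1}/patch mem_set// leeDl//; exact: sume_ge0.
Qed.

Section maxop.
Variable B : nat -> set T.
Hypothesis mB : forall i, measurable (B i).
Implicit Types (c : nat -> R) (u f : T -> \bar R).

(** The maximal operator of the family B, its i-th mean being normalised by an
    arbitrary number c i: this covers at once the reciprocals of the measures of
    the sets, and those of their masses for a weight. *)
Definition maxop c u (x : T) : \bar R :=
  ereal_sup (range (fun i => (c i * \1_(B i) x)%:E * \int[mu]_(y in B i) u y)).

Lemma measurable_maxop c u : measurable_fun [set: T] (maxop c u).
Proof.
rewrite (_ : maxop c u = fun x =>
    esups (fun i => (c i * \1_(B i) x)%:E * \int[mu]_(y in B i) u y) 0%N).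
  apply: (@measurable_fun_esups _ _ _ _
    (fun i x => (c i * \1_(B i) x)%:E * \int[mu]_(y in B i) u y)) => i.
  apply: emeasurable_funM => //; apply/measurable_EFinP.
  by apply: measurable_funM => //; exact: measurable_indic.
apply/funext => x; rewrite /maxop /esups; congr ereal_sup.
by apply/seteqP; split => y [i _ <-]; exists i.
Qed.

Lemma maxop_ge c u i x : B i x ->
  (c i)%:E * \int[mu]_(y in B i) u y <= maxop c u x.
Proof.
move=> Bx; apply: ereal_sup_ubound; exists i => //.
by rewrite indicE mem_set// mulr1.
Qed.

Lemma maxop_le c u x s : 0 <= s ->
  (forall i, B i x -> (c i)%:E * \int[mu]_(y in B i) u y <= s) ->
  maxop c u x <= s.
Proof.
move=> s0 H; apply: ge_ereal_sup => _ [i _ <-]; rewrite indicE.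
case: (boolP (x \in B i)) => [/set_mem/H|_]; first by rewrite mulr1.
by rewrite mulr0 mul0e.
Qed.

Lemma maxop_ge0 c u x : (forall i, (0 <= c i)%R) -> (forall x, 0 <= u x) ->
  0 <= maxop c u x.
Proof.
move=> c0 u0; apply: (@le_trans _ _
    ((c 0%N * \1_(B 0%N) x)%:E * \int[mu]_(y in B 0%N) u y)).
  by rewrite mule_ge0 ?integral_ge0// lee_fin mulr_ge0.
by apply: ereal_sup_ubound; exists 0%N.
Qed.

Lemma maxop_gt c u x t : (0 <= t)%R -> t%:E < maxop c u x ->
  exists2 i, B i x & t%:E < (c i)%:E * \int[mu]_(y in B i) u y.
Proof.
move=> t0 /ereal_sup_gt[_ [i _ <-]]; rewrite indicE.
case: (boolP (x \in B i)) => [/set_mem Bx|_]; first by rewrite mulr1; exists i.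
by rewrite mulr0 mul0e lte_fin ltNge t0.
Qed.

End maxop.

Lemma measurable_poweR_comp (r : R) (g : T -> \bar R) :
  measurable_fun [set: T] g -> measurable_fun [set: T] (fun x => g x `^ r).
Proof. by move=> mg; exact: (measurableT_comp (measurable_poweR _)). Qed.

Section strong_type.
Variables (B Bs : nat -> set T) (rad : nat -> R) (nu : T -> R) (b : nat -> R) (D : R).
Hypothesis mB : forall i, measurable (B i).
Hypothesis mBs : forall i, measurable (Bs i).
Hypothesis engulf : forall i j, B i `&` B j !=set0 -> (rad i <= rad j)%R ->
  B i `<=` Bs j.
Hypothesis mnu : measurable_fun [set: T] nu.
Hypothesis nu0 : forall x, (0 <= nu x)%R.
Hypothesis b0 : forall i, (0 < b i)%R.
Hypothesis nuB : forall i, \int[mu]_(x in B i) (nu x)%:E = (b i)%:E.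
Hypothesis D0 : (0 < D)%R.
Hypothesis nuBs : forall i, \int[mu]_(x in Bs i) (nu x)%:E <= (D * b i)%:E.

Let mnuE : measurable_fun [set: T] (EFin \o nu).
Proof. exact/measurable_EFinP. Qed.

(** After Vitali's selection, the disjoint sets that are kept bound the integral
    of u from below, while the enlargements that cover A cost only the doubling
    constant D of nu. *)
Lemma weak_type (s : seq nat) (t : R) (u : T -> \bar R) (A : set T) :
  (0 < t)%R -> measurable_fun [set: T] u -> (forall x, 0 <= u x) ->
  measurable A -> (forall x, A x -> exists2 i, i \in s & B i x) ->
  (forall i, i \in s -> (t * b i)%:E <= \int[mu]_(x in B i) u x) ->
  \int[mu]_(x in A) (nu x)%:E <= (D / t)%:E * \int[mu]_x u x.
Proof.
move=> t0 mu_ u0 mA As bu.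
have [E [uE Es tE cE]] := vitali_finite engulf s.
apply: (@le_trans _ _ (\sum_(j <- E) \int[mu]_(x in Bs j) (nu x)%:E)).
  apply: integral_cover_le => //.
  by move=> x /As[i /cE[j jE ij] Bx]; exists j => //; exact: ij.
apply: (@le_trans _ _ (\sum_(j <- E) (D / t)%:E * \int[mu]_(x in B j) u x)).
  rewrite big_seq [leRHS]big_seq; apply: lee_sum => j /Es/bu jb.
  apply: (le_trans (nuBs j)).
  rewrite (_ : (D * b j)%R = (D / t * (t * b j))%R); last by field; rewrite gt_eqF.
  by rewrite EFinM lee_wpmul2l// lee_fin divr_ge0// ltW.
rewrite -ge0_sume_distrr; last by move=> j _; exact: integral_ge0.
rewrite lee_wpmul2l ?lee_fin ?divr_ge0 ?(ltW D0) ?(ltW t0)//.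
have mU : measurable (\big[setU/set0]_(j <- E) B j).
  by apply: bigsetU_measurable.
rewrite -(@ge0_integral_bigsetU _ _ _ mu _ B)//; last exact: measurable_funTS.
exact: ge0_subset_integral.
Qed.

Variable q : R.
Hypothesis q1 : (1 < q)%R.
Variable f : T -> \bar R.
Hypothesis mf : measurable_fun [set: T] f.
Hypothesis f0 : forall x, 0 <= f x.

Let q0 : (0 < q)%R. Proof. exact: lt_trans q1. Qed.

Let fnu := fun x => f x * (nu x)%:E.

Let mfnu : measurable_fun [set: T] fnu.
Proof. exact: emeasurable_funM. Qed.

Let fnu0 x : 0 <= fnu x.
Proof. by rewrite mule_ge0// lee_fin. Qed.

(* With only finitely many sets in the family, the maximal function vanishes
   outside a set of finite mass; the error e^q of the discrete layer cake formula
   then has an integral that tends to 0 with e. *)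
Section truncated.
Variable N : nat.

Let c i : R := if (i < N)%N then (b i)^-1%R else 0%R.

Let c0 i : (0 <= c i)%R.
Proof. by rewrite /c; case: ifP => // _; rewrite invr_ge0 ltW. Qed.

Let M := maxop B c fnu.

Let high t x := if t%:E < f x then f x else 0.

Let mhigh t : measurable_fun [set: T] (fun x => high t x * (nu x)%:E).
Proof.
apply: emeasurable_funM => //; apply: measurable_fun_ifT => //.
exact: measurable_fun_lte.
Qed.

Let high0 t x : 0 <= high t x.
Proof. by rewrite /high; case: ifP. Qed.

(** Means of the part of f below half the level do not exceed half the level. *)
Lemma weak_type_high t : (0 < t)%R ->
  \int[mu]_(x in [set x | t%:E < M x]) (nu x)%:E <=
  (D / (t / 2))%:E * \int[mu]_x (high (t / 2) x * (nu x)%:E).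
Proof.
move=> t0; pose s := [seq i <- iota 0 N |
  t%:E < (b i)^-1%:E * \int[mu]_(y in B i) fnu y].
apply: (@weak_type s) => //.
- by rewrite divr_gt0.
- by move=> x; rewrite mule_ge0// lee_fin.
- rewrite -[X in measurable X]setTI; apply: emeasurable_fun_o_infty => //.
  exact: measurable_maxop.
- move=> x /= /(maxop_gt (ltW t0))[i Bx]; rewrite /c; case: ifP => [iN tB|_]; last first.
    by rewrite mul0e lte_fin ltNge (ltW t0).
  by exists i => //; rewrite mem_filter tB mem_iota.
- move=> i; rewrite mem_filter => /andP[tB _].
  have tb : (t * b i)%:E < \int[mu]_(y in B i) fnu y.
    by rewrite mulrC EFinM -lte_pdivlMl.
  have : \int[mu]_(y in B i) fnu y <= (t / 2 * b i)%:E +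
      \int[mu]_(x in B i) (high (t / 2) x * (nu x)%:E).
    rewrite EFinM -nuB -ge0_integralZl_EFin//; first last.
    + by rewrite divr_ge0// ltW.
    + exact: measurable_funTS.
    + by move=> x _; rewrite lee_fin.
    rewrite -ge0_integralD//; first last.
    + exact: measurable_funTS.
    + by move=> x _; rewrite mule_ge0// lee_fin.
    + by apply: measurable_funTS; apply: measurable_funeM.
    + by move=> x _; rewrite -EFinM lee_fin mulr_ge0// divr_ge0// ltW.
    apply: ge0_le_integral => //.
    + exact: measurable_funTS.
    + apply: measurable_funTS; apply: emeasurable_funD => //.
      exact: measurable_funeM.
    + move=> x _; rewrite -ge0_muleDl//; last by rewrite lee_fin divr_ge0// ltW.
      rewrite lee_wpmul2r// ?lee_fin// /high; case: ltP => [_|].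
        by rewrite leeDr// lee_fin divr_ge0// ltW.
      by rewrite adde0.
  move=> /(lt_le_trans tb).
  case: (\int[mu]_(x in B i) (high _ x * _)) => [r| |]//; last by rewrite leey.
  rewrite -EFinD !lte_fin lee_fin => H; rewrite ltW//; lra.
Qed.

(** Marcinkiewicz interpolation: the level set at height t is estimated by the
    weak type inequality for the part of f above t / 2 alone. *)
Lemma strong_type_truncated :
  \int[mu]_x (M x `^ q * (nu x)%:E) <=
  (D * 2 * 2 `^ q * (2 `^ (q - 1) / (2 `^ (q - 1) - 1)) * 2 `^ (q - 1))%:E *
  \int[mu]_x (f x `^ q * (nu x)%:E).
Proof.
set C := (D * 2 * _ * _ * _)%R.
set I := \int[mu]_x (f x `^ q * (nu x)%:E).
have q0' := ltW q0.
have mA t : measurable [set x | t%:E < M x].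
  rewrite -[X in measurable X]setTI; apply: emeasurable_fun_o_infty => //.
  exact: measurable_maxop.
have M0 x : 0 <= M x by exact: maxop_ge0.
pose U := \bigcup_(i in [set i | (i < N)%N]) B i.
have mU : measurable U by exact: bigcup_measurable.
pose V := (\sum_(i < N) b i)%R.
have V0 : (0 <= V)%R by apply: sumr_ge0 => i _; exact: ltW.
have UV : \int[mu]_(x in U) (nu x)%:E <= V%:E.
  rewrite -sumEFin -(big_mkord xpredT (fun i => (b i)%:E)).
  under eq_bigr do rewrite -nuB.
  apply: integral_cover_le => //.
  by move=> x [i /= iN Bx]; exists i; rewrite // mem_index_iota.
have MU x : ~ U x -> M x = 0.
  move=> xU; apply/eqP; rewrite eq_le M0 andbT; apply: maxop_le => // i Bx.
  by rewrite /c; case: ifP => [iN|_]; rewrite ?mul0e//; case: xU; exists i.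
have key e : (0 < e)%R ->
    \int[mu]_x (M x `^ q * (nu x)%:E) <= (e `^ q * V)%:E + C%:E * I.
  move=> e0.
  have e2k k : (0 < e * 2 ^+ k)%R by rewrite mulr_gt0 ?exprn_gt0.
  pose L k x := if (e * 2 ^+ k)%:E < M x then ((e * 2 ^+ k.+1) `^ q)%:E else 0.
  have L0 k x : 0 <= L k x by rewrite /L; case: ifP; rewrite ?lee_fin ?powR_ge0.
  have mL k : measurable_fun [set: T] (fun x => (nu x)%:E * L k x).
    apply: emeasurable_funM => //; apply: measurable_fun_ifT => //.
    by apply: measurable_fun_lte => //; exact: measurable_maxop.
  have nL0 k x : 0 <= (nu x)%:E * L k x by rewrite mule_ge0// lee_fin.
  have mUnu : measurable_fun [set: T] ((EFin \o nu) \_ U).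
    by apply/(measurable_restrictT _ mU)/measurable_funTS.
  have Unu0 x : 0 <= ((EFin \o nu) \_ U) x.
    by apply: erestrict_ge0 => y _; rewrite lee_fin.
  apply: (@le_trans _ _ (\int[mu]_x ((e `^ q)%:E * ((EFin \o nu) \_ U) x +
      \sum_(k <oo) (nu x)%:E * L k x))).
    apply: ge0_le_integral => //.
    - by move=> x _; rewrite mule_ge0 ?poweR_ge0// lee_fin.
    - apply: emeasurable_funM => //; apply: measurable_poweR_comp.
      exact: measurable_maxop.
    - apply: emeasurable_funD; first exact: measurable_funeM.
      exact: ge0_emeasurable_sum.
    - move=> x _; rewrite nneseriesZl; last by move=> k _; exact: L0.
      have SL0 : 0 <= \sum_(k <oo) L k x by exact: nneseries_ge0.
      rewrite {1}/patch; case: ifPn => [_|/negP xU].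
        rewrite /= [(nu x)%:E * _]muleC -ge0_muleDl//; last by rewrite lee_fin powR_ge0.
        by rewrite lee_wpmul2r ?lee_fin// poweR_le_levels.
      rewrite MU; last by move=> Ux; apply: xU; exact/mem_set.
      by rewrite poweR0r ?gt_eqF// mul0e mule0 add0e mule_ge0// lee_fin.
  rewrite ge0_integralD//; first last.
  - exact: ge0_emeasurable_sum.
  - by move=> x _; exact: nneseries_ge0.
  - exact: measurable_funeM.
  - by move=> x _; rewrite mule_ge0// lee_fin powR_ge0.
  rewrite integral_nneseries// ge0_integralZl_EFin ?powR_ge0//.
  rewrite -integral_mkcond EFinM; apply: leeD.
    by rewrite lee_wpmul2l// lee_fin powR_ge0.
  pose g k x := ((e * 2 ^+ k.+1) `^ q * (D / (e * 2 ^+ k / 2)))%:E *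
     (high (e * 2 ^+ k / 2) x * (nu x)%:E).
  have gc k : (0 <= (e * 2 ^+ k.+1) `^ q * (D / (e * 2 ^+ k / 2)))%R.
    by rewrite mulr_ge0 ?powR_ge0// divr_ge0 ?divr_ge0// ltW.
  have g0 k x : 0 <= g k x by rewrite mule_ge0 ?lee_fin// mule_ge0// lee_fin.
  have mg k : measurable_fun [set: T] (g k) by exact: measurable_funeM.
  apply: (@le_trans _ _ (\sum_(k <oo) \int[mu]_x g k x)).
    apply: lee_nneseries => [k _ _|k _]; first by apply: integral_ge0.
    rewrite (_ : (fun x => (nu x)%:E * L k x) = (fun x =>
      ((e * 2 ^+ k.+1) `^ q)%:E *
        ((EFin \o nu) \_ [set x | (e * 2 ^+ k)%:E < M x]) x)); last first.
      apply/funext => x; rewrite /L /patch; case: ifPn => [kM|kM].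
        by rewrite mem_set//= muleC.
      by rewrite memNset ?mule0//=; exact/negP.
    rewrite ge0_integralZl_EFin ?powR_ge0//; first last.
      by apply/(measurable_restrictT _ (mA _))/measurable_funTS.
      by move=> x _; apply: erestrict_ge0 => y _; rewrite lee_fin.
    rewrite -integral_mkcond ge0_integralZl_EFin//; last first.
      by move=> x _; rewrite mule_ge0// lee_fin.
    rewrite [leRHS](_ : _ = ((e * 2 ^+ k.+1) `^ q)%:E * ((D / (e * 2 ^+ k / 2))%:E * \int[mu]_x (high (e * 2 ^+ k / 2) x * (nu x)%:E))); last by rewrite muleA.
    rewrite lee_wpmul2l ?lee_fin ?powR_ge0//.
    exact: weak_type_high.
  rewrite -integral_nneseries// /I -ge0_integralZl_EFin//; first last.
  - by rewrite !mulr_ge0 ?powR_ge0 ?invr_ge0 ?subr_ge0 ?(ltW D0)// ltW// powR_gt1 ?ltr1n ?subr_gt0.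
  - apply: emeasurable_funM => //; exact: measurable_poweR_comp.
  - by move=> x _; rewrite mule_ge0 ?poweR_ge0// lee_fin.
  apply: ge0_le_integral => //.
  - by move=> x _; exact: nneseries_ge0.
  - exact: ge0_emeasurable_sum.
  - apply: measurable_funeM; apply: emeasurable_funM => //.
    exact: measurable_poweR_comp.
  move=> x _; rewrite muleA /g.
  under eq_eseriesr do rewrite muleA muleC.
  rewrite nneseriesZl; last first.
    by move=> k _; rewrite mule_ge0 ?lee_fin.
  by rewrite muleC lee_wpmul2r ?lee_fin// levels_le_poweR.
apply/lee_addgt0Pr => r r0.
have V1 : (0 < V + 1)%R by rewrite ltr_wpDl.
have e0 : (0 < (r / (V + 1)) `^ q^-1)%R by apply: powR_gt0; rewrite divr_gt0.
apply: (le_trans (key _ e0)); rewrite addeC leeD2l// lee_fin.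
rewrite -powRrM mulVf ?gt_eqF// powRr1; last by rewrite divr_ge0// ltW.
by rewrite mulrAC ler_pdivrMr// ler_wpM2l ?(ltW r0)// lerDl.
Qed.

End truncated.

Lemma strong_type :
  \int[mu]_x (maxop B (fun i => (b i)^-1%R) fnu x `^ q * (nu x)%:E) <=
  (D * 2 * 2 `^ q * (2 `^ (q - 1) / (2 `^ (q - 1) - 1)) * 2 `^ (q - 1))%:E *
  \int[mu]_x (f x `^ q * (nu x)%:E).
Proof.
set C := (D * 2 * _ * _ * _)%R; set M := maxop B _ fnu.
have q0' := ltW q0.
pose c N i : R := if (i < N)%N then (b i)^-1%R else 0%R.
pose MN N := maxop B (c N) fnu.
have c0 N i : (0 <= c N i)%R.
  by rewrite /c; case: ifP => // _; rewrite invr_ge0 ltW.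
have IB0 i : 0 <= \int[mu]_(y in B i) fnu y by exact: integral_ge0.
have MN0 N x : 0 <= MN N x by exact: maxop_ge0.
have M0 x : 0 <= M x by apply: maxop_ge0 => // i; rewrite invr_ge0 ltW.
pose g N x := MN N x `^ q * (nu x)%:E.
have g0 N x : 0 <= g N x by rewrite mule_ge0 ?poweR_ge0 ?lee_fin.
have mg N : measurable_fun [set: T] (g N).
  apply: emeasurable_funM => //; apply: measurable_poweR_comp.
  exact: measurable_maxop.
have le_c N N' i : (N <= N')%N -> (c N i <= c N' i)%R.
  move=> NN'; rewrite /c; case: (ltnP i N) => [iN|_]; first by rewrite (leq_trans iN).
  by case: ifP => // _; rewrite invr_ge0 ltW.
have ndg x : nondecreasing_seq (g ^~ x).
  move=> N N' NN'; rewrite /g lee_wpmul2r ?lee_fin// le_poweR//.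
  apply: maxop_le => // i Bx; apply: le_trans (maxop_ge _ _ Bx).
  by rewrite lee_wpmul2r// lee_fin le_c.
have -> : (fun x => M x `^ q * (nu x)%:E) = (fun x => limn (g ^~ x)).
  apply/funext => x.
  have /cvg_lim -> // := ereal_nondecreasing_cvgn (ndg x).
  apply/eqP; rewrite eq_le; apply/andP; split; last first.
    apply: ge_ereal_sup => _ [N _ <-]; rewrite lee_wpmul2r ?lee_fin// le_poweR//.
    apply: maxop_le => // i Bx; apply: le_trans (maxop_ge _ _ Bx).
    rewrite lee_wpmul2r// lee_fin /c; case: ifP => // _.
    by rewrite invr_ge0 ltW.
  set S := ereal_sup _.
  have gS N : g N x <= S by apply: ereal_sup_ubound; exists N.
  have S0 : 0 <= S by exact: le_trans (g0 0%N x) (gS 0%N).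
  have [nux0|nux] := eqVneq (nu x) 0%R; first by rewrite nux0 mule0.
  have {}nux : (0 < nu x)%R by rewrite lt0r nux nu0.
  rewrite muleC -lee_pdivlMl//; apply: poweR_ereal_sup_le => //.
  - move=> i; rewrite mule_ge0 ?integral_ge0// lee_fin mulr_ge0//.
    by rewrite invr_ge0 ltW.
  - by rewrite mule_ge0// lee_fin invr_ge0.
  - move=> i; rewrite lee_pdivlMl// muleC; apply: le_trans (gS i.+1).
    rewrite lee_wpmul2r ?lee_fin// le_poweR//.
      rewrite mule_ge0 ?integral_ge0// lee_fin mulr_ge0//.
      by rewrite invr_ge0 ltW.
    rewrite indicE; case: (boolP (x \in B i)) => [/set_mem Bx|_].
      apply: le_trans (maxop_ge _ _ Bx); rewrite mulr1 /c ltnSn//.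
    by rewrite mulr0 mul0e.
rewrite monotone_convergence//; apply: lime_le.
  apply: ereal_nondecreasing_is_cvgn => N N' NN'.
  by apply: ge0_le_integral => // x _; exact: ndg.
by apply: nearW => N; exact: strong_type_truncated.
Qed.
End strong_type.
End weighted_maximal.

(** * Dual weights and the A_p condition on a set *)

Section conjugate_exponents.
Context {R : realType}.
Implicit Types (p x a s l K : R).

Lemma conj_expB1 p : 1 < p -> conj_exp p - 1 = (p - 1)^-1.
Proof.
move=> p1; have ? : p - 1 != 0 by rewrite subr_eq0 gt_eqF.
by rewrite /conj_exp; field.
Qed.

Lemma subr1_conj_exp p : 1 < p -> 1 - conj_exp p = - (p - 1)^-1.
Proof. by move=> p1; rewrite -conj_expB1// opprB. Qed.

Lemma conj_exp_gt1 p : 1 < p -> 1 < conj_exp p.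
Proof. by move=> p1; rewrite -subr_gt0 conj_expB1// invr_gt0 subr_gt0. Qed.

Lemma conj_expK p : 1 < p -> conj_exp (conj_exp p) = p.
Proof.
move=> p1; have ? : p - 1 != 0 by rewrite subr_eq0 gt_eqF.
by rewrite {1}/conj_exp conj_expB1// /conj_exp; field.
Qed.

Lemma inv_conj_expD p : 1 < p -> p^-1 + (conj_exp p)^-1 = 1.
Proof.
move=> p1; have ? : p - 1 != 0 by rewrite subr_eq0 gt_eqF.
have ? : p != 0 by rewrite gt_eqF// (lt_trans ltr01).
by rewrite /conj_exp; field; rewrite ?andbT; apply/andP.
Qed.

Lemma dual_weightK p x : 1 < p -> 0 < x ->
  (x `^ (1 - conj_exp p)) `^ (1 - conj_exp (conj_exp p)) = x.
Proof.
move=> p1 x0; rewrite conj_expK// subr1_conj_exp// -powRrM.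
rewrite (_ : _ * _ = 1) ?powRr1 ?(ltW x0)//.
by field; rewrite subr_eq0 gt_eqF.
Qed.

(** The inequality of arithmetic and geometric means for x and x^(1 - p'),
    whose weights 1/p and 1/p' make the geometric mean equal to 1. *)
Lemma one_le_dual_mean p x : 1 < p -> 0 < x ->
  1 <= x / p + x `^ (1 - conj_exp p) / conj_exp p.
Proof.
move=> p1 x0; have p0 : 0 < p by rewrite (lt_trans ltr01).
have := @conjugate_powR R (x `^ p^-1) (x `^ (- p^-1)) p (conj_exp p)
  (powR_ge0 _ _) (powR_ge0 _ _) p0 _ (inv_conj_expD p1).
rewrite -powRD; last by rewrite (gt_eqF x0) implybT.
rewrite subrr powRr0 -!powRrM mulVf ?gt_eqF// powRr1 ?(ltW x0)//.
rewrite (_ : - p^-1 * conj_exp p = 1 - conj_exp p); last first.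
  rewrite subr1_conj_exp// /conj_exp; field.
  by rewrite subr_eq0 !gt_eqF.
by apply; rewrite (lt_trans ltr01)// conj_exp_gt1.
Qed.

End conjugate_exponents.

Section weights_on_a_set.
Context d (T : measurableType d) (R : realType).
Variable mu : {measure set T -> \bar R}.
Local Open Scope ereal_scope.
Implicit Types (w : T -> R) (A : set T) (p K : R).

Definition dual_weight p w x : R := (w x `^ (1 - conj_exp p))%R.

(** The A_p inequality on one set, written with masses rather than means, all of
    which are required to be finite and positive. *)
Definition ap_on p K w A : Prop := exists a s l : R,
  [/\ [/\ (0 < a)%R, (0 < s)%R & (0 < l)%R],
      mu A = l%:E, \int[mu]_(x in A) (w x)%:E = a%:E,
      \int[mu]_(x in A) (dual_weight p w x)%:E = s%:E &
      (a * s `^ (p - 1) <= K * l `^ p)%R].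

Lemma measurable_dual_weight p w : measurable_fun [set: T] w ->
  measurable_fun [set: T] (dual_weight p w).
Proof. by move=> mw; exact: (measurableT_comp (measurable_powR _)). Qed.

Lemma dual_weight_gt0 p w x : (0 < w x)%R -> (0 < dual_weight p w x)%R.
Proof. exact: powR_gt0. Qed.

Lemma ap_on_dual p K w A : (1 < p)%R -> (0 <= K)%R -> (forall x, 0 < w x)%R ->
  ap_on p K w A -> ap_on (conj_exp p) (K `^ (p - 1)^-1) (dual_weight p w) A.
Proof.
move=> p1 K0 w0 [a [s [l [[a0 s0 l0] Al Aa As ap]]]].
have p10 : (p - 1 != 0)%R by rewrite subr_eq0 gt_eqF.
have ip0 : (0 <= (p - 1)^-1)%R by rewrite invr_ge0 subr_ge0 ltW.
exists s, a, l; split => //.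
  by rewrite -Aa; apply: eq_integral => x _; rewrite /dual_weight dual_weightK.
rewrite conj_expB1//.
have := ge0_ler_powR ip0 _ _ ap.
rewrite !nnegrE !mulr_ge0 ?powR_ge0 ?(ltW a0)// => /(_ isT isT).
rewrite !powRM ?powR_ge0 ?(ltW a0)// -!powRrM divff// powRr1 ?(ltW s0)//.
by rewrite /conj_exp mulrC.
Qed.

(** Hoelder's inequality for 1 = w^(1/p) w^(-1/p). *)
Lemma ap_on_ge p w A (a s l : R) : (1 < p)%R -> (forall x, 0 < w x)%R ->
  measurable_fun [set: T] w -> measurable A ->
  (0 < a)%R -> (0 < l)%R -> mu A = l%:E -> \int[mu]_(x in A) (w x)%:E = a%:E ->
  \int[mu]_(x in A) (dual_weight p w x)%:E = s%:E ->
  (l `^ p <= a * s `^ (p - 1))%R.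
Proof.
move=> p1 w0 mw mA a0 l0 Al Aa As.
have p0 : (0 < p)%R by rewrite (lt_trans ltr01).
have q1 := conj_exp_gt1 p1; set q := conj_exp p in q1 *.
have q0 : (0 < q)%R by rewrite (lt_trans ltr01).
pose t := (l / a)%R; have t0 : (0 < t)%R by rewrite divr_gt0.
have mwE : measurable_fun A (fun x => (w x)%:E).
  by apply/measurable_EFinP; exact: measurable_funTS.
have msE : measurable_fun A (fun x => (dual_weight p w x)%:E).
  by apply/measurable_EFinP/measurable_funTS; exact: measurable_dual_weight.
have : l%:E <= \int[mu]_(x in A) ((t / p)%:E * (w x)%:E +
    (t `^ (1 - q) / q)%:E * (dual_weight p w x)%:E).
  rewrite -Al -[leLHS]mul1e -integral_cst//.
  apply: ge0_le_integral => //.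
    by apply: emeasurable_funD; exact: measurable_funeM.
  move=> x _; rewrite -!EFinM -EFinD lee_fin.
  apply: le_trans (one_le_dual_mean p1 (mulr_gt0 t0 (w0 x))) _.
  rewrite powRM ?(ltW t0) ?(ltW (w0 x))// le_eqVlt; apply/orP; left; apply/eqP.
  by rewrite /dual_weight -/q; ring.
rewrite ge0_integralD//; first last.
- exact: measurable_funeM.
- by move=> x _; rewrite -EFinM lee_fin !mulr_ge0 ?powR_ge0 ?invr_ge0// ltW.
- exact: measurable_funeM.
- by move=> x _; rewrite -EFinM lee_fin !mulr_ge0 ?powR_ge0 ?invr_ge0// ltW.
rewrite !ge0_integralZl_EFin//; first last.
- by rewrite divr_ge0// ltW.
- by move=> x _; rewrite lee_fin ltW.
- by rewrite divr_ge0 ?powR_ge0// ltW.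
- by move=> x _; rewrite lee_fin powR_ge0.
rewrite Aa As -!EFinM -EFinD lee_fin => H.
have {}H : (l <= t `^ (1 - q) * s)%R.
  have tal : (t / p * a = l / p)%R by rewrite /t; field; rewrite !gt_eqF.
  move: H; rewrite tal -lerBlDl.
  have -> : (l - l / p = l / q)%R.
    rewrite -{1}[l]mulr1 -(inv_conj_expD p1) -/q; ring.
  by rewrite mulrAC ler_pM2r ?invr_gt0.
have s0 : (0 <= s)%R by rewrite -lee_fin -As integral_ge0// => x _; rewrite lee_fin powR_ge0.
have p10 : (0 <= p - 1)%R by rewrite subr_ge0 ltW.
have := ge0_ler_powR p10 _ _ H; rewrite !nnegrE (ltW l0) mulr_ge0 ?powR_ge0//.
move=> /(_ isT isT); rewrite powRM ?powR_ge0// -powRrM.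
rewrite subr1_conj_exp// mulNr mulVf ?subr_eq0 ?gt_eqF// powR_inv1 ?(ltW t0)//.
rewrite /t invf_div mulrAC ler_pdivlMr// mulrC mulr_powRB1 ?(ltW l0) ?(ltW p0)//.
Qed.

End weights_on_a_set.

(** * Muckenhoupt's theorem and the Rubio de Francia algorithm *)

Section muckenhoupt_theorem.
Context d (T : measurableType d) (R : realType).
Variable mu : {measure set T -> \bar R}.
Local Open Scope ereal_scope.
Implicit Types (w : T -> R) (A : set T) (p K : R).

(** The A_p inequality on the larger set bounds its mass from above, and Hoelder's
    inequality on the smaller one bounds its mass from below; both bounds are in
    terms of the dual masses, which are ordered. *)
Lemma ap_on_doubling p K D0 w A A' : (1 < p)%R -> (0 < D0)%R -> (0 <= K)%R ->
  (forall x, 0 < w x)%R -> measurable_fun [set: T] w ->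
  measurable A -> measurable A' -> A `<=` A' ->
  mu A' <= D0%:E * mu A -> ap_on mu p K w A -> ap_on mu p K w A' ->
  \int[mu]_(x in A') (w x)%:E <= (K * D0 `^ p)%:E * \int[mu]_(x in A) (w x)%:E.
Proof.
move=> p1 D00 K0 w0 mw mA mA' AA' DA [a [s [l [[a0 s0 l0] Al Aa As _]]]].
move=> [a' [s' [l' [[a'0 s'0 l'0] Al' Aa' As' ap]]]].
have p0 : (0 < p)%R by rewrite (lt_trans ltr01).
have H := ap_on_ge p1 w0 mw mA a0 l0 Al Aa As.
have ss' : (s <= s')%R.
  rewrite -lee_fin -As -As'; apply: ge0_subset_integral => //.
    by apply/measurable_EFinP/measurable_funTS; exact: measurable_dual_weight.
  by move=> x _; rewrite lee_fin powR_ge0.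
move: DA; rewrite Al Al' -EFinM lee_fin => DA.
rewrite Aa Aa' -EFinM lee_fin -(@ler_pM2r _ (s' `^ (p - 1))) ?powR_gt0//.
apply: (le_trans ap); rewrite -!mulrA ler_wpM2l//.
apply: (@le_trans _ _ ((D0 * l) `^ p)%R).
  by rewrite ge0_ler_powR ?nnegrE ?mulr_ge0// ltW.
rewrite powRM ?(ltW D00) ?(ltW l0)// ler_wpM2l ?powR_ge0//.
apply: (le_trans H); rewrite ler_wpM2l ?(ltW a0)//.
by rewrite ge0_ler_powR ?nnegrE ?subr_ge0// ltW.
Qed.

Variables (B Bs : nat -> set T) (rad : nat -> R) (D0 : R).
Hypothesis mB : forall i, measurable (B i).
Hypothesis mBs : forall i, measurable (Bs i).
Hypothesis engulf : forall i j, B i `&` B j !=set0 -> (rad i <= rad j)%R ->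
  B i `<=` Bs j.
Hypothesis BBs : forall i, B i `<=` Bs i.
Hypothesis D00 : (0 < D0)%R.
Hypothesis muBs : forall i, mu (Bs i) <= D0%:E * mu (B i).

Let mean := maxop mu B (fun i => (fine (mu (B i)))^-1%R).

Lemma measurable_inv_weight w : measurable_fun [set: T] w ->
  (forall x, 0 < w x)%R -> measurable_fun [set: T] (fun x => ((w x)^-1)%:E).
Proof.
move=> mw w0; apply/measurable_EFinP.
under eq_fun do rewrite -powR_inv1 ?ltW//.
exact: (measurableT_comp (measurable_powR _)).
Qed.

Definition ap_class p K w : Prop :=
  [/\ measurable_fun [set: T] w, forall x, (0 < w x)%R,
      forall i, ap_on mu p K w (B i) & forall i, ap_on mu p K w (Bs i)].

Lemma ap_class_dual p K w : (1 < p)%R -> (0 <= K)%R -> ap_class p K w ->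
  ap_class (conj_exp p) (K `^ (p - 1)^-1) (dual_weight p w).
Proof.
move=> p1 K0 [mw w0 apB apBs]; split.
- exact: measurable_dual_weight.
- by move=> x; exact: dual_weight_gt0.
- by move=> i; exact: ap_on_dual.
- by move=> i; exact: ap_on_dual.
Qed.

(** The constant in the strong type inequality, as a function of the exponent and
    of the doubling constant. *)
Definition maxop_const (q D : R) : R :=
  (D * 2 * 2 `^ q * (2 `^ (q - 1) / (2 `^ (q - 1) - 1)) * 2 `^ (q - 1))%R.

Lemma maxop_const_gt0 q D : (1 < q)%R -> (0 < D)%R -> (0 < maxop_const q D)%R.
Proof.
move=> q1 D1; rewrite !mulr_gt0 ?invr_gt0 ?powR_gt0// subr_gt0.
by rewrite powR_gt1 ?ltr1n ?subr_gt0.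
Qed.

(** The means for the weight itself are bounded on L^q(w) for every 1 < q. *)
Lemma weighted_maxop_bound p K q w f : (1 < p)%R -> (0 < K)%R -> (1 < q)%R ->
  ap_class p K w -> measurable_fun [set: T] f -> (forall x, 0 <= f x) ->
  \int[mu]_x (maxop mu B (fun i => (fine (\int[mu]_(y in B i) (w y)%:E))^-1%R)
     (fun x => f x * (w x)%:E) x `^ q * (w x)%:E) <=
  (maxop_const q (K * D0 `^ p))%:E * \int[mu]_x (f x `^ q * (w x)%:E).
Proof.
move=> p1 K0 q1 [mw w0 apB apBs] mf f0.
have wB i : \int[mu]_(y in B i) (w y)%:E = (fine (\int[mu]_(y in B i) (w y)%:E))%:E.
  by have [a [s [l [_ _ -> _ _]]]] := apB i.
apply: (strong_type mB mBs engulf) => //.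
- by move=> x; rewrite ltW.
- move=> i; have [a [s [l [[a0 _ _] _ -> _ _]]]] := apB i; exact: a0.
- by rewrite mulr_gt0 ?powR_gt0.
- move=> i; rewrite EFinM -wB; apply: ap_on_doubling => //; exact: ltW.
Qed.

(** The two weights are balanced on each set by the A_p inequality, so the
    maximal operator is dominated by two maximal operators whose means are taken
    with respect to the dual weight and to the weight; both are bounded as these
    two weights are doubling.  The estimate is Lerner's. *)
Lemma muckenhoupt_bound p K : (1 < p)%R -> (0 < K)%R ->
  exists2 C : R, (0 < C)%R & forall w f, ap_class p K w ->
    measurable_fun [set: T] f -> (forall x, 0 <= f x) ->
    \int[mu]_x (mean f x `^ p * (w x)%:E) <=
    C%:E * \int[mu]_x (f x `^ p * (w x)%:E).
Proof.
move=> p1 K0; set q := conj_exp p.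
have q1 : (1 < q)%R by exact: conj_exp_gt1.
have p0 : (0 < p)%R by rewrite (lt_trans ltr01).
have p10 : (0 < p - 1)%R by rewrite subr_gt0.
have q0 : (0 < q)%R by rewrite (lt_trans ltr01).
pose K' := (K `^ (p - 1)^-1)%R.
have K'0 : (0 < K')%R by rewrite powR_gt0.
pose C1 := maxop_const q (K * D0 `^ p); pose C2 := maxop_const p (K' * D0 `^ q).
have C10 : (0 < C1)%R by rewrite maxop_const_gt0// mulr_gt0 ?powR_gt0.
have C20 : (0 < C2)%R by rewrite maxop_const_gt0// mulr_gt0 ?powR_gt0.
exists (K `^ q * (C1 * C2))%R; first by apply: mulr_gt0; [exact: powR_gt0|exact: mulr_gt0].
move=> w f apw mf f0; have [mw w0 apB apBs] := apw.
have [mv v0 dapB dapBs] := ap_class_dual p1 (ltW K0) apw.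
set v := dual_weight p w in mv v0 dapB dapBs *.
pose s i := fine (\int[mu]_(y in B i) (v y)%:E).
pose a i := fine (\int[mu]_(y in B i) (w y)%:E).
pose l i := fine (mu (B i)).
have apE i : [/\ (0 < a i)%R, (0 < s i)%R, (0 < l i)%R &
    mu (B i) = (l i)%:E /\ (a i * s i `^ (p - 1) <= K * l i `^ p)%R].
  rewrite /a /s /l; have [a1 [s1 [l1 [[a0 s0 l0] -> -> -> ap]]]] := apB i.
  by split.
pose f' x := f x * ((v x)^-1)%:E.
have mf' : measurable_fun [set: T] f'.
  by apply: emeasurable_funM => //; exact: measurable_inv_weight.
have f'0 x : 0 <= f' x by rewrite mule_ge0// lee_fin invr_ge0 ltW.
have f'E x : f' x * (v x)%:E = f x.
  by rewrite /f' -muleA -EFinM mulVf ?mule1// gt_eqF.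
pose g := maxop mu B (fun i => (s i)^-1%R) f.
have mg : measurable_fun [set: T] g by exact: measurable_maxop.
have g0 x : 0 <= g x.
  by apply: maxop_ge0 => // i; rewrite invr_ge0 ltW//; have [_ ->] := apE i.
pose h x := g x `^ (p - 1) * ((w x)^-1)%:E.
have mh : measurable_fun [set: T] h.
  apply: emeasurable_funM => //; first exact: measurable_poweR_comp.
  exact: measurable_inv_weight.
have h0 x : 0 <= h x by rewrite mule_ge0 ?poweR_ge0// lee_fin invr_ge0 ltW.
have hE x : h x * (w x)%:E = g x `^ (p - 1).
  by rewrite /h -muleA -EFinM mulVf ?mule1// gt_eqF.
pose G := maxop mu B (fun i => (a i)^-1%R) (fun x => h x * (w x)%:E).
have G0 x : 0 <= G x.
  apply: maxop_ge0 => // [i|y]; last by rewrite mule_ge0// lee_fin ltW.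
  by rewrite invr_ge0 ltW//; have [->] := apE i.
(* On a set of the family, the mean of f is s / l times its mean for the dual
   weight, which is at most g throughout the set, and the A_p inequality replaces
   (s / l)^(p - 1) by K l / a. *)
have lerner x : mean f x `^ p <= (K `^ q)%:E * G x `^ q.
  have -> : p = ((p - 1) * q)%R.
    by rewrite /q /conj_exp mulrC divfK// gt_eqF.
  rewrite poweRrM -poweR_EFin -poweRM ?lee_fin ?(ltW K0)//.
  apply: le_poweR; [exact: ltW|exact: poweR_ge0|].
  apply: poweR_ereal_sup_le => //.
  + by move=> i; rewrite mule_ge0 ?integral_ge0// lee_fin mulr_ge0.
  + by rewrite mule_ge0// lee_fin ltW.
  move=> i; have [ai si li [muB ap]] := apE i; rewrite -/(l i).
  rewrite indicE; case: (boolP (x \in B i)) => [/set_mem Bx|_]; last first.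
    by rewrite mulr0 mul0e poweR0r ?gt_eqF// mule_ge0// lee_fin ltW.
  rewrite mulr1; set X := \int[mu]_(y in B i) f y.
  have X0 : 0 <= X by exact: integral_ge0.
  apply: (@le_trans _ _ (K%:E * ((a i)^-1%:E *
      \int[mu]_(y in B i) (h y * (w y)%:E)))); last first.
    by rewrite lee_wpmul2l ?lee_fin ?(ltW K0)//; exact: maxop_ge.
  under eq_integral do rewrite hE.
  apply: (@le_trans _ _ (K%:E * ((a i)^-1%:E *
      (((s i)^-1%:E * X) `^ (p - 1) * (l i)%:E)))); last first.
    rewrite !lee_wpmul2l ?lee_fin ?invr_ge0 ?(ltW K0) ?(ltW ai)//.
    rewrite -muB -integral_cst//; apply: ge0_le_integral => //.
    + by move=> y _; exact: poweR_ge0.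
    + by apply: measurable_funTS; exact: measurable_poweR_comp.
    + move=> y By; apply: le_poweR; first exact: ltW.
        by rewrite mule_ge0// lee_fin invr_ge0 ltW.
      exact: maxop_ge.
  have -> : (l i)^-1%:E * X = (s i / l i)%:E * ((s i)^-1%:E * X).
    rewrite muleA -EFinM; congr (_%:E * _); by field; rewrite !gt_eqF.
  have Y0 : 0 <= (s i)^-1%:E * X by rewrite mule_ge0// lee_fin invr_ge0 ltW.
  rewrite poweRM ?lee_fin ?divr_ge0 ?(ltW si) ?(ltW li)//.
  rewrite [_ * (l i)%:E]muleC !muleA -!EFinM lee_wpmul2r ?poweR_ge0//.
  rewrite poweR_EFin lee_fin powRM ?invr_ge0 ?(ltW si) ?(ltW li)//.
  rewrite -[((l i)^-1)%R]powR_inv1 ?(ltW li)// -powRrM mulN1r powRN.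
  rewrite ler_pdivrMr ?powR_gt0// -[leRHS]mulrA mulr_powRB1 ?(ltW li)//.
  by rewrite mulrAC ler_pdivlMr// mulrC.
have mG : measurable_fun [set: T] G by exact: measurable_maxop.
apply: (@le_trans _ _ ((K `^ q)%:E * \int[mu]_x (G x `^ q * (w x)%:E))).
  rewrite -ge0_integralZl_EFin ?powR_ge0//; first last.
  - by apply: emeasurable_funM; [exact: measurable_poweR_comp|exact/measurable_EFinP].
  - by move=> x _; rewrite mule_ge0 ?poweR_ge0// lee_fin ltW.
  apply: ge0_le_integral => //.
  - by move=> x _; rewrite mule_ge0 ?poweR_ge0// lee_fin ltW.
  - apply: emeasurable_funM; last exact/measurable_EFinP.
    by apply: measurable_poweR_comp; exact: measurable_maxop.
  - apply: measurable_funeM.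
    by apply: emeasurable_funM; [exact: measurable_poweR_comp|exact/measurable_EFinP].
  - by move=> x _; rewrite muleA lee_wpmul2r ?lee_fin ?lerner// ltW.
rewrite EFinM -muleA lee_wpmul2l ?lee_fin ?powR_ge0//.
apply: le_trans (weighted_maxop_bound p1 K0 q1 apw mh h0) _.
rewrite [(C1 * C2)%:E]EFinM -muleA lee_wpmul2l ?lee_fin ?(ltW C10)//.
have := weighted_maxop_bound q1 K'0 p1 (ap_class_dual p1 (ltW K0) apw) mf' f'0.
rewrite -/v; under [X in maxop _ _ _ X]eq_fun do rewrite f'E.
rewrite (_ : \int[mu]_x (f' x `^ p * (v x)%:E) = \int[mu]_x (f x `^ p * (w x)%:E)).
  apply: le_trans; rewrite le_eqVlt; apply/orP; left; apply/eqP.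
  apply: eq_integral => x _; rewrite /h poweRM ?poweR_ge0 ?lee_fin ?invr_ge0 ?(ltW (w0 x))//.
  rewrite -poweRrM (_ : (p - 1) * q = p)%R; last first.
    by rewrite /q /conj_exp mulrC divfK// gt_eqF.
  rewrite -muleA; congr (_ * _); rewrite poweR_EFin -EFinM; congr EFin.
  rewrite -powR_inv1 ?(ltW (w0 x))// -powRrM -[X in (_ * X)%R]powRr1 ?(ltW (w0 x))//.
  by rewrite -powRD ?(gt_eqF (w0 x)) ?implybT// mulN1r addrC.
apply: eq_integral => x _; rewrite /f' poweRM ?lee_fin ?invr_ge0 ?(ltW (v0 x))//.
rewrite -muleA; congr (_ * _); rewrite poweR_EFin -EFinM; congr EFin.
rewrite -powR_inv1 ?(ltW (v0 x))// -powRrM -[X in (_ * X)%R]powRr1 ?(ltW (v0 x))//.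
rewrite -powRD ?(gt_eqF (v0 x)) ?implybT// mulN1r addrC.
by rewrite -[in LHS](conj_expK p1) -/q dual_weightK.
Qed.


(** A function of small norm to be added to a given one, so that the sum of the
    iterated means is positive even where the given function vanishes. *)
Lemma exists_small_positive p K w (eta : R) : (1 < p)%R -> ap_class p K w ->
  (forall x, exists i, B i x) -> (0 < eta)%R ->
  exists e : T -> \bar R, [/\ measurable_fun [set: T] e, forall x, 0 < e x &
    \int[mu]_x (e x `^ p * (w x)%:E) <= eta%:E].
Proof.
move=> p1 [mw w0 apB _] cB eta0; have p0 : (0 < p)%R by rewrite (lt_trans ltr01).
pose a i := fine (\int[mu]_(y in B i) (w y)%:E).
have aE i : (0 < a i)%R /\ \int[mu]_(y in B i) (w y)%:E = (a i)%:E.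
  by rewrite /a; have [a1 [s1 [l1 [[? ? ?] _ -> _ _]]]] := apB i.
pose t k x : \bar R := (eta / 2 * 2^-1 ^+ k / a k * \1_(B k) x)%:E.
have c0 k : (0 < eta / 2 * 2^-1 ^+ k / a k)%R.
  have [a0 _] := aE k.
  by rewrite divr_gt0// mulr_gt0 ?divr_gt0 ?exprn_gt0// invr_gt0.
have t0 k x : 0 <= t k x by rewrite lee_fin mulr_ge0// ltW.
have mt k : measurable_fun [set: T] (t k).
  by apply/measurable_EFinP/measurable_funM => //; exact: measurable_indic.
pose E x := \sum_(k <oo) t k x.
have E0 x : 0 <= E x by exact: nneseries_ge0.
have mE : measurable_fun [set: T] E by exact: ge0_emeasurable_sum.
exists (fun x => E x `^ p^-1); split.
- exact: measurable_poweR_comp.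
- move=> x; apply: poweR_gt0; have [i Bx] := cB x.
  apply: (@lt_le_trans _ _ (t i x)).
    by rewrite lte_fin mulr_gt0// indicE mem_set.
  apply: le_trans (nneseries_lim_ge i.+1 (fun n _ _ => t0 n x)).
  by rewrite big_nat_recr//= leeDr// sume_ge0.
rewrite (eq_integral (fun x => \sum_(k <oo) (w x)%:E * t k x)); last first.
  move=> x _; rewrite poweRVK ?gt_eqF// nneseriesZl//; first by rewrite muleC.
rewrite integral_nneseries//; first last.
- by move=> k x _; rewrite mule_ge0// lee_fin ltW.
- by move=> k; apply: emeasurable_funM => //; exact/measurable_EFinP.
have -> : eta = (eta / 2 / (1 - 2^-1))%R by field.
apply: le_trans (_ : \sum_(k <oo) (eta / 2 * 2^-1 ^+ k)%:E <= _); last first.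
  apply: geometric_eseries_le; first by rewrite divr_ge0// ltW.
  by rewrite invr_ge0 ler0n/= invf_lt1 ?ltr1n.
apply: lee_nneseries => k _ => [_|].
  by apply: integral_ge0 => x _; rewrite mule_ge0// lee_fin ltW.
have [ak0 wBk] := aE k.
rewrite (eq_integral (fun x => (eta / 2 * 2^-1 ^+ k / a k)%:E *
    ((EFin \o w) \_ (B k)) x)); last first.
  move=> x _; rewrite /t /patch indicE; case: ifPn => _ /=.
    by rewrite mulr1 muleC.
  by rewrite mulr0 !mule0.
rewrite ge0_integralZl_EFin//; first last.
- exact: ltW.
- by apply/(measurable_restrictT _ (mB k))/measurable_funTS/measurable_EFinP.
- by move=> x _; apply: erestrict_ge0 => y _; rewrite lee_fin ltW.
rewrite -integral_mkcond wBk -EFinM lee_fin divfK// gt_eqF//.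
Qed.

(** The algorithm of Rubio de Francia: the sum of the iterates of the maximal
    operator, with weights decaying faster than its norm grows, is dominated by
    its own means.  A supremum in place of the sum would make the norm estimate
    as easy, but it would not commute with means. *)
Lemma rubio_de_francia p K : (1 < p)%R -> (0 < K)%R ->
  (forall x, exists i, B i x) ->
  exists2 C : R, (0 < C)%R & forall w h (eta : R), ap_class p K w ->
    measurable_fun [set: T] h -> (forall x, 0 <= h x) -> (0 < eta)%R ->
    \int[mu]_x (h x `^ p * (w x)%:E) < +oo ->
    exists H : T -> R, [/\ measurable_fun [set: T] H, forall x, (0 < H x)%R,
      {ae mu, forall x, h x <= (H x)%:E},
      \int[mu]_x ((H x)%:E `^ p * (w x)%:E) <=
        C%:E * (\int[mu]_x (h x `^ p * (w x)%:E) + eta%:E) &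
      forall i, {ae mu, forall x, B i x ->
        \int[mu]_(y in B i) (H y)%:E <= (C * H x)%:E * mu (B i)}].
Proof.
move=> p1 K0 cB; have p0 : (0 < p)%R by rewrite (lt_trans ltr01).
have [C0 C00 Mbound] := muckenhoupt_bound p1 K0.
pose c := (C0 `^ p^-1)%R.
have c0 : (0 < c)%R by rewrite powR_gt0.
have cp : (c `^ p = C0)%R by rewrite -powRrM mulVf ?gt_eqF// powRr1// ltW.
exists (Num.max (2 `^ p * 2) (4 * c))%R.
  by rewrite lt_max mulr_gt0 ?powR_gt0.
move=> w h eta apw mh h0 eta0 hfin; have [mw w0 apB apBs] := apw.
have [e [me e0 ew]] := exists_small_positive p1 apw cB eta0.
have mwE : measurable_fun [set: T] (fun x => (w x)%:E) by exact/measurable_EFinP.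
pose h1 x := maxe (h x) (e x).
have mh1 : measurable_fun [set: T] h1 by exact: measurable_maxe.
have h10 x : 0 <= h1 x by rewrite /h1 le_max h0.
pose S u x := c^-1%:E * mean u x.
pose F k := iter k S h1.
have mean0 u x : (forall x, 0 <= u x) -> 0 <= mean u x.
  by move=> u0; apply: maxop_ge0.
have F0 k x : 0 <= F k x.
  elim: k x => [|k IH] x; first exact: h10.
  by rewrite /F iterS -/(F k) mule_ge0 ?mean0// lee_fin invr_ge0 ltW.
have mF k : measurable_fun [set: T] (F k).
  case: k => [//|k]; rewrite /F iterS; apply: measurable_funeM.
  exact: measurable_maxop.
have pw u : measurable_fun [set: T] u ->
    measurable_fun [set: T] (fun x => u x `^ p * (w x)%:E).
  by move=> mu_; apply: emeasurable_funM => //; exact: measurable_poweR_comp.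
have pw0 (u : T -> \bar R) x : 0 <= u x `^ p * (w x)%:E.
  by rewrite mule_ge0 ?poweR_ge0// lee_fin ltW.
pose I1 := \int[mu]_x (h1 x `^ p * (w x)%:E).
have I1le : I1 <= \int[mu]_x (h x `^ p * (w x)%:E) + eta%:E.
  apply: (@le_trans _ _ (\int[mu]_x (h x `^ p * (w x)%:E + e x `^ p * (w x)%:E))).
    apply: ge0_le_integral => //; [exact: pw|by apply: emeasurable_funD; exact: pw|].
    move=> x _; rewrite /h1; case: (leP (h x) (e x)) => _; rewrite ?leeDl ?leeDr//.
  by rewrite ge0_integralD// ?leeD2l//; exact: pw.
have IF k : \int[mu]_x (F k x `^ p * (w x)%:E) <= I1.
  elim: k => [//|k IH].
  apply: le_trans IH.
  rewrite (eq_integral (fun x => C0^-1%:E * (mean (F k) x `^ p * (w x)%:E))).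
    rewrite ge0_integralZl_EFin//; first last.
    - by rewrite invr_ge0 ltW.
    - by apply: pw; exact: measurable_maxop.
    by rewrite lee_pdivrMl//; exact: Mbound.
  move=> x _; rewrite /F iterS -/(F k) poweRM ?mean0 ?lee_fin ?invr_ge0 ?(ltW c0)//.
  rewrite -muleA; congr (_ * _); rewrite poweR_EFin; congr EFin.
  by rewrite -powR_inv1 ?(ltW c0)// powRAC cp powR_inv1// ltW.
(* One factor 2^-k of 4^-k bounds the sum by twice a supremum, and the other
   makes the p-th powers summable. *)
pose H0 x := \sum_(k <oo) (4^-1 ^+ k)%:E * F k x.
have q40 k : (0 <= 4^-1 ^+ k :> R)%R by rewrite exprn_ge0 ?invr_ge0.
have q20 k : (0 <= 2^-1 ^+ k :> R)%R by rewrite exprn_ge0 ?invr_ge0.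
have tH0 k x : 0 <= (4^-1 ^+ k)%:E * F k x by rewrite mule_ge0 ?lee_fin.
have H00 x : 0 <= H0 x by exact: nneseries_ge0.
have mH0 : measurable_fun [set: T] H0.
  by apply: ge0_emeasurable_sum => // k _; exact: measurable_funeM.
have h1H0 x : h1 x <= H0 x.
  apply: le_trans (nneseries_lim_ge 1 (fun n _ _ => tH0 n x)).
  by rewrite big_nat1 expr0 mul1e.
have H0_gt0 x : 0 < H0 x.
  by apply: lt_le_trans (h1H0 x); rewrite lt_max e0 orbT.
have H0p x : H0 x `^ p <= (2 `^ p)%:E * \sum_(k <oo) (2^-1 ^+ k)%:E * F k x `^ p.
  pose s := ereal_sup (range (fun k => (2^-1 ^+ k)%:E * F k x)).
  have s0 : 0 <= s.
    apply: (@le_trans _ _ ((2^-1 ^+ 0)%:E * F 0%N x)).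
      by rewrite mule_ge0// lee_fin.
    by apply: ereal_sup_ubound; exists 0%N.
  have Hs : H0 x <= 2%:E * s.
    apply: (@le_trans _ _ (\sum_(k <oo) (2^-1 ^+ k)%:E * s)).
      apply: lee_nneseries => [//|k _].
      rewrite (_ : 4^-1 = 2^-1 * 2^-1)%R; last by field.
      rewrite exprMn EFinM -muleA lee_wpmul2l ?lee_fin//.
      by apply: ereal_sup_ubound; exists k.
    under eq_eseriesr do rewrite muleC.
    case: (s) s0 => [r r0| _|//]; last by rewrite gt0_muley ?leey.
    rewrite nneseriesZl; last by move=> k _; rewrite lee_fin.
    rewrite muleC lee_wpmul2r//.
    have := @geometric_eseries_le R 1 2^-1 ler01.
    rewrite invr_ge0 ler0n invf_lt1 ?ltr1n// => /(_ isT).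
    rewrite (_ : 1 / (1 - 2^-1) = 2)%R; last by field.
    by under eq_eseriesr do rewrite mul1r.
  apply: (@le_trans _ _ ((2%:E * s) `^ p)); first by apply: le_poweR => //; exact: ltW.
  have Fk0 k : 0 <= (2^-1 ^+ k)%:E * F k x by rewrite mule_ge0 ?lee_fin.
  rewrite poweRM ?lee_fin// lee_wpmul2l ?lee_fin ?powR_ge0//; apply: poweR_ereal_sup_le => //.
    by apply: nneseries_ge0 => k _ _; rewrite mule_ge0 ?poweR_ge0 ?lee_fin.
  move=> k; rewrite poweRM ?lee_fin//.
  have t0 n : 0 <= (2^-1 ^+ n)%:E * F n x `^ p.
    by rewrite mule_ge0 ?poweR_ge0 ?lee_fin.
  apply: le_trans (nneseries_lim_ge k.+1 (fun n _ _ => t0 n)).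
  rewrite big_nat_recr//=; apply: le_trans (leeDr _ _); last exact: sume_ge0.
  rewrite lee_wpmul2r ?poweR_ge0// lee_fin; apply: ge1r_powR; last exact: ltW.
  by rewrite exprn_gt0 ?invr_gt0//= exprn_ile1 ?invr_ge0// invf_le1 ?ler1n.
have IH0 : \int[mu]_x (H0 x `^ p * (w x)%:E) <= (2 `^ p * 2)%:E * I1.
  have t0 (k : nat) x : 0 <= (2^-1 ^+ k)%:E * (F k x `^ p * (w x)%:E).
    by rewrite mule_ge0 ?lee_fin.
  have mt k : measurable_fun [set: T] (fun x => (2^-1 ^+ k)%:E * (F k x `^ p * (w x)%:E)).
    by apply: measurable_funeM; exact: pw.
  apply: (@le_trans _ _ (\int[mu]_x ((2 `^ p)%:E *
      \sum_(k <oo) (2^-1 ^+ k)%:E * (F k x `^ p * (w x)%:E)))).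
    apply: ge0_le_integral => //; first exact: pw.
      by apply: measurable_funeM; exact: ge0_emeasurable_sum.
    move=> x _; apply: (@le_trans _ _ ((2 `^ p)%:E *
      (\sum_(k <oo) (2^-1 ^+ k)%:E * F k x `^ p) * (w x)%:E)).
      by rewrite lee_wpmul2r// lee_fin ltW.
    rewrite -muleA lee_wpmul2l ?lee_fin ?powR_ge0// muleC.
    rewrite -nneseriesZl; last by move=> k _; rewrite mule_ge0 ?poweR_ge0 ?lee_fin.
    by under eq_eseriesr do rewrite muleC -muleA.
  rewrite ge0_integralZl_EFin ?powR_ge0//; first last.
  - exact: ge0_emeasurable_sum.
  - by move=> x _; exact: nneseries_ge0.
  rewrite EFinM -muleA lee_wpmul2l ?lee_fin ?powR_ge0//.
  rewrite integral_nneseries//.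
  apply: (@le_trans _ _ (\sum_(k <oo) I1 * (2^-1 ^+ k)%:E)).
    apply: lee_nneseries => k _ => [_|]; first exact: integral_ge0.
    rewrite ge0_integralZl_EFin//; last exact: pw.
    by rewrite muleC lee_wpmul2r ?lee_fin.
  have I10 : 0 <= I1 by exact: integral_ge0.
  case: (I1) I10 => [r r0| _|//]; last by rewrite gt0_muley ?leey.
  rewrite nneseriesZl; last by move=> k _; rewrite lee_fin.
  rewrite muleC lee_wpmul2r//.
  have := @geometric_eseries_le R 1 2^-1 ler01.
  rewrite invr_ge0 ler0n invf_lt1 ?ltr1n// => /(_ isT).
  rewrite (_ : 1 / (1 - 2^-1) = 2)%R; last by field.
  by under eq_eseriesr do rewrite mul1r.
have meanH0 i x : B i x -> \int[mu]_(y in B i) H0 y <= (4 * c)%:E * H0 x * mu (B i).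
  move=> Bx; have [a1 [s1 [l [[_ _ l0] muB _ _ _]]]] := apB i.
  rewrite integral_nneseries//; last first.
    by move=> k; apply: measurable_funTS; exact: measurable_funeM.
  have step k : \int[mu]_(y in B i) ((4^-1 ^+ k)%:E * F k y) <=
      (4 * c * l)%:E * ((4^-1 ^+ k.+1)%:E * F k.+1 x).
    rewrite ge0_integralZl_EFin//; last exact: measurable_funTS.
    rewrite [F k.+1 x](_ : _ = c^-1%:E * mean (F k) x); last by rewrite /F iterS.
    have := @maxop_ge _ _ _ mu B (fun i => (fine (mu (B i)))^-1%R) (F k) i x Bx.
    rewrite muB /= => H; rewrite !muleA -!EFinM.
    rewrite (_ : 4 * c * l * 4^-1 ^+ k.+1 * c^-1 = 4^-1 ^+ k * l)%R; last first.
      by rewrite exprS; field; rewrite gt_eqF.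
    by rewrite EFinM -muleA lee_wpmul2l ?lee_fin// -lee_pdivrMl.
  apply: (@le_trans _ _ (\sum_(k <oo) (4 * c * l)%:E * ((4^-1 ^+ k.+1)%:E * F k.+1 x))).
    apply: lee_nneseries => [k _ _|k _]; last exact: step.
    exact: integral_ge0.
  rewrite nneseriesZl// muB muleAC -EFinM lee_wpmul2l//.
    by rewrite lee_fin !mulr_ge0// ltW.
  rewrite /H0 [leRHS]nneseries_recl//.
  apply: (@le_trans _ _ (\sum_(1 <= k <oo) (4^-1 ^+ k)%:E * F k x)); last by rewrite leeDr.
  rewrite -[leRHS]nneseries_addn//.
  by under [leRHS]eq_eseriesr do rewrite addn1.
have H0fin : {ae mu, forall x, H0 x \is a fin_num}.
  have : mu.-integrable [set: T] (fun x => H0 x `^ p * (w x)%:E).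
    apply/integrableP; split; first exact: pw.
    under eq_integral do rewrite gee0_abs//.
    apply: (le_lt_trans IH0); apply: lte_mul_pinfty.
    - by rewrite lee_fin mulr_ge0 ?powR_ge0.
    - by [].
    - by apply: (le_lt_trans I1le); rewrite lte_add_pinfty ?ltry.
  move=> /(integrable_ae measurableT); apply: filterS => x /(_ Logic.I).
  case: (H0 x) (H00 x) => // _; rewrite poweRyr ?gt_eqF//.
  by rewrite gt0_mulye ?lte_fin.
pose H x := if H0 x \is a fin_num then fine (H0 x) else 1%R.
have HE x : H0 x \is a fin_num -> (H x)%:E = H0 x.
  by move=> fx; rewrite /H fx fineK.
have mH : measurable_fun [set: T] H.
  apply: measurable_fun_ifT => //.
    apply: (measurable_fun_bool true).
    exact: emeasurable_fin_num.
  exact: (measurableT_comp (fine_measurable measurableT)).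
exists H; split => //.
- move=> x; rewrite /H; case: ifPn => // fx.
  by rewrite -lte_fin fineK.
- apply: filterS H0fin => x fx; rewrite HE//; apply: le_trans (h1H0 x).
  by rewrite le_max lexx.
- rewrite (@ge0_ae_eq_integral _ _ _ mu _ _ (fun x => H0 x `^ p * (w x)%:E))//.
  + apply: (le_trans IH0); apply: lee_pmul; [|exact: integral_ge0| |by []].
    * by rewrite lee_fin mulr_ge0 ?powR_ge0.
    * by rewrite lee_fin le_max lexx.
  + by apply: pw; exact/measurable_EFinP.
  + exact: pw.
  + by move=> x _; exact: (pw0 (fun x => (H x)%:E)).
  + by move: H0fin; apply: filterS => x fx _; rewrite HE.
- move=> i; apply: filterS (H0fin) => x fx Bx.
  rewrite (@ge0_ae_eq_integral _ _ _ mu _ _ H0)//.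
  + apply: (le_trans (meanH0 i x Bx)); rewrite [(Num.max _ _ * H x)%:E]EFinM HE//.
    rewrite !lee_wpmul2r// lee_fin le_max lexx orbT//.
  + by apply: measurable_funTS; exact/measurable_EFinP.
  + exact: measurable_funTS.
  + by move=> y _; rewrite lee_fin /H; case: ifP => // _; exact: fine_ge0.
  + by move: H0fin; apply: filterS => y fy _; rewrite HE.
Qed.

End muckenhoupt_theorem.

(** * Extrapolation over an abstract family of sets *)

Section extrapolation_pointwise.
Context {R : realType}.
Local Open Scope ereal_scope.

(** A pointwise substitute for Hoelder's inequality in passing from the exponent
    p0 to the exponent 1: where y exceeds H, y^(p0 - 1) is at least H^(p0 - 1). *)
Lemma le_split_power (p0 H : R) (y : \bar R) : (1 <= p0)%R -> (0 < H)%R ->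
  0 <= y -> y <= H%:E + y `^ p0 * (H `^ (1 - p0))%:E.
Proof.
move=> p1 H0 y0; have p0' : (0 < p0)%R by rewrite (lt_le_trans ltr01).
have [yH|Hy] := leP y H%:E.
  apply: (le_trans yH); rewrite leeDl// mule_ge0 ?poweR_ge0// lee_fin powR_ge0//.
apply: le_trans (_ : y `^ p0 * (H `^ (1 - p0))%:E <= _); last first.
  by rewrite leeDr// lee_fin ltW.
case: y y0 Hy => [y| |]//; last first.
  by rewrite poweRyr ?gt_eqF// gt0_mulye// lte_fin powR_gt0.
rewrite !lee_fin lte_fin => y0 Hy; have {}y0 := lt_trans H0 Hy.
rewrite -[leLHS]powRr1 ?(ltW y0)// (_ : 1 = p0 + (1 - p0))%R; last first.
  by rewrite addrC subrK.
rewrite powRD ?(gt_eqF y0) ?implybT//.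
rewrite (_ : p0 + (1 - p0) - p0 = 1 - p0)%R; last by rewrite addrAC subrr add0r.
rewrite ler_wpM2l ?powR_ge0// -opprB !powRN lef_pV2 ?posrE ?powR_gt0//.
by rewrite ge0_ler_powR ?subr_ge0 ?nnegrE// ltW.
Qed.

(** Young's inequality for H w^(1/p) and V w^(-1/p), with a free scale m and
    without sharp constants. *)
Lemma young_scaled (p m H V w : R) : (1 < p)%R -> (0 < m)%R -> (0 < H)%R ->
  (0 < V)%R -> (0 < w)%R ->
  (H * V <= m * (H `^ p * w) +
    m `^ (1 - conj_exp p) * (V `^ conj_exp p * w `^ (1 - conj_exp p)))%R.
Proof.
move=> p1 m0 H0 V0 w0; set q := conj_exp p.
have p0 : (0 < p)%R by rewrite (lt_trans ltr01).
have q1 : (1 < q)%R by exact: conj_exp_gt1.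
have [le|lt] := leP V (m * (H `^ (p - 1) * w))%R.
  apply: (@le_trans _ _ (m * (H `^ p * w))%R); last first.
    by rewrite lerDl !mulr_ge0 ?powR_ge0.
  rewrite -(mulr_powRB1 (ltW H0) p0) -mulrA mulrCA.
  by rewrite ler_wpM2l// ltW.
apply: (@le_trans _ _ (m `^ (1 - q) * (V `^ q * w `^ (1 - q)))%R); last first.
  by rewrite lerDr !mulr_ge0 ?powR_ge0// ltW.
have H1 : (H <= (m^-1 * (V / w)) `^ (q - 1))%R.
  rewrite conj_expB1// -[leLHS]powRr1 ?(ltW H0)//.
  rewrite (_ : 1 = (p - 1) * (p - 1)^-1)%R; last by rewrite divff// subr_eq0 gt_eqF.
  rewrite powRrM mulrV ?unitfE ?subr_eq0 ?gt_eqF// ge0_ler_powR ?nnegrE ?powR_ge0//.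
  - by rewrite invr_ge0 subr_ge0 ltW.
  - by rewrite mulr_ge0 ?divr_ge0 ?invr_ge0// ltW.
  - by rewrite ler_pdivlMl// ler_pdivlMr// -mulrA ltW.
apply: (@le_trans _ _ ((m^-1 * (V / w)) `^ (q - 1) * V)%R).
  by rewrite ler_wpM2r// ltW.
rewrite !powRM ?invr_ge0 ?mulr_ge0 ?invr_ge0 ?(ltW m0) ?(ltW V0) ?(ltW w0)//.
have inv z : (0 < z)%R -> ((z^-1) `^ (q - 1) = z `^ (1 - q))%R.
  by move=> z0; rewrite -powR_inv1 ?(ltW z0)// -powRrM mulN1r opprB.
rewrite !inv// -(mulr_powRB1 (ltW V0) (lt_trans ltr01 q1)).
by rewrite le_eqVlt; apply/orP; left; apply/eqP; ring.
Qed.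

End extrapolation_pointwise.

Section extrapolation.
Context d (T : measurableType d) (R : realType).
Variable mu : {measure set T -> \bar R}.
Local Open Scope ereal_scope.
Variables (B Bs : nat -> set T) (rad : nat -> R) (D0 : R).
Hypothesis mB : forall i, measurable (B i).
Hypothesis mBs : forall i, measurable (Bs i).
Hypothesis engulf : forall i j, B i `&` B j !=set0 -> (rad i <= rad j)%R ->
  B i `<=` Bs j.
Hypothesis BBs : forall i, B i `<=` Bs i.
Hypothesis D00 : (0 < D0)%R.
Hypothesis muBs : forall i, mu (Bs i) <= D0%:E * mu (B i).
Hypothesis cover_B : forall x, exists i, B i x.

(** The A_1 condition with constant C, on the sets of the family. *)
Definition a1_class (C : R) (V : T -> R) : Prop :=
  [/\ measurable_fun [set: T] V, forall x, (0 < V x)%R &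
      forall i, {ae mu, forall x, B i x ->
        \int[mu]_(y in B i) (V y)%:E <= (C * V x)%:E * mu (B i)}].

Lemma a1_class_le (C C' : R) V : (C <= C')%R -> a1_class C V -> a1_class C' V.
Proof.
move=> CC' [mV V0 HV]; split => // i; apply: filterS (HV i) => x /[apply] H.
by apply: (le_trans H); rewrite lee_wpmul2r// lee_fin ler_wpM2r// ltW.
Qed.

(** The p-th power of the norm of g' is an integral of g' against some k of finite
    dual norm.  Majorising f and k by A_1 weights H and V reduces the estimate to
    the exponent p0 and the weight H^(1 - p0) V; the part of the bound that comes
    from k, that is from g' itself, is finite and can be absorbed. *)
Lemma extrapolation_finite p K : (1 < p)%R -> (0 < K)%R ->
  exists2 C1 : R, (0 < C1)%R & forall p0 Phi : R, (1 <= p0)%R -> (0 < Phi)%R ->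
  exists2 C : R, (0 < C)%R &
  forall w f g g', ap_class mu B Bs p K w ->
  measurable_fun [set: T] f -> (forall x, 0 <= f x) ->
  measurable_fun [set: T] g -> (forall x, 0 <= g x) ->
  measurable_fun [set: T] g' -> (forall x, 0 <= g' x) ->
  (forall x, g' x <= g x) -> (forall x, g' x < +oo) ->
  \int[mu]_x (g' x `^ p * (w x)%:E) < +oo ->
  (forall H V, a1_class C1 H -> a1_class C1 V ->
    \int[mu]_x (g x `^ p0 * (H x `^ (1 - p0) * V x)%:E) <=
    Phi%:E * \int[mu]_x (f x `^ p0 * (H x `^ (1 - p0) * V x)%:E)) ->
  \int[mu]_x (g' x `^ p * (w x)%:E) <= C%:E * \int[mu]_x (f x `^ p * (w x)%:E).
Proof.
move=> p1 K0; set q := conj_exp p.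
have q1 : (1 < q)%R by exact: conj_exp_gt1.
have p00 : (0 < p)%R by rewrite (lt_trans ltr01).
have q0 : (0 < q)%R by rewrite (lt_trans ltr01).
have p10 : (0 < p - 1)%R by rewrite subr_gt0.
pose K' := (K `^ (p - 1)^-1)%R.
have K'0 : (0 < K')%R by rewrite powR_gt0.
have [A A0 rdfH] := rubio_de_francia mB mBs engulf BBs D00 muBs p1 K0 cover_B.
have [A' A'0 rdfV] := rubio_de_francia mB mBs engulf BBs D00 muBs q1 K'0 cover_B.
exists (Num.max A A')%R; first by rewrite lt_max A0.
move=> p0 Phi p01 Phi0.
have p0'0 : (0 < p0)%R by rewrite (lt_le_trans ltr01).
(* The scale for which the coefficient of the term to be absorbed is 1/2. *)
pose m := ((2 * (1 + Phi) * A') `^ (p - 1))%R.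
have P1 : (0 < 1 + Phi)%R by rewrite addr_gt0.
have m0 : (0 < m)%R by rewrite powR_gt0// !mulr_gt0.
have mq : (m `^ (1 - q) = (2 * (1 + Phi) * A')^-1)%R.
  rewrite subr1_conj_exp// -powRrM mulrN mulfV ?gt_eqF// powR_inv1//.
  by rewrite !mulr_ge0// ltW.
exists (2 * (1 + Phi) * m * A)%R; first by rewrite !mulr_gt0.
move=> w f g g' apw mf f0 mg g0 mg' g'0 g'g g'fin Gfin hyp.
have [mw w0 apB apBs] := apw.
have mwE : measurable_fun [set: T] (EFin \o w) by exact/measurable_EFinP.
set F := \int[mu]_x (f x `^ p * (w x)%:E); set G := \int[mu]_x (g' x `^ p * (w x)%:E).
have F0 : 0 <= F.
  by apply: integral_ge0 => x _; rewrite mule_ge0 ?poweR_ge0// lee_fin ltW.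
have G0 : 0 <= G.
  by apply: integral_ge0 => x _; rewrite mule_ge0 ?poweR_ge0// lee_fin ltW.
have [->|] := eqVneq F +oo.
  by rewrite gt0_muley ?leey// lte_fin !mulr_gt0.
rewrite -ltey => Ffin.
have apv := ap_class_dual p1 (ltW K0) apw.
pose k x := g' x `^ (p - 1) * (w x)%:E.
have mk : measurable_fun [set: T] k.
  by apply: emeasurable_funM => //; exact: measurable_poweR_comp.
have k0 x : 0 <= k x by rewrite mule_ge0 ?poweR_ge0// lee_fin ltW.
have kG : \int[mu]_x (k x `^ q * (dual_weight p w x)%:E) = G.
  apply: eq_integral => x _; rewrite /k poweRM ?poweR_ge0 ?lee_fin ?(ltW (w0 x))//.
  rewrite -poweRrM (_ : (p - 1) * q = p)%R; last first.
    by rewrite /q /conj_exp mulrC divfK// gt_eqF.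
  rewrite -muleA; congr (_ * _); rewrite poweR_EFin -EFinM; congr EFin.
  rewrite /dual_weight -/q -powRD ?(gt_eqF (w0 x)) ?implybT//.
  by rewrite addrC subrK powRr1// ltW.
have gk x : g' x `^ p * (w x)%:E = g' x * k x.
  rewrite /k muleA; congr (_ * _).
  case: (g' x) (g'0 x) (g'fin x) => // y y0 _.
  by rewrite !poweR_EFin -EFinM mulr_powRB1.
suff key (eta : R) : (0 < eta)%R ->
    G <= (2 * (1 + Phi) * m * A)%:E * (F + eta%:E) + eta%:E.
  have c0 : (0 < 2 * (1 + Phi) * m * A)%R by rewrite !mulr_gt0.
  set c := (2 * (1 + Phi) * m * A)%R in key c0 *.
  move: (F) (F0) (Ffin) key => [r r0 _ key|//|//].
  apply/lee_addgt0Pr => e e0.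
  have := key (e / (c + 1))%R; rewrite divr_gt0 ?addr_gt0// => /(_ isT) /le_trans; apply.
  rewrite -EFinD -!EFinM -!EFinD lee_fin mulrDr -addrA lerD2l.
  by rewrite -{2}[(e / _)%R]mul1r -mulrDl mulrCA divff ?mulr1// gt_eqF// addr_gt0.
move=> eta0.
have [H [mH H0 fH IH aH]] := rdfH _ _ _ apw mf f0 eta0 Ffin.
have kfin : \int[mu]_x (k x `^ q * (dual_weight p w x)%:E) < +oo by rewrite kG.
have [V [mV V0 kV IV aV]] := rdfV _ _ _ apv mk k0 eta0 kfin.
rewrite -/F in IH; rewrite kG in IV.
have mHE : measurable_fun [set: T] (EFin \o H) by exact/measurable_EFinP.
have mVE : measurable_fun [set: T] (EFin \o V) by exact/measurable_EFinP.
pose W x := (H x `^ (1 - p0) * V x)%R.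
have W0 x : (0 < W x)%R by rewrite mulr_gt0// powR_gt0.
have mW : measurable_fun [set: T] (EFin \o W).
  apply/measurable_EFinP; apply: measurable_funM => //.
  exact: (measurableT_comp (measurable_powR _)).
have mHV : measurable_fun [set: T] (fun x => (H x * V x)%:E).
  by apply/measurable_EFinP; exact: measurable_funM.
have HV0 x : 0 <= (H x * V x)%:E by rewrite lee_fin mulr_ge0 ?ltW.
have mp u : measurable_fun [set: T] u ->
    measurable_fun [set: T] (fun x => u x `^ p0 * (W x)%:E).
  by move=> mu_; apply: emeasurable_funM => //; exact: measurable_poweR_comp.
have pW0 (u : T -> \bar R) x : 0 <= u x `^ p0 * (W x)%:E.
  by rewrite mule_ge0 ?poweR_ge0// lee_fin ltW.
pose J := \int[mu]_x (H x * V x)%:E.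
have fJ : \int[mu]_x (f x `^ p0 * (W x)%:E) <= J.
  apply: ae_ge0_le_integral => //.
  - exact: mp.
  - apply: filterS fH => x fxH _.
    have -> : (H x * V x)%:E = (H x)%:E `^ p0 * (W x)%:E.
      rewrite poweR_EFin -EFinM /W mulrA -powRD ?(gt_eqF (H0 x)) ?implybT//.
      by rewrite addrC subrK powRr1// ltW.
    by rewrite lee_wpmul2r ?lee_fin ?(ltW (W0 x))// le_poweR// ltW.
have gJ : \int[mu]_x (g x `^ p0 * (W x)%:E) <= Phi%:E * J.
  apply: le_trans (hyp H V _ _) _.
  - by apply: (@a1_class_le A) => //; rewrite le_max lexx.
  - by apply: (@a1_class_le A') => //; rewrite le_max lexx orbT.
  - by rewrite lee_wpmul2l// lee_fin ltW.
have GJ : G <= (1 + Phi)%:E * J.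
  apply: (@le_trans _ _ (\int[mu]_x ((H x * V x)%:E + g x `^ p0 * (W x)%:E))).
    apply: ae_ge0_le_integral => //.
    - by move=> x _; rewrite mule_ge0 ?poweR_ge0// lee_fin ltW.
    - by apply: emeasurable_funM => //; exact: measurable_poweR_comp.
    - by move=> x _; rewrite adde_ge0.
    - by apply: emeasurable_funD => //; exact: mp.
    - apply: filterS kV => x kx _; rewrite gk.
      apply: (@le_trans _ _ (g x * (V x)%:E)); first exact: lee_pmul.
      apply: (@le_trans _ _ (((H x)%:E + g x `^ p0 * (H x `^ (1 - p0))%:E) * (V x)%:E)).
        by rewrite lee_wpmul2r ?lee_fin ?(ltW (V0 x))//; exact: le_split_power.
      rewrite ge0_muleDl ?lee_fin ?(ltW (H0 x))//; last first.
        by rewrite mule_ge0 ?poweR_ge0// lee_fin powR_ge0.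
      by rewrite -muleA -!EFinM.
  rewrite ge0_integralD//; last exact: mp.
  rewrite EFinD ge0_muleDl ?lee_fin ?(ltW Phi0)// mul1e.
  by rewrite leeD2l.
have mwp (a : R) (h : T -> R) (u : T -> R) : measurable_fun [set: T] h ->
    measurable_fun [set: T] u ->
    measurable_fun [set: T] (fun x => (h x)%:E `^ a * (u x)%:E).
  move=> mh mu_; apply: emeasurable_funM; last exact/measurable_EFinP.
  by apply: measurable_poweR_comp; exact/measurable_EFinP.
have mv : measurable_fun [set: T] (dual_weight p w) by exact: measurable_dual_weight.
have JFG : J <= m%:E * (A%:E * (F + eta%:E)) +
    (m `^ (1 - q))%:E * (A'%:E * (G + eta%:E)).
  apply: (@le_trans _ _ (\int[mu]_x (m%:E * ((H x)%:E `^ p * (w x)%:E) +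
     (m `^ (1 - q))%:E * ((V x)%:E `^ q * (dual_weight p w x)%:E)))).
    apply: ge0_le_integral => //.
      by apply: emeasurable_funD; apply: measurable_funeM; exact: mwp.
    move=> x _; rewrite !poweR_EFin -!EFinM -EFinD lee_fin.
    exact: young_scaled.
  rewrite ge0_integralD//; first last.
  - by apply: measurable_funeM; exact: mwp.
  - move=> x _; apply: mule_ge0; first by rewrite lee_fin powR_ge0.
    by apply: mule_ge0; [exact: poweR_ge0|rewrite lee_fin powR_ge0].
  - by apply: measurable_funeM; exact: mwp.
  - move=> x _; apply: mule_ge0; first by rewrite lee_fin ltW.
    by apply: mule_ge0; [exact: poweR_ge0|rewrite lee_fin ltW].
  rewrite !ge0_integralZl_EFin ?powR_ge0 ?(ltW m0)//; first last.
  - exact: mwp.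
  - by move=> x _; apply: mule_ge0; [exact: poweR_ge0|rewrite lee_fin ltW].
  - exact: mwp.
  - by move=> x _; apply: mule_ge0; [exact: poweR_ge0|rewrite lee_fin powR_ge0].
  apply: leeD; rewrite lee_wpmul2l ?lee_fin ?powR_ge0 ?(ltW m0)//.
have : G <= (1 + Phi)%:E * (m%:E * (A%:E * (F + eta%:E)) +
    (m `^ (1 - q))%:E * (A'%:E * (G + eta%:E))).
  by apply: (le_trans GJ); rewrite lee_wpmul2l// lee_fin ltW.
move: (F) (F0) (Ffin) => [r r0 _|//|//].
have Gfin' : G < +oo by exact: Gfin.
move: (G) (G0) (Gfin') => [s s0 _|//|//].
rewrite mq -!EFinD -!EFinM !lee_fin.
have -> : ((1 + Phi) * (m * (A * (r + eta)) +
    (2 * (1 + Phi) * A')^-1 * (A' * (s + eta))) =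
    (2 * (1 + Phi) * m * A * (r + eta) + (s + eta)) / 2)%R.
  by field; rewrite !gt_eqF.
by lra.
Qed.

(** Truncating g to a bounded function supported on finitely many sets makes its
    norm finite; monotone convergence removes the truncation. *)
Lemma extrapolation p K : (1 < p)%R -> (0 < K)%R ->
  exists2 C1 : R, (0 < C1)%R & forall p0 Phi : R, (1 <= p0)%R -> (0 < Phi)%R ->
  exists2 C : R, (0 < C)%R & forall w f g, ap_class mu B Bs p K w ->
  measurable_fun [set: T] f -> (forall x, 0 <= f x) ->
  measurable_fun [set: T] g -> (forall x, 0 <= g x) ->
  (forall H V, a1_class C1 H -> a1_class C1 V ->
    \int[mu]_x (g x `^ p0 * (H x `^ (1 - p0) * V x)%:E) <=
    Phi%:E * \int[mu]_x (f x `^ p0 * (H x `^ (1 - p0) * V x)%:E)) ->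
  \int[mu]_x (g x `^ p * (w x)%:E) <= C%:E * \int[mu]_x (f x `^ p * (w x)%:E).
Proof.
move=> p1 K0; have [C1 C10 ext] := extrapolation_finite p1 K0.
have p0_ : (0 < p)%R by rewrite (lt_trans ltr01).
exists C1 => // p0 Phi p01 Phi0; have [C C0 {}ext] := ext p0 Phi p01 Phi0.
exists C => // w f g apw mf f0 mg g0 hyp; have [mw w0 apB _] := apw.
pose U N := \bigcup_(i in [set i | (i < N)%N]) B i.
have mU N : measurable (U N) by exact: bigcup_measurable.
pose t N x := mine (g x) N%:R%:E.
pose h N := t N \_ (U N).
have mt N : measurable_fun [set: T] (t N) by exact: measurable_mine.
have mh N : measurable_fun [set: T] (h N).
  by apply/(measurable_restrictT _ (mU N))/measurable_funTS.
have t0 N x : 0 <= t N x by rewrite /t le_min g0 lee_fin ler0n.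
have h0 N x : 0 <= h N x by apply: erestrict_ge0.
have ht N x : h N x <= t N x by rewrite /h /patch; case: ifP.
have hg N x : h N x <= g x by apply: le_trans (ht N x) _; rewrite ge_min lexx.
have hN N x : h N x <= N%:R%:E.
  by apply: le_trans (ht N x) _; rewrite ge_min lexx orbT.
have mhw N : measurable_fun [set: T] (fun x => h N x `^ p * (w x)%:E).
  by apply: emeasurable_funM; [exact: measurable_poweR_comp|exact/measurable_EFinP].
have hw0 N x : 0 <= h N x `^ p * (w x)%:E.
  by rewrite mule_ge0 ?poweR_ge0// lee_fin ltW.
have hfin N : \int[mu]_x (h N x `^ p * (w x)%:E) < +oo.
  apply: (@le_lt_trans _ _ (\int[mu]_x ((N%:R `^ p)%:E * ((EFin \o w) \_ (U N)) x))).
    apply: ge0_le_integral => //.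
      apply: measurable_funeM.
      by apply/(measurable_restrictT _ (mU N))/measurable_funTS/measurable_EFinP.
    move=> x _; have := hN N x; have := h0 N x; rewrite /h /patch.
    case: ifP => _ a0 aN; last by rewrite poweR0r ?gt_eqF// mul0e mule0.
    rewrite lee_wpmul2r ?lee_fin ?(ltW (w0 x))//.
    by apply: (@le_poweR _ p _ N%:R%:E) => //; exact: ltW.
  rewrite ge0_integralZl_EFin ?powR_ge0//; first last.
    by apply/(measurable_restrictT _ (mU N))/measurable_funTS/measurable_EFinP.
    by move=> x _; apply: erestrict_ge0 => y _; rewrite lee_fin ltW.
  rewrite -integral_mkcond; apply: lte_mul_pinfty; rewrite ?lee_fin ?powR_ge0//.
  apply: (@le_lt_trans _ _ (\sum_(j <- iota 0 N) \int[mu]_(x in B j) (w x)%:E)).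
    apply: integral_cover_le => //.
    - by move=> x; rewrite lee_fin ltW.
    - exact/measurable_EFinP.
    - by move=> x [i /= iN Bx]; exists i; rewrite // mem_iota.
  apply/lte_sum_pinfty => i _; have [a [s [l [_ _ -> _ _]]]] := apB i.
  exact: ltry.
have hle N : \int[mu]_x (h N x `^ p * (w x)%:E) <=
    C%:E * \int[mu]_x (f x `^ p * (w x)%:E).
  apply: (ext w f g (h N)) => //.
  by move=> x; apply: (le_lt_trans (hN N x)); exact: ltry.
have nd x : nondecreasing_seq (fun N => h N x `^ p * (w x)%:E).
  move=> N M NM; rewrite lee_wpmul2r ?lee_fin ?(ltW (w0 x))// le_poweR ?(ltW p0_)//.
  rewrite /h /patch; case: ifPn => [|_]; last by case: ifP.
  rewrite inE => -[i /= iN Bx].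
  rewrite mem_set; last by exists i => //=; exact: leq_trans NM.
  by rewrite /t le_min ge_min lexx/= ge_min lee_fin ler_nat NM orbT.
apply: (@le_trans _ _ (\int[mu]_x limn (fun N => h N x `^ p * (w x)%:E))).
  apply: ge0_le_integral => //.
  - by move=> x _; rewrite mule_ge0 ?poweR_ge0// lee_fin ltW.
  - by apply: emeasurable_funM; [exact: measurable_poweR_comp|exact/measurable_EFinP].
  - apply: (@emeasurable_fun_cvg _ _ _ _ (fun N x => h N x `^ p * (w x)%:E)) => // x _.
    exact: ereal_nondecreasing_is_cvgn.
  move=> x _; have /cvg_lim -> // := ereal_nondecreasing_cvgn (nd x).
  set S := ereal_sup _.
  have hS N : h N x `^ p * (w x)%:E <= S by apply: ereal_sup_ubound; exists N.
  have [i Bx] := cover_B x.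
  have hE N : (i < N)%N -> h N x = t N x.
    by move=> iN; rewrite /h /patch mem_set//; exists i.
  case gx : (g x) (g0 x) => [r| |]// r0.
    pose N := maxn i.+1 (Num.truncn r).+1.
    have := hS N; rewrite hE; last by rewrite leq_max leqnn.
    rewrite /t gx /mine ifT// lte_fin.
    by rewrite (lt_le_trans (truncnS_gt _))// ler_nat leq_max leqnn orbT.
  rewrite poweRyr ?gt_eqF// gt0_mulye ?lte_fin// leye_eq; apply/eqP/eqyP => A A0.
  pose N := maxn i.+1 (Num.truncn ((A / w x) `^ p^-1)).+1.
  apply: le_trans (hS N); rewrite hE; last by rewrite leq_max leqnn.
  rewrite /t gx /mine ltNge leey/= -EFinM lee_fin -ler_pdivrMr//.
  have {1}-> : (A / w x = ((A / w x) `^ p^-1) `^ p)%R.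
    by rewrite -powRrM mulVf ?gt_eqF// powRr1// divr_ge0// ltW.
  rewrite ge0_ler_powR ?nnegrE ?powR_ge0 ?(ltW p0_)//.
  by rewrite (le_trans (ltW (truncnS_gt _)))// ler_nat leq_max leqnn orbT.
rewrite monotone_convergence//; apply: lime_le.
  apply: ereal_nondecreasing_is_cvgn => N M NM.
  by apply: ge0_le_integral => // x _; exact: nd.
exact: nearW.
Qed.

End extrapolation.

(** * The Euclidean norm and measurability *)

Section esum_image.
Context {R : realType}.
Local Open Scope ereal_scope.

(** An inequality only, as e may send several points to the same one. *)
Lemma esum_image_le (T : pointedType) (T' : choiceType) (P : set T) (e : T -> T')
    (a : T' -> \bar R) : (forall y, 0 <= a y) ->
  \esum_(y in e @` P) a y <= \esum_(x in P) a (e x).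
Proof.
move=> a0; have /choice[s Hs] (y : T') : exists x, (e @` P) y -> P x /\ e x = y.
  have [[x Px <-]|nP] := pselect ((e @` P) y); last by exists point.
  by exists x.
have sinj : set_inj (e @` P) s.
  move=> y z; rewrite !inE => Py Pz syz.
  by rewrite -(Hs _ Py).2 -(Hs _ Pz).2 syz.
rewrite -(@eq_esum _ _ (e @` P) (a \o e \o s)); last first.
  by move=> y Py /=; rewrite (Hs _ Py).2.
rewrite -(esum_image _ s (a \o e))//; apply: ereal_sup_le => _ [X [fX XS] <-].
exists X => //; split => //; apply: (subset_trans XS) => _ [y Py <-].
exact: (Hs _ Py).1.
Qed.

End esum_image.

Section euclidean_norm.
Context {R : realType} {n : nat}.
Implicit Types x y z : 'rV[R]_n.

Lemma enorm_ge0 x : 0 <= enorm x.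
Proof. exact: sqrtr_ge0. Qed.

Lemma sqr_enorm x : enorm x ^+ 2 = \sum_i x 0 i ^+ 2.
Proof. by rewrite sqr_sqrtr// sumr_ge0// => i _; exact: sqr_ge0. Qed.

Lemma enorm0 : enorm (0 : 'rV[R]_n) = 0.
Proof.
rewrite /enorm big1 ?sqrtr0// => i _; by rewrite mxE expr0n.
Qed.

Lemma enormN x : enorm (- x) = enorm x.
Proof. by rewrite /enorm; under eq_bigr do rewrite mxE sqrrN. Qed.

Lemma enormB x y : enorm (x - y) = enorm (y - x).
Proof. by rewrite -enormN opprB. Qed.

Lemma coord_le_enorm x i : `|x 0 i| <= enorm x.
Proof.
rewrite -sqrtr_sqr ler_sqrt ?sumr_ge0// ?sqr_ge0//; last by move=> j _; exact: sqr_ge0.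
by rewrite (bigD1 i)//= lerDl sumr_ge0// => j _; exact: sqr_ge0.
Qed.

Lemma enorm_eq0 x : enorm x = 0 -> x = 0.
Proof.
move=> x0; apply/rowP => i; rewrite mxE; apply/normr0_eq0/le_anti.
by rewrite normr_ge0 andbT -x0 coord_le_enorm.
Qed.

Lemma cauchy_schwarz x y : \sum_i x 0 i * y 0 i <= enorm x * enorm y.
Proof.
have [x0|xN0] := eqVneq (enorm x) 0.
  by rewrite x0 mul0r (enorm_eq0 x0) big1// => i _; rewrite mxE mul0r.
have [y0|yN0] := eqVneq (enorm y) 0.
  by rewrite y0 mulr0 (enorm_eq0 y0) big1// => i _; rewrite mxE mulr0.
have x0 : 0 < enorm x by rewrite lt0r xN0 enorm_ge0.
have y0 : 0 < enorm y by rewrite lt0r yN0 enorm_ge0.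
pose t := enorm y / enorm x; have t0 : 0 < t by rewrite divr_gt0.
have -> : enorm x * enorm y = \sum_i (x 0 i ^+ 2 * t + y 0 i ^+ 2 / t) / 2.
  rewrite -mulr_suml big_split/= -!mulr_suml -!sqr_enorm /t; field.
  by rewrite xN0.
apply: ler_sum => i _; rewrite -subr_ge0.
rewrite (_ : _ - _ = (x 0 i * t - y 0 i) ^+ 2 / (2 * t)).
  by rewrite divr_ge0 ?sqr_ge0// mulr_ge0// ltW.
by field; rewrite gt_eqF.
Qed.

Lemma ler_enormD x y : enorm (x + y) <= enorm x + enorm y.
Proof.
rewrite -(@ler_pXn2r _ 2)// ?nnegrE ?addr_ge0 ?enorm_ge0// sqr_enorm.
under eq_bigr do rewrite mxE sqrrD.
rewrite big_split/= big_split/= sqrrD !sqr_enorm lerD2r lerD2l.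
by rewrite sumrMnl lerMn2r; exact: cauchy_schwarz.
Qed.

Lemma enorm_triangle y x z : enorm (x - z) <= enorm (x - y) + enorm (y - z).
Proof. by apply: le_trans (ler_enormD _ _); rewrite addrA subrK. Qed.

Lemma enorm_le_sum x : enorm x <= \sum_i `|x 0 i|.
Proof.
rewrite -(@ler_pXn2r _ 2)// ?nnegrE ?enorm_ge0 ?sumr_ge0// sqr_enorm.
rewrite expr2 mulr_suml; apply: ler_sum => i _.
rewrite -[leLHS]real_normK ?num_real// expr2 ler_wpM2l// (bigD1 i)//= lerDl sumr_ge0//.
Qed.

Lemma eball_le x r s : r <= s -> eball x r `<=` eball x s.
Proof. by move=> rs y /lt_le_trans; apply. Qed.

Lemma eball_sub x y r s : enorm (x - y) + r <= s -> eball x r `<=` eball y s.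
Proof.
move=> h z xz; rewrite /eball/=; apply: lt_le_trans h.
by apply: le_lt_trans (enorm_triangle x _ _) _; rewrite addrC ltrD2l.
Qed.

End euclidean_norm.

Section lebesgue_rV_basics.
Context {R : realType} {n : nat}.
Implicit Types (x : 'rV[R]_n) (A : set 'rV[R]_n).
Local Notation leb := (@lebesgue_rV R n).
Local Notation outer := (@lebesgue_outer_rV R n).

Lemma lebesgue_outer_box_le (Q : 'rV[R]_n * 'rV[R]_n) A : A `<=` box Q ->
  (outer A <= (box_volume Q)%:E)%E.
Proof.
move=> AQ; apply: ereal_inf_lbound; exists [set Q].
  by split; [exact: countable1|move=> y /AQ Qy; exists Q].
by rewrite esum_set1// box_volume_ge0.
Qed.

Definition cut_low (i : 'I_n) (c : R) (Q : 'rV[R]_n * 'rV[R]_n) :=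
  (Q.1, \row_j (if j == i then Num.min (Q.2 0 j) c else Q.2 0 j)).

Definition cut_high (i : 'I_n) (c : R) (Q : 'rV[R]_n * 'rV[R]_n) :=
  (\row_j (if j == i then Num.max (Q.1 0 j) c else Q.1 0 j), Q.2).

Lemma box_volume_cut i c Q :
  box_volume (cut_low i c Q) + box_volume (cut_high i c Q) = box_volume Q.
Proof.
rewrite /box_volume !(bigD1 i (P := xpredT))//= !mxE eqxx.
rewrite (eq_bigr (fun j => Num.max 0 (Q.2 0 j - Q.1 0 j))); last first.
  by move=> j ji; rewrite mxE (negbTE ji).
rewrite [in X in _ + _ * X](eq_bigr (fun j => Num.max 0 (Q.2 0 j - Q.1 0 j))); last first.
  by move=> j ji; rewrite mxE (negbTE ji).
rewrite -mulrDl; congr (_ * _); rewrite /Num.max /Num.min.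
by repeat case: ifPn; rewrite -?leNgt; lra.
Qed.

(** Cutting every box of a cover along the hyperplane gives covers of both parts
    with the same total volume. *)
Lemma measurable_half_space (i : 'I_n) (c : R) :
  measurable [set x : 'rV[R]_n | x 0 i <= c].
Proof.
apply: le_caratheodory_measurable => X /=.
apply/ereal_infP => _ [C [cC XC] <-].
have cover_cut (f : 'rV[R]_n * 'rV[R]_n -> 'rV[R]_n * 'rV[R]_n) Y :
    (forall x, Y x -> exists2 Q, C Q & box (f Q) x) ->
    (outer Y <= \esum_(Q in C) (box_volume (f Q))%:E)%E.
  move=> YC; apply: le_trans (@esum_image_le R _ _ C f
    (fun Q => (box_volume Q)%:E) (@box_volume_ge0 R n)).
  apply: ereal_inf_lbound; exists (f @` C) => //; split; first exact: sub_countable (card_image_le _ _) cC.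
  by move=> x /YC[Q CQ Qx]; exists (f Q) => //; exists Q.
rewrite (@eq_esum _ _ C _ (fun Q => (box_volume (cut_low i c Q))%:E +
    (box_volume (cut_high i c Q))%:E)%E); last first.
  by move=> Q _; rewrite -EFinD box_volume_cut.
rewrite esumD; [|by move=> Q _; exact: box_volume_ge0..].
apply: leeD; apply: cover_cut => x [/XC[Q CQ Qx] xc]; exists Q => // j.
- rewrite /= mxE; have /andP[-> Q2] := Qx j; case: eqP => [ji|//].
  by rewrite le_min Q2/= ji.
- rewrite /= mxE; have /andP[Q1 ->] := Qx j; case: eqP => [ji|]; last by rewrite Q1.
  by rewrite gt_max Q1/= ji andbT ltNge; exact/negP.
Qed.

Lemma measurable_coord (i : 'I_n) : measurable_fun [set: 'rV[R]_n] (fun x => x 0 i).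
Proof.
move=> mT; apply: (measurability _ (RGenOInfty.measurableE R)) => //.
move=> _ [_ [r ->] <-]; rewrite setTI.
rewrite (_ : _ @^-1` _ = ~` [set x : 'rV[R]_n | x 0 i <= r]).
  by apply: measurableC; exact: measurable_half_space.
apply/seteqP; split => x /=; rewrite in_itv/= andbT.
  by rewrite ltNge => /negP.
by move=> /negP; rewrite -ltNge.
Qed.

Lemma measurable_enormB x : measurable_fun [set: 'rV[R]_n] (fun y => enorm (y - x)).
Proof.
apply: (measurableT_comp (continuous_measurable_fun (@sqrt_continuous R))).
apply: measurable_sum => i; apply: measurable_funX.
under eq_fun do rewrite !mxE.
by apply: measurable_funB; [exact: measurable_coord|exact: measurable_cst].
Qed.

Lemma measurable_eball x r : measurable (eball x r).
Proof.
rewrite (_ : eball x r = (fun y => enorm (y - x)) @^-1` `]-oo, r[%classic).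
  by rewrite -[X in measurable X]setTI; exact: measurable_enormB.
by apply/seteqP; split => y /=; rewrite in_itv.
Qed.

Lemma lebesgue_eball_le x r : 0 < r -> (leb (eball x r) <= ((2 * r) ^+ n)%:E)%E.
Proof.
move=> r0; apply: (@le_trans _ _ (box_volume (x - const_mx r, x + const_mx r))%:E).
  apply: lebesgue_outer_box_le => y xy i /=; rewrite !mxE.
  have := le_lt_trans (coord_le_enorm (y - x) i) xy.
  rewrite !mxE ltr_norml => /andP[yx1 yx2]; apply/andP; split; lra.
rewrite lee_fin /box_volume /= (eq_bigr (fun=> 2 * r)).
  by rewrite prodr_const card_ord.
move=> i _; rewrite !mxE (_ : _ - _ = 2 * r); last by lra.
by rewrite /Num.max ifT// mulr_gt0.
Qed.

End lebesgue_rV_basics.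

(** * A lower bound for the Lebesgue measure of a cube *)

Section cube_lower_bound.
Context {R : realType} {n : nat}.
Implicit Types (x : 'rV[R]_n) (A : set 'rV[R]_n).
Local Notation leb := (@lebesgue_rV R n).
Local Notation outer := (@lebesgue_outer_rV R n).

(** The number of integers of an open interval exceeds its length by at most 1;
    the minimum with N makes the induction go through. *)
Lemma count_open_interval (u v : R) (N : nat) : u < v ->
  \sum_(j < N) ((u < j%:R < v)%R : nat)%:R <= Num.max 0 (Num.min N%:R (v + 1) - u).
Proof.
move=> uv; elim: N => [|N IH]; first by rewrite big_ord0 le_max lexx.
rewrite big_ord_recr/=; case: (boolP (u < N%:R < v)) => [/andP[uN Nv]|_].
  apply: (@le_trans _ _ (N%:R - u + 1)).
    rewrite lerD2r; apply: (le_trans IH).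
    rewrite ge_max subr_ge0 (ltW uN) lerB// ge_min lexx//.
  rewrite le_max; apply/orP; right; rewrite addrAC -natr1 lerD2r le_min lexx/=.
  by rewrite lerD2r ltW.
rewrite addr0; apply: (le_trans IH).
rewrite ge_max !le_max lexx/= lerB ?orbT// le_min ge_min ge_min lexx orbT andbT.
by rewrite -natr1 lerDl ler01.
Qed.

Lemma open_open_box (a b : 'rV[R]_n) :
  open [set y : 'rV[R]_n | forall i, a 0 i < y 0 i < b 0 i].
Proof.
rewrite openE => y yab; exists (fun _ j => `]a 0 j, b 0 j[%classic).
  move=> i j; rewrite ord1; apply: open_nbhs_nbhs; split => //=.
  by rewrite in_itv/= yab.
by move=> z zab i; have := zab 0 i; rewrite /= in_itv.
Qed.

(** Two estimates of the number of points of a fine enough grid of a cube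
    covered by boxes: all of them on the one hand, and on the other hand a
    constant times the sum of the volumes of finitely many boxes. Every box is
    doubled first, so as to have an open cover and as compactness is needed for
    the mesh of the grid to be small with respect to each of the boxes. *)
Lemma lebesgue_outer_cube_ge (a : 'rV[R]_n) (l : R) : 0 < l ->
  (((l / 4) ^+ n)%:E <=
   outer [set y : 'rV[R]_n | forall i, (a 0 i <= y 0 i <= a 0 i + l)%R])%E.
Proof.
move=> l0; set K := [set y | _].
have cK : compact K.
  have -> : K = [set v | forall i, `[a 0 i, a 0 i + l]%classic (v 0 i)].
    by apply/seteqP; split => y Ky i; have := Ky i; rewrite /= in_itv.
  apply: (@rV_compact R n (fun i => `[a 0 i, a 0 i + l]%classic)) => i.
  exact: segment_compact.
apply/ereal_infP => _ [C [cC KC] <-].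
pose C1 := C `&` [set Q : 'rV[R]_n * 'rV[R]_n | forall i, Q.1 0 i < Q.2 0 i].
pose lo (Q : 'rV[R]_n * 'rV[R]_n) : 'rV[R]_n :=
  \row_i (Q.1 0 i - (Q.2 0 i - Q.1 0 i) / 2).
pose hi (Q : 'rV[R]_n * 'rV[R]_n) : 'rV[R]_n :=
  \row_i (Q.2 0 i + (Q.2 0 i - Q.1 0 i) / 2).
pose O Q := [set y : 'rV[R]_n | forall i, lo Q 0 i < y 0 i < hi Q 0 i].
move: cK; rewrite compact_cover => /(_ _ C1 O).
case=> [Q _|y /KC[Q CQ Qy]|D DC1 KD].
- exact: open_open_box.
- have Q12 i : Q.1 0 i < Q.2 0 i by have /andP[/lt_le_trans] := Qy i; apply.
  exists Q => // i; rewrite !mxE; have /andP[y1 y2] := Qy i.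
  by have := Q12 i; move=> ?; apply/andP; split; lra.
have D12 Q : Q \in D -> forall i, Q.1 0 i < Q.2 0 i.
  by move=> QD; have [] := set_mem (DC1 _ QD).
have {}DC Q : Q \in D -> C Q.
  by move=> QD; have [] := set_mem (DC1 _ QD).
apply: esum_ge; exists [set` D].
  by split => //=; move=> Q /DC.
rewrite fsbig_finite//= set_fsetK sumEFin lee_fin.
have [N N0 HN] : exists2 N : nat, (0 < N)%N & forall Q, Q \in D ->
    forall i, 1 <= 2 * (Q.2 0 i - Q.1 0 i) * N%:R / l.
  pose s (Q : 'rV[R]_n * 'rV[R]_n) : nat :=
    (\max_i (Num.truncn (l / (2 * (Q.2 0%R i - Q.1 0%R i)))%R).+1)%N.
  exists (\max_(Q <- enum_fset D) s Q).+1%N => // Q QD i.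
  have Q12 := D12 _ QD i.
  rewrite ler_pdivlMr// mul1r mulrC -ler_pdivrMr ?mulr_gt0 ?subr_gt0//.
  apply: (le_trans (ltW (truncnS_gt _))); rewrite ler_nat.
  apply: leqW; apply: leq_trans (_ : s Q <= _)%N; last exact: leq_bigmax_seq.
  by rewrite /s; apply: (leq_bigmax i).
have N0' : (0 < N%:R :> R) by rewrite ltr0n.
pose pt (f : {ffun 'I_n -> 'I_N}) : 'rV[R]_n := \row_i (a 0 i + l * (f i)%:R / N%:R).
have ptK f : K (pt f).
  move=> i; rewrite mxE lerDl divr_ge0 ?mulr_ge0 ?(ltW l0)//= lerD2l.
  by rewrite ler_pdivrMr// ler_wpM2l ?(ltW l0)// ler_nat ltnW.
(* The sides of the box O Q, in the coordinates of the grid. *)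
pose U Q i : R := (lo Q 0 i - a 0 i) * N%:R / l.
pose V Q i : R := (hi Q 0 i - a 0 i) * N%:R / l.
have inO Q f : O Q (pt f) -> forall i, U Q i < (f i)%:R < V Q i.
  move=> Oq i; have := Oq i; rewrite [pt f 0 i]mxE [l * _]mulrC.
  move=> /andP[h1 h2]; apply/andP; split.
    by rewrite /U ltr_pdivrMr// -ltr_pdivlMr// ltrBlDl.
  by rewrite /V ltr_pdivlMr// -ltr_pdivrMr// ltrBrDl.
have card1 : (N%:R ^+ n :> R) <=
    \sum_(Q <- enum_fset D) \prod_i \sum_(j < N) ((U Q i < j%:R < V Q i)%R : nat)%:R.
  have -> : (N%:R ^+ n :> R) = \sum_(f : {ffun 'I_n -> 'I_N}) 1.
    by rewrite sumr_const card_ffun !card_ord natrX.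
  under [leRHS]eq_bigr do rewrite bigA_distr_bigA/=.
  rewrite exchange_big/=; apply: ler_sum => f _.
  have [Q /= QD Of] := KD _ (ptK f).
  rewrite (big_rem Q)//= -[leLHS]addr0 lerD//.
    by rewrite big1// => i _; rewrite (inO _ _ Of).
  by apply: sumr_ge0 => Q' _; apply: prodr_ge0 => i _; rewrite ler0n.
have card2 Q : Q \in D ->
    \prod_i \sum_(j < N) ((U Q i < j%:R < V Q i)%R : nat)%:R <=
    (4 * N%:R / l) ^+ n * box_volume Q.
  move=> QD; have -> : (4 * N%:R / l) ^+ n = \prod_(i < n) (4 * N%:R / l).
    by rewrite prodr_const card_ord.
  rewrite /box_volume -big_split/=.
  apply: ler_prod => i _; apply/andP; split; first exact: sumr_ge0.
  have Q12 := D12 _ QD i.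
  have UV : U Q i < V Q i.
    by rewrite /U /V ltr_pM2r ?invr_gt0// ltr_pM2r// ltrD2r !mxE; lra.
  apply: (le_trans (count_open_interval N UV)).
  rewrite /Num.max [X in _ <= _ * X]ifT ?subr_gt0//.
  have h : 1 <= 2 * (Q.2 0 i - Q.1 0 i) * N%:R / l by exact: HN.
  have E : V Q i - U Q i = 2 * (Q.2 0 i - Q.1 0 i) * N%:R / l.
    by rewrite /V /U !mxE; field; rewrite gt_eqF.
  have E4 : 4 * N%:R / l * (Q.2 0 i - Q.1 0 i) = 2 * (V Q i - U Q i).
    by rewrite E; field; rewrite gt_eqF.
  rewrite E4; rewrite -E in h; case: ifP => _; last by lra.
  apply: (@le_trans _ _ (V Q i + 1 - U Q i)); last by lra.
  by rewrite lerD2r ge_min lexx orbT.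
have : N%:R ^+ n <= (4 * N%:R / l) ^+ n * \sum_(Q <- enum_fset D) box_volume Q.
  apply: (le_trans card1); rewrite mulr_sumr big_seq [leRHS]big_seq.
  by apply: ler_sum => Q QD; exact: card2.
rewrite -ler_pdivrMl ?exprn_gt0 ?divr_gt0 ?mulr_gt0//.
rewrite -exprVn -exprMn (_ : (4 * N%:R / l)^-1 * N%:R = l / 4)//.
by field; rewrite !gt_eqF.
Qed.

End cube_lower_bound.

(** * Volumes of balls and rational balls *)

Section lebesgue_balls.
Context {R : realType} {n : nat}.
Hypothesis n_gt0 : (0 < n)%N.
Implicit Types (x y : 'rV[R]_n) (r : R) (A : set 'rV[R]_n).
Local Notation leb := (@lebesgue_rV R n).

(** A crude lower bound for the volume of the unit ball, which contains a cube of
    side 1/n: only the comparability of volumes with r^n matters below. *)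
Definition ball_const : R := (4 * n%:R) ^- n.

Lemma ball_const_gt0 : 0 < ball_const.
Proof. by rewrite invr_gt0 exprn_gt0// mulr_gt0// ltr0n. Qed.

Lemma lebesgue_eball_ge x r : 0 < r ->
  ((ball_const * r ^+ n)%:E <= leb (eball x r))%E.
Proof.
move=> r0; have n0 : 0 < n%:R :> R by rewrite ltr0n.
pose s := r / (2 * n%:R); have s0 : 0 < s by rewrite divr_gt0// mulr_gt0.
have l0 : 0 < 2 * s by rewrite mulr_gt0.
apply: le_trans (le_trans (lebesgue_outer_cube_ge (x - const_mx s) l0) _).
  rewrite lee_fin /ball_const -exprVn -exprMn (_ : _^-1 * r = 2 * s / 4)//.
  by rewrite /s; field; rewrite gt_eqF.
apply: le_lebesgue_outer_rV => y xy; rewrite /eball/=.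
apply: le_lt_trans (enorm_le_sum _) _.
apply: (@le_lt_trans _ _ (\sum_(i < n) s)).
  apply: ler_sum => i _; have := xy i; rewrite !mxE ler_norml.
  by move=> /andP[y1 y2]; apply/andP; split; lra.
rewrite sumr_const card_ord -mulr_natr (_ : s * n%:R = r / 2).
  by rewrite ltr_pdivrMr// ltr_pMr// ltr1n.
by rewrite /s; field; rewrite gt_eqF.
Qed.

Definition ball_volume x r : R := fine (leb (eball x r)).

Lemma lebesgue_eballE x r : 0 < r -> leb (eball x r) = (ball_volume x r)%:E.
Proof.
move=> r0; rewrite /ball_volume fineK// ge0_fin_numE//.
by apply: (le_lt_trans (lebesgue_eball_le x r0)); exact: ltry.
Qed.

Lemma ball_volume_gt0 x r : 0 < r -> 0 < ball_volume x r.
Proof.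
move=> r0; rewrite -lte_fin -lebesgue_eballE//.
apply: lt_le_trans (lebesgue_eball_ge x r0).
by rewrite lte_fin mulr_gt0 ?ball_const_gt0 ?exprn_gt0.
Qed.

Lemma lebesgue_eball_scale x y r s t : 0 < r -> 0 < t -> s <= t * r -> 0 < s ->
  (leb (eball y s) <= ((2 * t) ^+ n / ball_const)%:E * leb (eball x r))%E.
Proof.
move=> r0 t0 st s0; apply: (le_trans (lebesgue_eball_le y s0)).
apply: le_trans (lee_wpmul2l _ (lebesgue_eball_ge x r0)); last first.
  by rewrite lee_fin divr_ge0 ?exprn_ge0 ?mulr_ge0 ?(ltW t0)// ltW// ball_const_gt0.
rewrite -EFinM lee_fin mulrA divfK ?gt_eqF ?ball_const_gt0// -exprMn.
by rewrite lerXn2r ?nnegrE ?mulr_ge0 ?(ltW s0) ?(ltW r0) ?(ltW t0)// -mulrA ler_wpM2l.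
Qed.

Lemma lebesgue_rV_set1 x : leb [set x] = 0%E.
Proof.
apply/eqP; rewrite eq_le measure_ge0 andbT; apply/lee_addgt0Pr => e e0.
rewrite add0e; pose r := Num.min 1 e / 2.
have me0 : 0 < Num.min 1 e by rewrite lt_min ltr01.
have r0 : 0 < r by rewrite divr_gt0.
apply: (@le_trans _ _ (leb (eball x r))).
  by apply: le_lebesgue_outer_rV => y /= ->; rewrite /eball/= subrr enorm0.
apply: (le_trans (lebesgue_eball_le x r0)); rewrite lee_fin mulrC divfK//.
apply: (@le_trans _ _ (Num.min 1 e)); last by rewrite ge_min lexx orbT.
rewrite -[leRHS]expr1 ler_wiXn2l// ?(ltW me0)//.
by rewrite ge_min lexx.
Qed.

Lemma rat_vector_dense x r : 0 < r ->
  exists q : 'rV[rat]_n, enorm (x - map_mx ratr q) < r.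
Proof.
move=> r0; pose d := r / n%:R; have d0 : 0 < d by rewrite divr_gt0// ltr0n.
have /choice[q Hq] (i : 'I_n) : exists q : rat, `|x 0 i - ratr q| < d.
  have xd : x 0 i - d < x 0 i + d by lra.
  have [q] := rat_in_itvoo xd; rewrite in_itv/= => /andP[q1 q2].
  by exists q; rewrite ltr_norml; apply/andP; split; lra.
exists (\row_i q i); apply: (le_lt_trans (enorm_le_sum _)).
apply: (@lt_le_trans _ _ (\sum_(i < n) d)).
  apply: ltr_sum; last by move=> i _; rewrite !mxE.
  by apply/hasP; exists (Ordinal n_gt0) => //; rewrite mem_index_enum.
by rewrite sumr_const card_ord -mulr_natr divfK// gt_eqF// ltr0n.
Qed.

(** An enumeration of the balls with a rational centre and a rational radius. *)
Definition rat_ball_data (k : nat) : 'rV[R]_n * R :=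
  if @unpickle ('rV[rat]_n * rat)%type k is Some (q, s) then
    if 0 < s then (map_mx ratr q, ratr s) else (0, 1)
  else (0, 1).

Definition rat_center k := (rat_ball_data k).1.
Definition rat_radius k := (rat_ball_data k).2.
Definition rat_ball k := eball (rat_center k) (rat_radius k).
Definition rat_ball3 k := eball (rat_center k) (3 * rat_radius k).

Lemma rat_radius_gt0 k : 0 < rat_radius k.
Proof.
rewrite /rat_radius /rat_ball_data; case: (unpickle k) => [[q s]|] //=.
by case: ifP => //= s0; rewrite ltr0q.
Qed.

Lemma rat_ball_engulf i j : rat_ball i `&` rat_ball j !=set0 ->
  rat_radius i <= rat_radius j -> rat_ball i `<=` rat_ball3 j.
Proof.
move=> [x [xi xj]] rij y yi; rewrite /rat_ball3 /eball/=.
apply: le_lt_trans (enorm_triangle x _ _) _.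
apply: le_lt_trans (lerD (enorm_triangle (rat_center i) _ _) (lexx _)) _.
rewrite (enormB (rat_center i)).
move: xi xj yi; rewrite /rat_ball /eball/= => xi xj yi; lra.
Qed.

Lemma rat_ball3_volume i :
  (leb (rat_ball3 i) <= ((2 * 3) ^+ n / ball_const)%:E * leb (rat_ball i))%E.
Proof.
by apply: lebesgue_eball_scale; rewrite ?mulr_gt0 ?rat_radius_gt0.
Qed.

(** Hence conditions on the countably many rational balls pass to all balls. *)
Lemma rat_ball_approx x r : 0 < r ->
  exists2 i, eball x r `<=` rat_ball i & rat_radius i <= 2 * r.
Proof.
move=> r0; have [|q xq] := @rat_vector_dense x (r / 2); first by rewrite divr_gt0.
have r32 : r * (3 / 2) < 2 * r by lra.
have [s] := rat_in_itvoo r32; rewrite in_itv/= => /andP[s1 s2].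
have s0 : 0 < s by rewrite -(ltr0q R) (lt_trans _ s1)// mulr_gt0// divr_gt0.
exists (pickle (q, s)); rewrite /rat_ball /rat_center /rat_radius /rat_ball_data;
  rewrite pickleK s0 /=; last exact: ltW.
by apply: eball_sub => /=; lra.
Qed.

End lebesgue_balls.

(** * Muckenhoupt weights on Euclidean balls *)

Section positive_integrals.
Context d (T : measurableType d) (R : realType).
Variable mu : {measure set T -> \bar R}.
Local Open Scope ereal_scope.

Lemma ae_exists (A : set T) (P : T -> Prop) : measurable A -> 0 < mu A ->
  {ae mu, forall x, A x -> P x} -> exists2 x, A x & P x.
Proof.
move=> mA A0 [N [mN N0 HN]]; apply: contrapT => nex.
have : mu A <= mu N.
  apply: le_measure; rewrite ?inE// => x Ax; apply: HN => /= AP.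
  by apply: nex; exists x => //; exact: AP.
by rewrite N0 leNgt A0.
Qed.

Lemma integral_gt0_of_pos (A : set T) (u : T -> R) : measurable A ->
  measurable_fun [set: T] u -> (forall x, 0 < u x)%R -> 0 < mu A ->
  0 < \int[mu]_(x in A) (u x)%:E.
Proof.
move=> mA mu_ u0 A0; rewrite lt0e integral_ge0 ?andbT; last first.
  by move=> x _; rewrite lee_fin ltW.
apply/negP => /eqP I0.
have mE : measurable_fun A (fun x => (u x)%:E).
  by apply/measurable_EFinP; exact: measurable_funTS.
have /(ae_eq_integral_abs mu mA mE) : \int[mu]_(x in A) `|(u x)%:E| = 0.
  by rewrite -[RHS]I0; apply: eq_integral => x _; rewrite gee0_abs// lee_fin ltW.
move=> /(ae_exists mA A0)[x _] /eqP; rewrite eqe => /eqP ux.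
by have := u0 x; rewrite ux ltxx.
Qed.

End positive_integrals.

Section muckenhoupt_weights.
Context {R : realType} {n : nat}.
Hypothesis n_gt0 : (0 < n)%N.
Implicit Types (x y : 'rV[R]_n) (r p K : R) (w V H : 'rV[R]_n -> R).
Local Notation leb := (@lebesgue_rV R n).
Local Open Scope ereal_scope.

(** The rational balls form a countable base. *)
Lemma open_measurable_rV (U : set 'rV[R]_n) : open U -> measurable U.
Proof.
rewrite openE => oU.
have -> : U = \bigcup_(k in [set k | rat_ball k `<=` U]) rat_ball k.
  apply/seteqP; split => [x Ux|x [k kU /kU]//].
  have /nbhs_ballP[e /= e0 eU] := oU _ Ux.
  have [|k xk rk] := @rat_ball_approx R n n_gt0 x (e / 4); first by rewrite divr_gt0.
  have xx : rat_ball k x by apply: xk; rewrite /eball/= subrr enorm0 divr_gt0.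
  exists k => //= y yk; apply: eU.
  have xy : (enorm (x - y) < e)%R.
    apply: le_lt_trans (enorm_triangle (rat_center k) _ _) _.
    rewrite (enormB (rat_center k)); move: xx yk; rewrite /rat_ball /eball/=.
    by move=> xx yk; lra.
  split => // i j; rewrite ord1 /ball/=; apply: le_lt_trans xy.
  by apply: le_trans (coord_le_enorm _ j); rewrite !mxE.
apply: bigcup_measurable => k _; exact: measurable_eball.
Qed.

Definition ap_balls p K w : Prop :=
  [/\ measurable_fun [set: 'rV[R]_n] w, forall x, (0 < w x)%R &
      forall x r, (0 < r)%R -> ap_on leb p K w (eball x r)].

Definition a1_balls K V : Prop :=
  [/\ measurable_fun [set: 'rV[R]_n] V, forall x, (0 < V x)%R &
      forall x r, (0 < r)%R -> {ae leb, forall y, eball x r y ->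
        \int[leb]_(z in eball x r) (V z)%:E <= (K * V y)%:E * leb (eball x r)}].

Lemma eball_gt0 x r : (0 < r)%R -> 0 < leb (eball x r).
Proof. by move=> r0; rewrite lebesgue_eballE// lte_fin ball_volume_gt0. Qed.

Lemma a1_ball_mass K V x r : a1_balls K V -> (0 < r)%R ->
  exists2 v : R, (0 < v)%R & \int[leb]_(z in eball x r) (V z)%:E = v%:E.
Proof.
move=> [mV V0 aV] r0.
have := integral_gt0_of_pos (measurable_eball x r) mV V0 (eball_gt0 x r0).
have [y _] := ae_exists (measurable_eball x r) (eball_gt0 x r0) (aV x r r0).
rewrite lebesgue_eballE//; case: (\int[leb]_(z in _) _) => [v|//|//] _ v0.
by exists v.
Qed.

(** Compact sets are measurable and contained in a ball about the origin. *)
Lemma weight_of_ball_mass w : measurable_fun [set: 'rV[R]_n] w ->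
  (forall x, 0 < w x)%R ->
  (forall r, (0 < r)%R -> \int[leb]_(z in eball 0%R r) (w z)%:E < +oo) -> weight w.
Proof.
move=> mw w0 fw; split => //; last by apply: aeW.
move=> K cK; have /compact_bounded [M [Mreal HM]] := cK.
have mK : measurable K.
  rewrite -[K]setCK; apply: measurableC; apply: open_measurable_rV.
  by apply: closed_openC; apply: compact_closed => //; exact: norm_hausdorff.
pose r := ((`|M| + 1) * n%:R + 1)%R.
have r0 : (0 < r)%R by rewrite ltr_wpDl// mulr_ge0// addr_ge0.
apply: le_lt_trans (fw r r0).
rewrite (eq_integral (fun x => (w x)%:E)); last first.
  by move=> x _; rewrite gee0_abs// lee_fin ltW.
apply: ge0_subset_integral; [exact: mK|exact: measurable_eball| | |].
- by apply/measurable_EFinP; exact: measurable_funTS.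
- by move=> x _; rewrite lee_fin ltW.
move=> x Kx; rewrite /eball/= subr0; apply: (le_lt_trans (enorm_le_sum x)).
apply: (@le_lt_trans _ _ (\sum_(i < n) (`|M| + 1)%R)%R).
  apply: ler_sum => i _; apply: (@le_trans _ _ `|x|%R).
    rewrite [leRHS]mx_normrE.
    exact: (le_bigmax _ (fun ij : 'I_1 * 'I_n => `|x ij.1 ij.2|%R) (0%R, i)).
  by apply: HM => //; rewrite (le_lt_trans (ler_norm M))// ltrDl.
by rewrite sumr_const card_ord -mulr_natr ltrDl.
Qed.

Lemma avgE w x r (a : R) : (0 < r)%R ->
  \int[leb]_(z in eball x r) (w z)%:E = a%:E ->
  avg w (eball x r) = (a / ball_volume x r)%:E.
Proof.
move=> r0 Ia; rewrite /avg /mass Ia lebesgue_eballE// inver gt_eqF//.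
exact: ball_volume_gt0.
Qed.

Lemma ap_on_avg p K w x r : (1 < p)%R -> (forall x, 0 < w x)%R ->
  measurable_fun [set: 'rV[R]_n] w -> (0 < r)%R -> ap_on leb p K w (eball x r) ->
  exists t : R, [/\ avg w (eball x r) *
      avg (fun y => w y `^ (1 - conj_exp p))%R (eball x r) `^ (p - 1) = t%:E,
      (1 <= t)%R & (t <= K)%R].
Proof.
move=> p1 w0 mw r0 [a [s [l [[a0 s0 l0] El Ea Es ap]]]].
have p0 : (0 < p)%R by rewrite (lt_trans ltr01).
have lE : ball_volume x r = l by rewrite /ball_volume El.
exists (a * s `^ (p - 1) / l `^ p)%R; split.
- rewrite (avgE r0 Ea) (avgE r0 Es) lE poweR_EFin -EFinM; congr EFin.
  rewrite powRM ?invr_ge0 ?(ltW s0) ?(ltW l0)//.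
  have -> : (l^-1 `^ (p - 1) = (l `^ (p - 1))^-1)%R.
    by rewrite -powR_inv1 ?(ltW l0)// -powRrM mulN1r powRN.
  rewrite -(mulr_powRB1 (ltW l0) p0).
  by field; rewrite !gt_eqF ?powR_gt0.
- rewrite ler_pdivlMr ?powR_gt0// mul1r.
  exact: (ap_on_ge p1 w0 mw (measurable_eball x r) a0 l0 El Ea Es).
- by rewrite ler_pdivrMr ?powR_gt0.
Qed.

(** The lower bound, which comes from Hoelder's inequality, places the constant in
    the range where a nondecreasing phi may be applied to it. *)
Lemma muckenhoupt_of_ap p K w : (1 < p)%R -> ap_balls p K w ->
  muckenhoupt p w /\ (1 <= fine (muckenhoupt_const p w) <= K)%R.
Proof.
move=> p1 [mw w0 apw].
have ub : Ap_const p w <= K%:E.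
  apply: ge_ereal_sup => _ [[x r] /= r0 <-].
  by have [t [-> _ tK]] := ap_on_avg p1 w0 mw r0 (apw x r r0).
have lb : 1 <= Ap_const p w.
  apply: le_ereal_sup_tmp; have [t [tE t1 _]] := ap_on_avg p1 w0 mw ltr01 (apw 0 1 ltr01)%R.
  exists t%:E; last by rewrite lee_fin.
  by exists (0%R, 1%R); [exact: ltr01|exact: tE].
have p1' : (p == 1%R) = false by rewrite gt_eqF.
split.
  split; last by rewrite p1' (le_lt_trans ub) ?ltry.
  apply: weight_of_ball_mass => // r r0.
  by have [a [s [l [_ _ -> _ _]]]] := apw 0%R r r0; exact: ltry.
rewrite /muckenhoupt_const p1'; move: (Ap_const p w) ub lb => [t| |]//.
by rewrite !lee_fin /= => -> ->.
Qed.

Lemma A1_bound_of_a1 K V : a1_balls K V -> A1_bound V K.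
Proof.
move=> aV x r r0; have [v v0 vE] := a1_ball_mass x aV r0.
have [_ _ {}aV] := aV; apply: filterS (aV x r r0) => y /[apply].
rewrite (avgE r0 vE) vE lebesgue_eballE// -EFinM !lee_fin ler_pdivrMr//.
exact: ball_volume_gt0.
Qed.

Lemma muckenhoupt_of_a1 K V : a1_balls K V ->
  muckenhoupt 1 V /\ (1 <= fine (muckenhoupt_const 1 V) <= K)%R.
Proof.
move=> aV; have [mV V0 _] := aV; have AV := A1_bound_of_a1 aV.
rewrite /muckenhoupt /muckenhoupt_const eqxx; split.
  split; last by exists K.
  apply: weight_of_ball_mass => // r r0.
  by have [v _ ->] := a1_ball_mass 0%R aV r0; exact: ltry.
have ub : A1_const V <= K%:E by apply: ereal_inf_lbound; exists K.
have lb : 1 <= A1_const V.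
  apply/ereal_infP => _ [c cV <-]; rewrite lee_fin.
  have [v v0 vE] := a1_ball_mass 0%R aV ltr01.
  have l0 := @ball_volume_gt0 R n n_gt0 0%R 1%R ltr01.
  set l := ball_volume _ _ in l0.
  have := cV 0%R 1%R ltr01; rewrite (avgE ltr01 vE) -/l => H.
  have mB := measurable_eball (0 : 'rV[R]_n) 1.
  have c0 : (0 < c)%R.
    have [y _] := ae_exists mB (eball_gt0 0%R ltr01) H.
    rewrite lee_fin => /(lt_le_trans (divr_gt0 v0 l0)).
    by rewrite pmulr_lgt0.
  have : \int[leb]_(z in eball 0%R 1%R) (v / l)%:E <=
         \int[leb]_(z in eball 0%R 1%R) (c%:E * (V z)%:E).
    apply: ae_ge0_le_integral; [exact: mB| |exact: measurable_cst| | |exact: H].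
    - by move=> z _; rewrite lee_fin ltW// divr_gt0.
    - by move=> z _; rewrite -EFinM lee_fin ltW// mulr_gt0.
    - by apply: measurable_funeM; apply/measurable_EFinP; exact: measurable_funTS.
  rewrite (integral_cst _ mB) (ge0_integralZl_EFin _ mB _ _ (ltW c0)); first last.
  - by apply/measurable_EFinP; exact: measurable_funTS.
  - by move=> z _; rewrite lee_fin ltW.
  rewrite vE [X in _ * X <= _](lebesgue_eballE 0%R ltr01) -/l -!EFinM lee_fin divfK ?gt_eqF//.
  by rewrite -[leLHS]mul1r ler_pM2r.
move: (A1_const V) ub lb => [t| |]//.
by rewrite !lee_fin /= => -> ->.
Qed.

End muckenhoupt_weights.

(** * Extrapolation on Euclidean balls *)

Section extrapolation_on_balls.
Context {R : realType} {n : nat}.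
Hypothesis n_gt0 : (0 < n)%N.
Implicit Types (x y : 'rV[R]_n) (r p K : R) (w V H : 'rV[R]_n -> R).
Local Notation leb := (@lebesgue_rV R n).
Local Open Scope ereal_scope.

Lemma a1_balls_of_rat C V : (0 < C)%R -> a1_class leb (@rat_ball R n) C V ->
  a1_balls (C * ((2 * 2) ^+ n / @ball_const R n)) V.
Proof.
move=> C0 [mV V0 aV]; split => // x r r0.
have [i xi ri] := @rat_ball_approx R n n_gt0 x r r0.
apply: filterS (aV i) => y + xy => /(_ (xi _ xy)) H.
apply: (@le_trans _ _ (\int[leb]_(z in rat_ball i) (V z)%:E)).
  apply: ge0_subset_integral; [exact: measurable_eball|exact: measurable_eball| | |exact: xi].
  - by apply/measurable_EFinP; exact: measurable_funTS.
  - by move=> z _; rewrite lee_fin ltW.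
apply: (le_trans H); rewrite mulrAC [leRHS](_ : _ = (C * V y)%:E *
    (((2 * 2) ^+ n / @ball_const R n)%:E * leb (eball x r))); last first.
  by rewrite muleA -EFinM.
rewrite lee_wpmul2l ?lee_fin ?mulr_ge0 ?(ltW C0) ?(ltW (V0 y))//.
by apply: lebesgue_eball_scale => //; exact: rat_radius_gt0.
Qed.

(** The easy half of the factorisation of A_p weights: on a ball an A_1 weight
    is bounded below by a multiple of its mean, which bounds from above its
    negative powers. *)
Lemma ap_on_of_a1 p K H V x r : (1 < p)%R -> (0 < K)%R ->
  a1_balls K H -> a1_balls K V -> (0 < r)%R ->
  ap_on leb p (K `^ p) (fun y => H y `^ (1 - p) * V y)%R (eball x r).
Proof.
move=> p1 K0 aH aV r0.
have [h h0 hE] := a1_ball_mass n_gt0 x aH r0.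
have [v v0 vE] := a1_ball_mass n_gt0 x aV r0.
have [mH H0 {}aH] := aH; have [mV V0 {}aV] := aV.
have p0 : (0 < p)%R by rewrite (lt_trans ltr01).
have q1 := conj_exp_gt1 p1; set q := conj_exp p in q1.
have mB := measurable_eball x r.
have lE := lebesgue_eballE x r0; set l := ball_volume x r in lE.
have l0 : (0 < l)%R by exact: ball_volume_gt0.
have low (m : R) (U : 'rV[R]_n -> R) (s : R) : (0 < m)%R -> (s <= 0)%R -> (forall y, 0 < U y)%R ->
    \int[leb]_(z in eball x r) (U z)%:E = m%:E ->
    {ae leb, forall y, eball x r y -> \int[leb]_(z in eball x r) (U z)%:E <=
      (K * U y)%:E * leb (eball x r)} ->
    {ae leb, forall y, eball x r y -> (U y `^ s <= (m / (K * l)) `^ s)%R}.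
  move=> m0 s0 U0 Um; apply: filterS => y /[apply].
  rewrite Um lE -EFinM lee_fin => mU; rewrite -[s]opprK ![(_ `^ - - s)%R]powRN.
  rewrite lef_pV2 ?posrE ?powR_gt0 ?divr_gt0 ?mulr_gt0//.
  rewrite ge0_ler_powR ?nnegrE ?oppr_ge0 ?divr_ge0 ?mulr_ge0 ?(ltW m0) ?(ltW K0) ?(ltW (U0 y)) ?(ltW l0)//.
  by rewrite ler_pdivrMr ?mulr_gt0// mulrCA mulrA.
have mpow (U : 'rV[R]_n -> R) (s : R) : measurable_fun [set: 'rV[R]_n] U ->
    measurable_fun [set: 'rV[R]_n] (fun y => U y `^ s)%R.
  by move=> mU; exact: (measurableT_comp (measurable_powR _)).
have bound (U1 U2 : 'rV[R]_n -> R) (c m : R) : measurable_fun [set: 'rV[R]_n] U1 ->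
    measurable_fun [set: 'rV[R]_n] U2 ->
    (forall y, 0 < U1 y)%R -> (forall y, 0 < U2 y)%R -> (0 < c)%R ->
    {ae leb, forall y, eball x r y -> (U1 y <= c)%R} ->
    \int[leb]_(y in eball x r) (U2 y)%:E = m%:E ->
    exists a, [/\ (0 < a)%R, (a <= c * m)%R &
      \int[leb]_(y in eball x r) (U1 y * U2 y)%:E = a%:E].
  move=> mU1 mU2 U10 U20 c0 U1c U2m.
  have mU : measurable_fun [set: 'rV[R]_n] (fun y => U1 y * U2 y)%R.
    exact: measurable_funM.
  have : \int[leb]_(y in eball x r) (U1 y * U2 y)%:E <= (c * m)%:E.
    have mE2 : measurable_fun (eball x r) (fun y => (U2 y)%:E).
      by apply/measurable_EFinP; exact: measurable_funTS.
    have U2ge0 y : eball x r y -> 0 <= (U2 y)%:E by move=> _; rewrite lee_fin ltW.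
    rewrite EFinM -U2m -(ge0_integralZl_EFin _ mB U2ge0 mE2 (ltW c0)).
    apply: ae_ge0_le_integral; [exact: mB| | | | |].
    - by move=> y _; rewrite lee_fin ltW// mulr_gt0.
    - by apply/measurable_EFinP; exact: measurable_funTS.
    - by move=> y _; rewrite -EFinM lee_fin ltW// mulr_gt0.
    - exact: measurable_funeM.
    - apply: filterS U1c => y /[apply] U1c.
      by rewrite -EFinM lee_fin ler_wpM2r// ltW.
  have := integral_gt0_of_pos mB mU (fun y => mulr_gt0 (U10 y) (U20 y))
    (eball_gt0 n_gt0 x r0).
  case: (\int[leb]_(y in _) _) => [a| |]//.
  by rewrite lte_fin lee_fin => a0 ac; exists a.
have p1' : (1 - p <= 0)%R by rewrite subr_le0 ltW.
have q1' : (1 - q <= 0)%R by rewrite subr_le0 ltW.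
have [a [a0 ac aE]] := bound _ _ _ v (mpow H (1 - p)%R mH) mV
  (fun y => powR_gt0 _ (H0 y)) V0 (powR_gt0 (1 - p) (divr_gt0 h0 (mulr_gt0 K0 l0)))
  (low h H (1 - p)%R h0 p1' H0 hE (aH x r r0)) vE.
have [s [s0 sc sE]] := bound _ _ _ h (mpow V (1 - q)%R mV) mH
  (fun y => powR_gt0 _ (V0 y)) H0 (powR_gt0 (1 - q) (divr_gt0 v0 (mulr_gt0 K0 l0)))
  (low v V (1 - q)%R v0 q1' V0 vE (aV x r r0)) hE.
exists a, s, l; split => //.
  rewrite -sE; apply: eq_integral => y _; congr EFin.
  rewrite /dual_weight -/q powRM ?powR_ge0 ?(ltW (V0 y))// -powRrM.
  rewrite (_ : (1 - p) * (1 - q) = 1)%R; last first.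
    by rewrite /q subr1_conj_exp// mulrN -mulNr opprB mulfV// subr_eq0 gt_eqF.
  by rewrite powRr1 ?(ltW (H0 y))// mulrC.
have p10 : (0 <= p - 1)%R by rewrite subr_ge0 ltW.
apply: (@le_trans _ _ ((h / (K * l)) `^ (1 - p) * v *
   ((v / (K * l)) `^ (1 - q) * h) `^ (p - 1))%R).
  apply: ler_pM; rewrite ?powR_ge0 ?(ltW a0)//.
  apply: ge0_ler_powR => //; rewrite nnegrE ?mulr_ge0 ?powR_ge0//; exact: ltW.
have Kl0 : (0 < K * l)%R by rewrite mulr_gt0.
rewrite [((_ `^ _ * h) `^ _)%R]powRM ?powR_ge0 ?(ltW h0)// -powRrM.
rewrite (_ : (1 - q) * (p - 1) = -1)%R; last first.
  by rewrite /q subr1_conj_exp// mulNr mulVf// subr_eq0 gt_eqF.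
rewrite powR_inv1 ?divr_ge0 ?(ltW v0) ?(ltW Kl0)// invf_div.
rewrite -(opprB p 1%R) powRN powRM ?(ltW h0) ?invr_ge0 ?(ltW Kl0)//.
have -> : ((K * l)^-1 `^ (p - 1) = ((K * l) `^ (p - 1))^-1)%R.
  by rewrite -powR_inv1 ?(ltW Kl0)// -powRrM mulN1r powRN.
rewrite -powRM ?(ltW K0) ?(ltW l0)// -[leRHS](mulr_powRB1 (ltW Kl0) p0).
rewrite le_eqVlt; apply/orP; left; apply/eqP; field.
by rewrite !gt_eqF ?powR_gt0.
Qed.

Lemma integral_le_of_Lnorm_le (p0 : R) f g w (t : R) :
  (1 <= p0)%R -> nonneg_measurable f -> nonneg_measurable g ->
  (0 < t)%R -> Lnorm_weight p0 w g <= t%:E * Lnorm_weight p0 w f ->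
  (forall x, 0 < w x)%R ->
  \int[leb]_x (g x `^ p0 * (w x)%:E) <= (t `^ p0)%:E * \int[leb]_x (f x `^ p0 * (w x)%:E).
Proof.
move=> p01 [mf f0] [mg g0] t0 H w0.
have p0' : (0 < p0)%R by rewrite (lt_le_trans ltr01).
have p0N : p0 != 0%R by rewrite gt_eqF.
have I0 (u : 'rV[R]_n -> \bar R) : 0 <= \int[leb]_x (u x `^ p0 * (w x)%:E).
  by apply: integral_ge0 => x _; rewrite mule_ge0 ?poweR_ge0// lee_fin ltW.
have E u : (forall x, 0 <= u x) -> Lnorm_weight p0 w u =
    (\int[leb]_x (u x `^ p0 * (w x)%:E)) `^ p0^-1.
  move=> u0; rewrite /Lnorm_weight; congr (_ `^ _).
  by apply: eq_integral => x _; rewrite gee0_abs.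
move: H; rewrite !E// => H.
rewrite -[leLHS](poweRVK p0N)// -[X in _ <= _ * X](poweRVK p0N)//.
rewrite -poweR_EFin -poweRM ?poweR_ge0 ?lee_fin ?(ltW t0)//.
by apply: le_poweR => //; [exact: ltW|exact: poweR_ge0].
Qed.

(** The rational balls form a countable family to which the abstract extrapolation
    applies; its weights H^(1 - p0) V are A_p0 weights whose constant is bounded
    in terms of p0, p, K and n alone. *)
Lemma extrapolation_balls (p0 p K : R)
    (F : set (('rV[R]_n -> \bar R) * ('rV[R]_n -> \bar R))) :
  (1 <= p0)%R -> (forall f g, F (f, g) -> nonneg_measurable f /\ nonneg_measurable g) ->
  weighted_bound p0 F -> (1 < p)%R -> (0 < K)%R ->
  exists2 C : R, (0 < C)%R & forall f g w, F (f, g) -> ap_balls p K w ->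
    \int[leb]_x (g x `^ p * (w x)%:E) <= C%:E * \int[leb]_x (f x `^ p * (w x)%:E).
Proof.
move=> p01 hF [phi [phi0 phi_nd hphi]] p1 K0.
pose D0 := ((2 * 3) ^+ n / @ball_const R n)%R.
have D00 : (0 < D0)%R by rewrite divr_gt0 ?exprn_gt0 ?ball_const_gt0.
have cov x : exists i, rat_ball i x.
  have [i xi _] := @rat_ball_approx R n n_gt0 x 1%R ltr01.
  by exists i; apply: xi; rewrite /eball/= subrr enorm0.
have mB i : measurable (@rat_ball R n i) by exact: measurable_eball.
have mBs i : measurable (@rat_ball3 R n i) by exact: measurable_eball.
have BBs i : @rat_ball R n i `<=` rat_ball3 i.
  by apply: eball_le; rewrite ler_peMl ?ler1n// ltW// rat_radius_gt0.
have [C1 C10 ext] := extrapolation mB mBs (@rat_ball_engulf R n) BBs D00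
  (rat_ball3_volume n_gt0) cov p1 K0.
pose K1 := (C1 * ((2 * 2) ^+ n / @ball_const R n))%R.
have K10 : (0 < K1)%R.
  by rewrite mulr_gt0// divr_gt0 ?exprn_gt0 ?mulr_gt0 ?ball_const_gt0.
pose M := Num.max 1%R (K1 `^ p0)%R.
have M1 : (1 <= M)%R by rewrite le_max lexx.
have [C C0 {}ext] := ext p0 (phi M `^ p0)%R p01 (powR_gt0 _ (phi0 _ M1)).
exists C => // f g w Ffg [mw w0 apw].
have [[mf f0] [mg g0]] := hF _ _ Ffg.
apply: ext => //.
  by split => // i; apply: apw; rewrite ?mulr_gt0 ?rat_radius_gt0.
move=> H V /(a1_balls_of_rat C10) aH /(a1_balls_of_rat C10) aV.
rewrite -/K1 in aH aV; have [mH H0 _] := aH; have [mV V0 _] := aV.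
pose W y := (H y `^ (1 - p0) * V y)%R.
have W0 y : (0 < W y)%R by rewrite mulr_gt0// powR_gt0.
have mW : measurable_fun [set: 'rV[R]_n] W.
  by apply: measurable_funM; [exact: (measurableT_comp (measurable_powR _))|exact: mV].
have [muckW /andP[cW1 cWM]] : muckenhoupt p0 W /\
    (1 <= fine (muckenhoupt_const p0 W) <= M)%R.
  have [p0E|p0N] := eqVneq p0 1%R.
    have WV : W = V by apply/funext => y; rewrite /W p0E subrr powRr0 mul1r.
    have [mV' /andP[c1 cK]] := muckenhoupt_of_a1 n_gt0 aV.
    rewrite WV p0E; split => //; rewrite c1 /M p0E powRr1 ?(ltW K10)//.
    by rewrite le_max cK orbT.
  have p01' : (1 < p0)%R by rewrite lt_neqAle eq_sym p0N.
  have apW : ap_balls p0 (K1 `^ p0) W.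
    by split => // x r r0; exact: ap_on_of_a1.
  have [mW' /andP[c1 cK]] := muckenhoupt_of_ap n_gt0 p01' apW.
  by split => //; rewrite c1 le_max cK orbT.
apply: (integral_le_of_Lnorm_le p01 (hF _ _ Ffg).1 (hF _ _ Ffg).2) => //.
- exact: phi0.
- apply: (le_trans (hphi f g W Ffg muckW)); rewrite lee_wpmul2r//.
    exact: poweR_ge0.
  by rewrite lee_fin phi_nd.
Qed.

End extrapolation_on_balls.

(** * Radial weights *)

Section dyadic_series.
Context d (T : measurableType d) (R : realType).
Variable mu : {measure set T -> \bar R}.
Local Open Scope ereal_scope.

Lemma integral_le_geometric (E : set T) (B : nat -> set T) (W : T -> R)
    (u : T -> \bar R) (c : nat -> R) (a q : R) :
  measurable E -> (forall k, measurable (B k)) ->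
  measurable_fun [set: T] W -> (forall x, 0 <= W x)%R ->
  measurable_fun [set: T] u -> (forall x, 0 <= u x) ->
  (forall k, 0 <= c k)%R -> (0 <= a)%R -> (0 <= q < 1)%R ->
  (forall x, E x -> exists2 k, B k x & (W x <= c k)%R) ->
  (forall k, (c k)%:E * \int[mu]_(x in B k) u x <= (a * q ^+ k)%:E) ->
  \int[mu]_(x in E) ((W x)%:E * u x) <= (a / (1 - q))%:E.
Proof.
move=> mE mB mW W0 mu_ u0 c0 a0 q01 Wc cu.
have mr k : measurable_fun [set: T] (fun x => (c k)%:E * (u \_ (B k)) x).
  by apply: measurable_funeM; apply/(measurable_restrictT _ (mB k))/measurable_funTS.
have r0 k x : 0 <= (c k)%:E * (u \_ (B k)) x.
  by rewrite mule_ge0 ?lee_fin//; apply: erestrict_ge0.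
apply: (@le_trans _ _ (\int[mu]_(x in E) \sum_(k <oo) (c k)%:E * (u \_ (B k)) x)).
  apply: ge0_le_integral => //.
  - by move=> x _; rewrite mule_ge0// lee_fin.
  - apply: measurable_funTS; apply: emeasurable_funM => //.
    exact/measurable_EFinP.
  - by apply: measurable_funTS; exact: ge0_emeasurable_sum.
  move=> x /Wc[k Bx Wk].
  apply: le_trans (nneseries_lim_ge k.+1 (fun n _ _ => r0 n x)).
  rewrite big_nat_recr//=; apply: (@le_trans _ _ ((c k)%:E * (u \_ (B k)) x)).
    by rewrite /patch mem_set// lee_wpmul2r// lee_fin.
  by rewrite leeDr// sume_ge0.
apply: (@le_trans _ _ (\int[mu]_x \sum_(k <oo) (c k)%:E * (u \_ (B k)) x)).
  apply: ge0_subset_integral => //; first exact: ge0_emeasurable_sum.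
  by move=> x _; exact: nneseries_ge0.
rewrite integral_nneseries//; apply: le_trans (geometric_eseries_le a0 q01).
apply: lee_nneseries => k _ => [_|]; first exact: integral_ge0.
rewrite ge0_integralZl_EFin//; last 2 first.
- by move=> x _; apply: erestrict_ge0.
- by apply/(measurable_restrictT _ (mB k))/measurable_funTS.
by rewrite -integral_mkcond.
Qed.

End dyadic_series.

Section radial_weights.
Context {R : realType} {n : nat}.
Hypothesis n_gt0 : (0 < n)%N.
Implicit Types (x y z : 'rV[R]_n) (r s : R).
Local Notation leb := (@lebesgue_rV R n).
Local Open Scope ereal_scope.

Lemma powR_dyadic (a t s : R) k : (0 <= a)%R -> (0 <= t)%R ->
  ((a * t ^+ k) `^ s = a `^ s * (t `^ s) ^+ k)%R.
Proof.
move=> a0 t0; rewrite powRM ?exprn_ge0//; congr (_ * _)%R.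
by rewrite -powR_mulrn// powRAC powR_mulrn// powR_ge0.
Qed.

Lemma powR_lt1 (t s : R) : (0 < t < 1)%R -> (0 < s)%R -> (0 <= t `^ s < 1)%R.
Proof.
move=> /andP[t0 t1] s0; rewrite powR_ge0/= [ltRHS](_ : 1 = 1 `^ s)%R; last by rewrite powR1.
by rewrite gt0_ltr_powR ?nnegrE ?ler01// ltW.
Qed.

Lemma ge_powRN (a b s : R) : (0 <= s)%R -> (0 < a)%R -> (a <= b)%R ->
  (b `^ (- s) <= a `^ (- s))%R.
Proof.
move=> s0 a0 ab; have b0 := lt_le_trans a0 ab.
by rewrite !powRN lef_pV2 ?posrE ?powR_gt0// ge0_ler_powR ?nnegrE ?(ltW a0) ?(ltW b0).
Qed.

(** With a negative exponent and a scale r > 0, this is the substitute for the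
    characteristic function of the ball of centre z and radius r, which is not a
    weight. *)
Definition radial_weight z r s x : R := ((r + enorm (x - z)) `^ s)%R.

Lemma measurable_radial_weight z r s :
  measurable_fun [set: 'rV[R]_n] (radial_weight z r s).
Proof.
apply: (measurableT_comp (measurable_powR _)).
by apply: measurable_funD; [exact: measurable_cst|exact: measurable_enormB].
Qed.

(** The contributions of the dyadic balls that shrink to z decrease
    geometrically, as delta < kappa. *)
Lemma radial_weight_inner (kappa delta : R) : (0 <= delta)%R -> (delta < kappa)%R ->
  exists2 C : R, (0 < C)%R & forall u z r rho A,
    measurable_fun [set: 'rV[R]_n] u -> (forall x, 0 <= u x) ->
    (0 <= r)%R -> (0 < rho)%R -> (0 <= A)%R ->
    (forall s, (0 < s)%R -> \int[leb]_(x in eball z s) u x <= (A * s `^ kappa)%:E) ->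
    \int[leb]_(x in eball z rho) ((radial_weight z r (- delta) x)%:E * u x) <=
    (C * A * rho `^ (kappa - delta))%:E.
Proof.
move=> d0 dk; have kd0 : (0 < kappa - delta)%R by rewrite subr_gt0.
pose q := ((2^-1) `^ (kappa - delta))%R.
have q01 : (0 <= q < 1)%R.
  by apply: powR_lt1 => //; rewrite invr_gt0 ltr0n/= invf_lt1// ltr1n.
have /andP[q0 q1] := q01.
exists (2 `^ delta / (1 - q))%R; first by rewrite divr_gt0 ?powR_gt0// subr_gt0.
move=> u z r rho A mu_ u0 r0 rho0 A0 HA.
have h0 : (0 <= 2^-1 :> R)%R by rewrite invr_ge0.
pose s k := (rho * 2^-1 ^+ k)%R.
have s0 k : (0 < s k)%R by rewrite mulr_gt0 ?exprn_gt0 ?invr_gt0.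
have -> : (2 `^ delta / (1 - q) * A * rho `^ (kappa - delta) =
   2 `^ delta * A * rho `^ (kappa - delta) / (1 - q))%R.
  by field; rewrite gt_eqF// subr_gt0.
apply: (@integral_le_geometric _ _ _ leb _ (fun k => eball z (s k)) _ _
  (fun k => (s k / 2) `^ (- delta))%R) => //.
- exact: measurable_eball.
- by move=> k; exact: measurable_eball.
- exact: measurable_radial_weight.
- by move=> x; exact: powR_ge0.
- by move=> k; exact: powR_ge0.
- by rewrite !mulr_ge0 ?powR_ge0.
- move=> x xz; rewrite /radial_weight; set y := (r + enorm (x - z))%R.
  have y0 : (0 <= y)%R by rewrite addr_ge0 ?enorm_ge0.
  have [yrho|rhoy] := ltP y rho; last first.
    exists 0%N; first by rewrite /s expr0 mulr1.
    apply: ge_powRN; rewrite ?divr_gt0//; apply: le_trans rhoy.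
    by rewrite /s expr0 mulr1 ler_pdivrMr// ler_peMr ?ler1n// ltW.
  have [y_0|yN0] := eqVneq y 0%R.
    exists 0%N; first by rewrite /s expr0 mulr1.
    rewrite y_0; have [->|dN0] := eqVneq delta 0%R; first by rewrite oppr0 !powRr0.
    by rewrite powR0 ?powR_ge0// oppr_eq0.
  have {}y0 : (0 < y)%R by rewrite lt0r yN0.
  have [k [k1 k2]] := dyadic_level_exists y0 yrho.
  exists k.
    rewrite /eball/=; apply: (@le_lt_trans _ _ y); first by rewrite lerDr.
    by rewrite /s exprVn ltr_pdivlMr ?exprn_gt0.
  apply: ge_powRN => //; first by rewrite divr_gt0.
  by rewrite /s exprVn -mulrA -invfM -exprSr ler_pdivrMr ?exprn_gt0.
- move=> k; apply: le_trans (lee_wpmul2l _ (HA _ (s0 k))) _.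
    by rewrite lee_fin powR_ge0.
  rewrite -EFinM lee_fin le_eqVlt; apply/orP; left; apply/eqP.
  have E1 : ((s k) `^ (- delta) * (s k) `^ kappa =
      rho `^ (kappa - delta) * q ^+ k)%R.
    by rewrite -powRD ?(gt_eqF (s0 k)) ?implybT// addrC powR_dyadic// ltW.
  have E2 : ((2^-1) `^ (- delta) = 2 `^ delta :> R)%R.
    by rewrite -powR_inv1// -powRrM mulN1r opprK.
  rewrite powRM ?(ltW (s0 k))// E2.
  rewrite [LHS](_ : _ = A * 2 `^ delta * (s k `^ (- delta) * s k `^ kappa))%R.
    by rewrite E1 (mulrC A) !mulrA.
  by ring.
Qed.

(** The contributions of the dyadic balls that grow from the scale r decrease
    geometrically, as kappa < gamma. *)
Lemma radial_weight_outer (kappa gamma : R) : (0 <= gamma)%R -> (kappa < gamma)%R ->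
  exists2 C : R, (0 < C)%R & forall u z r A,
    measurable_fun [set: 'rV[R]_n] u -> (forall x, 0 <= u x) ->
    (0 < r)%R -> (0 <= A)%R ->
    (forall s, (r <= s)%R -> \int[leb]_(x in eball z s) u x <= (A * s `^ kappa)%:E) ->
    \int[leb]_x ((radial_weight z r (- gamma) x)%:E * u x) <=
    (C * A * r `^ (kappa - gamma))%:E.
Proof.
move=> g0 kg; pose q := (2 `^ (kappa - gamma) : R)%R.
have q01 : (0 <= q < 1)%R.
  have -> : q = (2^-1 `^ (gamma - kappa))%R.
    by rewrite -powR_inv1// -powRrM mulN1r opprB.
  apply: powR_lt1; last by rewrite subr_gt0.
  by rewrite invr_gt0 ltr0n/= invf_lt1// ltr1n.
have /andP[q0 q1] := q01.
exists (4 `^ kappa / (1 - q))%R; first by rewrite divr_gt0 ?powR_gt0// subr_gt0.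
move=> u z r A mu_ u0 r0 A0 HA.
pose t k := (r * 2 ^+ k)%R.
have t0 k : (0 < t k)%R by rewrite mulr_gt0 ?exprn_gt0.
have rt k : (r <= t k)%R by rewrite ler_peMr ?(ltW r0)// exprn_ege1// ler1n.
have -> : (4 `^ kappa / (1 - q) * A * r `^ (kappa - gamma) =
   4 `^ kappa * A * r `^ (kappa - gamma) / (1 - q))%R.
  by field; rewrite gt_eqF// subr_gt0.
apply: (@integral_le_geometric _ _ _ leb _ (fun k => eball z (4 * t k)) _ _
  (fun k => (t k) `^ (- gamma))%R) => //.
- by move=> k; exact: measurable_eball.
- exact: measurable_radial_weight.
- by move=> x; exact: powR_ge0.
- by move=> k; exact: powR_ge0.
- by rewrite !mulr_ge0 ?powR_ge0.
- move=> x _; rewrite /radial_weight /eball/=; set y := enorm (x - z).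
  have y0 : (0 <= y)%R by exact: enorm_ge0.
  have [ry|yr] := ltP r y; last first.
    exists 0%N; rewrite /t expr0 mulr1; last by apply: ge_powRN; rewrite // lerDl.
    by rewrite (le_lt_trans yr)// ltr_pMl// ltr1n.
  have [k [k1 k2]] := dyadic_level_exists r0 ry.
  exists k; first by move: k2; rewrite exprS mulrCA -/(t k) => k2; have := t0 k; lra.
  by apply: ge_powRN => //; rewrite -/(t k) in k1; rewrite (le_trans (ltW k1))// lerDr ltW.
- move=> k.
  have t4 : (r <= 4 * t k)%R by rewrite (le_trans (rt k))// ler_peMl ?ler1n// ltW.
  apply: le_trans (lee_wpmul2l _ (HA _ t4)) _; first by rewrite lee_fin powR_ge0.
  rewrite -EFinM lee_fin le_eqVlt; apply/orP; left; apply/eqP.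
  have E1 : ((t k) `^ (- gamma) * (t k) `^ kappa =
      r `^ (kappa - gamma) * q ^+ k)%R.
    by rewrite -powRD ?(gt_eqF (t0 k)) ?implybT// addrC powR_dyadic// ltW.
  rewrite powRM ?(ltW (t0 k))//.
  rewrite [LHS](_ : _ = A * 4 `^ kappa * (t k `^ (- gamma) * t k `^ kappa))%R.
    by rewrite E1 (mulrC A) !mulrA.
  by ring.
Qed.

Lemma radial_weight_ge z r s y rho x : (0 <= s)%R -> (0 <= r)%R -> (0 < rho)%R ->
  (0 < r + enorm (x - z))%R -> eball y rho x ->
  ((r + enorm (y - z) + rho) `^ (- s) <= radial_weight z r (- s) x)%R.
Proof.
move=> s0 r0 rho0 rx0 xy; apply: ge_powRN => //.
rewrite -addrA lerD2l; apply: (le_trans (enorm_triangle y _ _)).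
by rewrite [leRHS]addrC lerD2r ltW.
Qed.

(** Away from the centre the weight is almost constant on the ball; otherwise
    the ball is contained in a larger one with the same centre as the weight. *)
Lemma radial_weight_mass (gamma : R) : (0 <= gamma)%R -> (gamma < n%:R)%R ->
  exists2 C : R, (0 < C)%R & forall z r y rho, (0 <= r)%R -> (0 < rho)%R ->
    \int[leb]_(x in eball y rho) (radial_weight z r (- gamma) x)%:E <=
    (C * (r + enorm (y - z) + rho) `^ (- gamma) * rho ^+ n)%:E.
Proof.
move=> g0 gn; have [C0 C00 inner] := radial_weight_inner g0 gn.
exists (3 `^ gamma * 2 ^+ n + C0 * 2 ^+ n * 3 ^+ n)%R.
  by rewrite addr_gt0 ?mulr_gt0 ?powR_gt0 ?exprn_gt0.
move=> z r y rho r0 rho0.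
set N := (r + enorm (y - z) + rho)%R.
have N0 : (0 < N)%R by rewrite ltr_wpDl// addr_ge0 ?enorm_ge0.
have three a : (0 < a)%R -> ((a / 3) `^ (- gamma) = 3 `^ gamma * a `^ (- gamma))%R.
  move=> a0; rewrite powRM ?invr_ge0 ?(ltW a0)// mulrC; congr (_ * _)%R.
  by rewrite -powR_inv1// -powRrM mulN1r opprK.
have mB := measurable_eball y rho.
have mW : measurable_fun [set: 'rV[R]_n] (fun x => (radial_weight z r (- gamma) x)%:E).
  by apply/measurable_EFinP; exact: measurable_radial_weight.
have [far|near] := leP (2 * rho)%R (r + enorm (y - z))%R.
  apply: (@le_trans _ _ (\int[leb]_(x in eball y rho) ((N / 3) `^ (- gamma))%:E)).
    apply: ge0_le_integral; [exact: mB| | | |].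
    - by move=> x _; rewrite lee_fin powR_ge0.
    - exact: measurable_funTS.
    - exact: measurable_cst.
    move=> x xy; rewrite lee_fin; apply: ge_powRN; rewrite ?divr_gt0//.
    have : (enorm (y - z) <= enorm (x - z) + rho)%R.
      apply: (le_trans (enorm_triangle x _ _)); rewrite [leRHS]addrC lerD2r enormB.
      exact: ltW.
    by rewrite /N; move: far => ? ?; rewrite ler_pdivrMr//; lra.
  rewrite integral_cst//; apply: le_trans (lee_wpmul2l _ (lebesgue_eball_le y rho0)) _.
    by rewrite lee_fin powR_ge0.
  rewrite -EFinM lee_fin three// exprMn.
  rewrite [leLHS](_ : _ = 3 `^ gamma * 2 ^+ n * N `^ (- gamma) * rho ^+ n)%R; last by ring.
  rewrite ler_wpM2r ?exprn_ge0 ?(ltW rho0)// ler_wpM2r ?powR_ge0// lerDl.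
  by rewrite !mulr_ge0 ?exprn_ge0// ltW.
have n0 : (0 < n%:R :> R)%R by rewrite ltr0n.
have rho30 : (0 < 3 * rho)%R by rewrite mulr_gt0.
apply: (@le_trans _ _ (\int[leb]_(x in eball z (3 * rho))
    ((radial_weight z r (- gamma) x)%:E * 1))).
  rewrite [leRHS](eq_integral (fun x => (radial_weight z r (- gamma) x)%:E)); last first.
    by move=> x _; rewrite mule1.
  apply: ge0_subset_integral; [exact: mB|exact: measurable_eball| | |].
  - exact: measurable_funTS.
  - by move=> x _; rewrite lee_fin powR_ge0.
  - by apply: eball_sub; move: near; lra.
apply: le_trans (inner (fun=> 1) z r (3 * rho)%R (2 ^+ n)%R _ _ _ _ _ _) _ => //.
  move=> s s0; rewrite integral_cst; last exact: measurable_eball.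
  by rewrite mul1e powR_mulrn ?(ltW s0)// -exprMn lebesgue_eball_le.
rewrite lee_fin powRD ?(gt_eqF rho30) ?implybT// powR_mulrn ?(ltW rho30)// exprMn.
have H : ((3 * rho) `^ (- gamma) <= N `^ (- gamma))%R.
  by apply: ge_powRN => //; rewrite /N; move: near; lra.
rewrite [leLHS](_ : _ = C0 * 2 ^+ n * 3 ^+ n * (3 * rho) `^ (- gamma) * rho ^+ n)%R.
  rewrite ler_wpM2r ?exprn_ge0 ?(ltW rho0)//.
  apply: ler_pM; rewrite ?powR_ge0 ?mulr_ge0 ?exprn_ge0 ?(ltW C00)//.
  by rewrite lerDr mulr_ge0 ?powR_ge0 ?exprn_ge0.
by ring.
Qed.

End radial_weights.

(** * Products of a weight with a radial weight *)

Section products_with_radial_weights.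
Context {R : realType} {n : nat}.
Hypothesis n_gt0 : (0 < n)%N.
Implicit Types (x y z : 'rV[R]_n) (r rho : R) (w : 'rV[R]_n -> R).
Local Notation leb := (@lebesgue_rV R n).
Local Notation vol := (@ball_volume R n).
Local Open Scope ereal_scope.

Lemma le_vol y rho : (0 < rho)%R -> (rho ^+ n <= (@ball_const R n)^-1 * vol y rho)%R.
Proof.
move=> rho0; rewrite ler_pdivlMl ?ball_const_gt0// -lee_fin.
by rewrite -lebesgue_eballE//; exact: lebesgue_eball_ge.
Qed.

Lemma measurable_pow_weight w (s : R) : measurable_fun [set: 'rV[R]_n] w ->
  measurable_fun [set: 'rV[R]_n] (fun x => w x `^ s)%R.
Proof. by move=> mw; exact: (measurableT_comp (measurable_powR _)). Qed.

Lemma radial_weight_pow z r (s t : R) x :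
  (radial_weight z r s x `^ t = radial_weight z r (s * t) x)%R.
Proof. by rewrite /radial_weight powRrM. Qed.

(** Hoelder's inequality with exponents sigma and its conjugate; the power of the
    radial weight that arises is still locally integrable. *)
Lemma rh_radial_mass (sigma gamma : R) : (1 < sigma)%R -> (0 <= gamma)%R ->
  (gamma * conj_exp sigma < n%:R)%R ->
  exists2 C : R, (0 < C)%R & forall w z r y rho (b : R),
    measurable_fun [set: 'rV[R]_n] w -> (forall x, 0 < w x)%R ->
    (0 < r)%R -> (0 < rho)%R -> (0 < b)%R ->
    \int[leb]_(x in eball y rho) (w x `^ sigma)%:E = b%:E ->
    \int[leb]_(x in eball y rho) (w x * radial_weight z r (- gamma) x)%:E <=
    (C * (b / vol y rho) `^ sigma^-1 *
     (r + enorm (y - z) + rho) `^ (- gamma) * vol y rho)%:E.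
Proof.
move=> s1 g0 gn; set tau := conj_exp sigma in gn.
have s0 : (0 < sigma)%R by rewrite (lt_trans ltr01).
have t1 : (1 < tau)%R by exact: conj_exp_gt1.
have t0 : (0 < tau)%R by rewrite (lt_trans ltr01).
have gt0 : (0 <= gamma * tau)%R by rewrite mulr_ge0// ltW.
have [C1 C10 HC] := radial_weight_mass n_gt0 gt0 gn.
pose C2 := (C1 / @ball_const R n)%R.
have C20 : (0 < C2)%R by rewrite divr_gt0 ?ball_const_gt0.
exists (2 * C2 `^ tau^-1)%R; first by rewrite mulr_gt0 ?powR_gt0.
move=> w z r y rho b mw w0 r0 rho0 b0 wb.
set v := radial_weight z r (- gamma); set N := (r + enorm (y - z) + rho)%R.
have N0 : (0 < N)%R by rewrite ltr_wpDl// addr_ge0 ?enorm_ge0 ?(ltW r0).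
set l := vol y rho; have l0 : (0 < l)%R by exact: ball_volume_gt0.
have v0 x : (0 < v x)%R.
  by rewrite powR_gt0// ltr_pwDl ?enorm_ge0.
have mv : measurable_fun [set: 'rV[R]_n] v by exact: measurable_radial_weight.
have [a aE] : exists a, a = ((b / l) `^ sigma^-1)%R by eexists.
have [c cE] : exists c, c = (C2 `^ tau^-1 * N `^ (- gamma))%R by eexists.
have a0 : (0 < a)%R by rewrite aE powR_gt0// divr_gt0.
have c0 : (0 < c)%R by rewrite cE mulr_gt0 ?powR_gt0.
have as_ : (a `^ sigma = b / l)%R.
  by rewrite aE -powRrM mulVf ?gt_eqF// powRr1// divr_ge0// ltW.
have ct : (c `^ tau = C2 * N `^ (- (gamma * tau)))%R.
  rewrite cE powRM ?powR_ge0// -powRrM mulVf ?gt_eqF// powRr1 ?(ltW C20)//.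
  by rewrite -powRrM mulNr.
have vt : \int[leb]_(x in eball y rho) (v x `^ tau)%:E <= (c `^ tau * l)%:E.
  rewrite (eq_integral (fun x => (radial_weight z r (- (gamma * tau)) x)%:E)); last first.
    by move=> x _; rewrite /v radial_weight_pow mulNr.
  apply: (le_trans (HC z r y rho (ltW r0) rho0)); rewrite lee_fin ct -/N.
  apply: (@le_trans _ _ (C1 * N `^ (- (gamma * tau)) * ((@ball_const R n)^-1 * l))%R).
    by rewrite ler_wpM2l ?mulr_ge0 ?powR_ge0 ?(ltW C10)//; exact: le_vol.
  by rewrite le_eqVlt; apply/orP; left; apply/eqP; rewrite /C2; ring.
have mB := measurable_eball y rho.
have mE (u : 'rV[R]_n -> R) : measurable_fun [set: 'rV[R]_n] u ->
    measurable_fun (eball y rho) (fun x => (u x)%:E).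
  by move=> mu_; apply/measurable_EFinP; exact: measurable_funTS.
apply: (@le_trans _ _ (\int[leb]_(x in eball y rho)
    ((a * c / a `^ sigma)%:E * (w x `^ sigma)%:E +
     (a * c / c `^ tau)%:E * (v x `^ tau)%:E))).
  apply: ge0_le_integral; [exact: mB| | | |].
  - by move=> x _; rewrite lee_fin mulr_ge0 ?(ltW (w0 x)) ?(ltW (v0 x)).
  - by apply: mE; exact: measurable_funM.
  - apply: emeasurable_funD; apply: measurable_funeM; apply: mE;
      exact: measurable_pow_weight.
  move=> x _; rewrite -!EFinM -EFinD lee_fin.
  have wa0 : (0 <= w x / a)%R by rewrite divr_ge0// ltW.
  have vc0 : (0 <= v x / c)%R by rewrite divr_ge0// ltW.
  have := conjugate_powR wa0 vc0 s0 t0 (inv_conj_expD s1).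
  rewrite !powRM ?invr_ge0 ?(ltW (w0 x)) ?(ltW (v0 x)) ?(ltW a0) ?(ltW c0)//.
  have inv (m e : R) : (0 < m)%R -> ((m^-1) `^ e = (m `^ e)^-1)%R.
    by move=> m0; rewrite -powR_inv1 ?(ltW m0)// -powRrM mulN1r powRN.
  rewrite !inv// => H.
  have {}H : (w x / a * (v x / c) <= w x `^ sigma / a `^ sigma + v x `^ tau / c `^ tau)%R.
    apply: (le_trans H); apply: lerD; rewrite ler_pdivrMr// ler_peMr ?(ltW s1) ?(ltW t1)//;
    by rewrite mulr_ge0 ?powR_ge0// invr_ge0 powR_ge0.
  rewrite [leLHS](_ : _ = a * c * (w x / a * (v x / c)))%R; last first.
    by field; rewrite !gt_eqF.
  rewrite [leRHS](_ : _ = a * c * (w x `^ sigma / a `^ sigma + v x `^ tau / c `^ tau))%R; last by ring.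
  by rewrite ler_wpM2l// mulr_ge0// ltW.
have ac0 (m e : R) : (0 <= a * c / m `^ e)%R.
  by rewrite !mulr_ge0 ?invr_ge0 ?powR_ge0 ?(ltW a0) ?(ltW c0).
have mpow (u : 'rV[R]_n -> R) (e : R) : measurable_fun [set: 'rV[R]_n] u ->
    measurable_fun (eball y rho) (fun x => (u x `^ e)%:E).
  by move=> mu_; apply: mE; exact: measurable_pow_weight.
have pow0 (u : 'rV[R]_n -> R) (e : R) x : eball y rho x -> 0 <= (u x `^ e)%:E.
  by move=> _; rewrite lee_fin powR_ge0.
rewrite ge0_integralD; [|exact: mB| | | |]; last first.
- by apply: measurable_funeM; exact: mpow.
- by move=> x xy; apply: mule_ge0; [rewrite lee_fin|exact: pow0 xy].
- by apply: measurable_funeM; exact: mpow.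
- by move=> x xy; apply: mule_ge0; [rewrite lee_fin|exact: pow0 xy].
rewrite (ge0_integralZl_EFin _ mB (pow0 w sigma) (mpow _ _ mw) (ac0 _ _)).
rewrite (ge0_integralZl_EFin _ mB (pow0 v tau) (mpow _ _ mv) (ac0 _ _)).
rewrite wb; apply: (@le_trans _ _ ((a * c * l)%:E + (a * c * l)%:E)).
  apply: leeD.
    rewrite as_ -EFinM lee_fin le_eqVlt; apply/orP; left; apply/eqP.
    by field; rewrite !gt_eqF.
  apply: le_trans (lee_wpmul2l _ vt) _; first by rewrite lee_fin.
  rewrite -EFinM lee_fin le_eqVlt; apply/orP; left; apply/eqP.
  by field; rewrite gt_eqF ?powR_gt0.
rewrite -EFinD lee_fin le_eqVlt; apply/orP; left; apply/eqP.
by rewrite -aE cE; ring.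
Qed.

(** The A_p and the reverse Hoelder conditions on one ball, merged: in the A_p
    inequality, the mean of w is replaced by its mean of order sigma. *)
Definition ap_rh_on p sigma K w y rho : Prop := exists b s : R,
  [/\ (0 < b)%R, (0 < s)%R,
      \int[leb]_(x in eball y rho) (w x `^ sigma)%:E = b%:E,
      \int[leb]_(x in eball y rho) (dual_weight p w x)%:E = s%:E &
      ((b / vol y rho) `^ sigma^-1 * (s / vol y rho) `^ (p - 1) <= K)%R].

(** On each ball the radial weight may be replaced by its infimum: for the mass of
    the product by the previous estimate, and for its dual mass trivially, the
    exponent 1 - p' being negative.  The infimum then cancels. *)
Lemma ap_balls_mul_radial (p sigma gamma K : R) : (1 < p)%R -> (1 < sigma)%R ->
  (0 <= gamma)%R -> (gamma * conj_exp sigma < n%:R)%R -> (0 < K)%R ->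
  exists2 K' : R, (0 < K')%R & forall w z r,
    measurable_fun [set: 'rV[R]_n] w -> (forall x, 0 < w x)%R ->
    (forall y rho, (0 < rho)%R -> ap_rh_on p sigma K w y rho) -> (0 < r)%R ->
    ap_balls p K' (fun x => w x * radial_weight z r (- gamma) x)%R.
Proof.
move=> p1 s1 g0 gn K0; have [C C0 HC] := rh_radial_mass s1 g0 gn.
exists (C * K)%R; first by rewrite mulr_gt0.
move=> w z r mw w0 apw r0.
have p0 : (0 < p)%R by rewrite (lt_trans ltr01).
have p10 : (0 < p - 1)%R by rewrite subr_gt0.
have q1 := conj_exp_gt1 p1.
set v := radial_weight z r (- gamma).
have v0 x : (0 < v x)%R by rewrite powR_gt0// ltr_pwDl ?enorm_ge0.
have mv : measurable_fun [set: 'rV[R]_n] v by exact: measurable_radial_weight.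
have mwv : measurable_fun [set: 'rV[R]_n] (fun x => w x * v x)%R by exact: measurable_funM.
have wv0 x : (0 < w x * v x)%R by rewrite mulr_gt0.
split => // y rho rho0; have [b [s [b0 s0 wb ws bs]]] := apw y rho rho0.
have mB := measurable_eball y rho.
have l0 : (0 < vol y rho)%R by exact: ball_volume_gt0.
set N := (r + enorm (y - z) + rho)%R.
have N0 : (0 < N)%R by rewrite ltr_wpDl// addr_ge0 ?enorm_ge0 ?(ltW r0).
have := HC w z r y rho b mw w0 r0 rho0 b0 wb; rewrite -/v -/N => Ha.
have := integral_gt0_of_pos mB mwv wv0 (eball_gt0 n_gt0 y rho0).
case Ea : (\int[leb]_(x in eball y rho) (w x * v x)%:E) Ha => [a| |]// Ha.
rewrite lee_fin in Ha; rewrite lte_fin => a0.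
have mdwv : measurable_fun [set: 'rV[R]_n] (dual_weight p (fun x => w x * v x)%R).
  exact: measurable_dual_weight.
have Hs : \int[leb]_(x in eball y rho) (dual_weight p (fun x => w x * v x)%R x)%:E <=
    ((N `^ (- gamma)) `^ (1 - conj_exp p) * s)%:E.
  have mdw : measurable_fun (eball y rho) (fun x => (dual_weight p w x)%:E).
    by apply/measurable_EFinP; apply: measurable_funTS; exact: measurable_dual_weight.
  have dw0 x : eball y rho x -> 0 <= (dual_weight p w x)%:E.
    by move=> _; rewrite lee_fin powR_ge0.
  rewrite EFinM -ws -(ge0_integralZl_EFin _ mB dw0 mdw (powR_ge0 _ _)).
  apply: ge0_le_integral; [exact: mB| | | |].
  - by move=> x _; rewrite lee_fin powR_ge0.
  - by apply/measurable_EFinP; exact: measurable_funTS.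
  - exact: measurable_funeM.
  move=> x xy; rewrite -EFinM lee_fin /dual_weight.
  rewrite (powRM _ (ltW (w0 x)) (ltW (v0 x))) mulrC; apply: (ler_wpM2r (powR_ge0 _ _)).
  rewrite -opprB; apply: ge_powRN; rewrite ?powR_gt0//.
    by rewrite subr_ge0 ltW.
  apply: radial_weight_ge => //; first exact: ltW.
  by rewrite ltr_pwDl ?enorm_ge0.
have := integral_gt0_of_pos mB mdwv (fun x => dual_weight_gt0 p (wv0 x)) (eball_gt0 n_gt0 y rho0).
case Es : (\int[leb]_(x in eball y rho) (dual_weight p (fun x => w x * v x)%R x)%:E) Hs => [s'| |]// Hs.
rewrite lee_fin in Hs; rewrite lte_fin => s'0.
exists a, s', (vol y rho); split => //; first exact: lebesgue_eballE.
have Hs' : (s' `^ (p - 1) <= N `^ gamma * s `^ (p - 1))%R.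
  have Hp := ge0_ler_powR (ltW p10) _ _ Hs.
  rewrite !nnegrE ?mulr_ge0 ?powR_ge0 ?(ltW s'0) ?(ltW s0)// in Hp.
  apply: (le_trans (Hp isT isT)); rewrite powRM ?powR_ge0 ?(ltW s0)//.
  have -> : (((N `^ (- gamma)) `^ (1 - conj_exp p)) `^ (p - 1) = N `^ gamma)%R.
    rewrite -!powRrM; congr (_ `^ _)%R; rewrite subr1_conj_exp//; field.
    by rewrite gt_eqF.
  by [].
apply: (le_trans (ler_pM (ltW a0) (powR_ge0 _ _) Ha Hs')).
set l := vol y rho in bs l0 *.
have -> : (s `^ (p - 1) = (s / l) `^ (p - 1) * l `^ (p - 1))%R.
  by rewrite -powRM ?divr_ge0 ?(ltW s0) ?(ltW l0)// divfK// gt_eqF.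
have NN : (N `^ (- gamma) * N `^ gamma = 1)%R.
  by rewrite powRN mulVf// gt_eqF// powR_gt0.
rewrite -(mulr_powRB1 (ltW l0) p0).
rewrite [leLHS](_ : _ = C * ((b / l) `^ sigma^-1 * (s / l) `^ (p - 1)) *
   (N `^ (- gamma) * N `^ gamma) * (l * l `^ (p - 1)))%R; last by ring.
rewrite NN mulr1 ler_wpM2r ?mulr_ge0 ?powR_ge0 ?(ltW l0)//.
by rewrite ler_wpM2l// ltW.
Qed.

(** The same replacement of the radial weight by its infimum on a ball; it is
    pointwise on the side where the A_1 condition has values of the weight. *)
Lemma a1_balls_mul_radial (sigma gamma K : R) : (1 < sigma)%R ->
  (0 <= gamma)%R -> (gamma * conj_exp sigma < n%:R)%R -> (0 < K)%R ->
  exists2 K' : R, (0 < K')%R & forall w z r,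
    measurable_fun [set: 'rV[R]_n] w -> (forall x, 0 < w x)%R ->
    (forall y rho, (0 < rho)%R -> exists b : R, [/\ (0 < b)%R,
      \int[leb]_(x in eball y rho) (w x `^ sigma)%:E = b%:E &
      {ae leb, forall x, eball y rho x ->
        ((b / vol y rho) `^ sigma^-1 <= K * w x)%R}]) -> (0 < r)%R ->
    a1_balls K' (fun x => w x * radial_weight z r (- gamma) x)%R.
Proof.
move=> s1 g0 gn K0; have [C C0 HC] := rh_radial_mass s1 g0 gn.
exists (C * K)%R; first by rewrite mulr_gt0.
move=> w z r mw w0 aw r0.
set v := radial_weight z r (- gamma).
have v0 x : (0 < v x)%R by rewrite powR_gt0// ltr_pwDl ?enorm_ge0.
have mv : measurable_fun [set: 'rV[R]_n] v by exact: measurable_radial_weight.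
split; first exact: measurable_funM.
  by move=> x; rewrite mulr_gt0.
move=> y rho rho0; have [b [b0 wb Hb]] := aw y rho rho0.
have := HC w z r y rho b mw w0 r0 rho0 b0 wb; rewrite -/v => Ha.
apply: filterS Hb => x /[swap] xy /(_ xy) Hb.
apply: (le_trans Ha); rewrite lebesgue_eballE// -EFinM lee_fin.
rewrite ler_wpM2r ?(ltW (ball_volume_gt0 n_gt0 y rho0))//.
rewrite [leRHS](_ : _ = C * (K * w x) * v x)%R; last by ring.
apply: ler_pM; rewrite ?mulr_ge0 ?powR_ge0 ?(ltW C0)//.
  by rewrite ler_wpM2l// ltW.
by apply: radial_weight_ge => //; rewrite ?(ltW r0)// ltr_pwDl ?enorm_ge0.
Qed.

End products_with_radial_weights.

(** * Morrey norms *)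

Section morrey_spaces.
Context {R : realType} {n : nat}.
Hypothesis n_gt0 : (0 < n)%N.
Implicit Types (x y z : 'rV[R]_n) (r rho : R) (w : 'rV[R]_n -> R).
Local Notation leb := (@lebesgue_rV R n).
Local Open Scope ereal_scope.

Lemma measurable_enorm_pow (s : R) :
  measurable_fun [set: 'rV[R]_n] (fun x => enorm x `^ s)%R.
Proof.
apply: measurable_pow_weight.
rewrite (_ : enorm = fun x : 'rV[R]_n => enorm (x - 0%R)).
  exact: measurable_enormB.
by apply/funext => x; rewrite subr0.
Qed.

Lemma ae_neq0 : {ae leb, forall x, x != 0%R}.
Proof.
have E0 : [set 0%R] = ~` [set x : 'rV[R]_n | x != 0%R].
  by apply/seteqP; split => x /=; [move=> ->; rewrite eqxx|move/negP; rewrite negbK => /eqP].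
have m0 : measurable ([set 0%R] : set 'rV[R]_n).
  have -> : [set 0%R] = \bigcap_k eball (0%R : 'rV[R]_n) (k.+1%:R^-1)%R.
    apply/seteqP; split => [x -> k _|x Hx].
      by rewrite /eball/= subrr enorm0 invr_gt0.
    apply: enorm_eq0; apply/eqP; rewrite eq_le enorm_ge0 andbT leNgt; apply/negP => x0.
    have := Hx (Num.truncn (enorm x)^-1) I; rewrite /eball/= subr0.
    apply/negP; rewrite -leNgt -[leRHS]invrK lef_pV2 ?posrE ?invr_gt0//.
    by rewrite ltW// truncnS_gt.
  apply: bigcap_measurableType => k _; exact: measurable_eball.
exists [set 0%R]; split; [exact: m0| exact: lebesgue_rV_set1|].
by rewrite E0.
Qed.

(** Removing the factor |x|^alpha from a Morrey bound: when alpha < lambda the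
    bounds on the annuli around the origin add up. *)
Lemma morrey_local (lambda alpha : R) : (0 <= alpha)%R ->
  (alpha < lambda)%R \/ alpha = 0%R ->
  exists2 C : R, (0 < C)%R & forall u (A : R),
    measurable_fun [set: 'rV[R]_n] u -> (forall x, 0 <= u x) -> (0 <= A)%R ->
    (forall x r, (0 < r)%R -> \int[leb]_(y in eball x r)
       ((enorm y `^ alpha)%:E * u y) <= (A * r `^ lambda)%:E) ->
    forall y rho, (0 < rho)%R -> \int[leb]_(x in eball y rho) u x <=
      (C * A * (rho + enorm y) `^ (- alpha) * rho `^ lambda)%:E.
Proof.
move=> a0 [al|a_0]; last first.
  exists 1%R => // u A mu_ u0 A0 HA y rho rho0; have := HA y rho rho0.
  rewrite a_0 oppr0 powRr0 mul1r mulr1.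
  by under eq_integral do rewrite powRr0 mul1e.
have [C0 C00 inner] := @radial_weight_inner R n lambda alpha a0 al.
exists (3 `^ alpha + C0 * 3 `^ lambda)%R.
  by rewrite addr_gt0 ?mulr_gt0 ?powR_gt0.
move=> u A mu_ u0 A0 HA y rho rho0; set N := (rho + enorm y)%R.
have N0 : (0 < N)%R by rewrite ltr_pwDl ?enorm_ge0.
have three : ((N / 3) `^ (- alpha) = 3 `^ alpha * N `^ (- alpha))%R.
  rewrite powRM ?invr_ge0 ?(ltW N0)// mulrC; congr (_ * _)%R.
  by rewrite -powR_inv1// -powRrM mulN1r opprK.
have mB := measurable_eball y rho.
pose u' x := (enorm x `^ alpha)%:E * u x.
have mu' : measurable_fun [set: 'rV[R]_n] u'.
  apply: emeasurable_funM; last exact: mu_.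
  by apply/measurable_EFinP; exact: measurable_enorm_pow.
have u'0 x : 0 <= u' x by rewrite mule_ge0// lee_fin powR_ge0.
have [far|near] := leP (2 * rho)%R (enorm y).
  pose m := (N / 3)%R; have m0 : (0 < m)%R by rewrite divr_gt0.
  apply: (@le_trans _ _ (\int[leb]_(x in eball y rho) ((m `^ (- alpha))%:E * u' x))).
    apply: ge0_le_integral; [exact: mB|by []|exact: measurable_funTS| |].
      by apply: measurable_funTS; exact: measurable_funeM.
    move=> x xy; rewrite /u' muleA -EFinM -[leLHS]mul1e lee_wpmul2r// lee_fin.
    have mx : (m <= enorm x)%R.
      have := enorm_triangle x y 0%R; rewrite !subr0 enormB.
      move: xy; rewrite /eball/= /m /N => xy h; rewrite ler_pdivrMr//; lra.
    have x0 : (0 < enorm x)%R by exact: lt_le_trans mx.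
    rewrite -[leLHS](@mulVf _ (enorm x `^ alpha)%R) ?gt_eqF ?powR_gt0//.
    by rewrite ler_wpM2r ?powR_ge0// -powRN; exact: ge_powRN.
  rewrite ge0_integralZl_EFin ?powR_ge0//; last exact: measurable_funTS.
  apply: le_trans (lee_wpmul2l _ (HA y rho rho0)) _; first by rewrite lee_fin powR_ge0.
  rewrite -EFinM lee_fin mulrA ler_wpM2r ?powR_ge0// [leRHS]mulrAC ler_wpM2r//.
  rewrite /m three ler_wpM2r ?powR_ge0// lerDl.
  by rewrite mulr_ge0 ?powR_ge0// ltW.
have rho30 : (0 < 3 * rho)%R by rewrite mulr_gt0.
have mV : measurable_fun [set: 'rV[R]_n]
    (fun x => (radial_weight 0%R 0%R (- alpha) x)%:E * u' x).
  apply: emeasurable_funM; last exact: mu'.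
  by apply/measurable_EFinP; exact: measurable_radial_weight.
have V0 x : 0 <= (radial_weight 0%R 0%R (- alpha) x)%:E * u' x.
  by rewrite mule_ge0// lee_fin powR_ge0.
apply: (@le_trans _ _ (\int[leb]_(x in eball y rho)
    ((radial_weight 0%R 0%R (- alpha) x)%:E * u' x))).
  apply: ae_ge0_le_integral; [exact: mB|by []|exact: measurable_funTS|by []| |].
    by apply: measurable_funTS; exact: mV.
  apply: filterS ae_neq0 => x x0 _; rewrite /u' muleA -EFinM.
  have ex0 : (0 < enorm x)%R.
    rewrite lt0r enorm_ge0 andbT; apply: contra_neq x0; exact: enorm_eq0.
  rewrite /radial_weight subr0 add0r powRN mulVf ?mul1e//.
  by rewrite gt_eqF// powR_gt0.
apply: (@le_trans _ _ (\int[leb]_(x in eball 0%R (3 * rho))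
    ((radial_weight 0%R 0%R (- alpha) x)%:E * u' x))).
  apply: ge0_subset_integral; [exact: mB|exact: measurable_eball| |by []|].
    by apply: measurable_funTS; exact: mV.
  by apply: eball_sub; rewrite subr0; move: near; lra.
apply: (le_trans (inner u' 0%R 0%R _ A mu' u'0 (lexx _) rho30 A0 (HA 0%R))).
rewrite lee_fin powRD ?(gt_eqF rho30) ?implybT//.
have H : ((3 * rho) `^ (- alpha) <= N `^ (- alpha))%R.
  by apply: ge_powRN => //; rewrite /N; move: near; lra.
rewrite powRM ?(ltW rho0)//.
rewrite [leLHS](_ : _ = C0 * 3 `^ lambda * A * (3 * rho) `^ (- alpha) * rho `^ lambda)%R.
  rewrite ler_wpM2r ?powR_ge0//.
  apply: ler_pM; rewrite ?powR_ge0 ?mulr_ge0 ?powR_ge0 ?(ltW C00)//.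
  by rewrite ler_wpM2r// lerDr powR_ge0.
by ring.
Qed.

(** On the ball of centre z and radius r the radial weight is at least
    (2 r)^(- gamma), so its weighted norm of g controls the integral of g over the
    ball.  For f, the integral against the radial weight is a sum over dyadic
    balls about z, to which the Morrey norm applies; it converges as
    lambda < gamma.  On the ball |x|^alpha is at most (r + |z|)^alpha, and the
    opposite power of r + |z| comes from the removal of |x|^alpha for f. *)
Lemma morrey_of_radial (p lambda gamma alpha C0 : R) w
    (F : set (('rV[R]_n -> \bar R) * ('rV[R]_n -> \bar R))) :
  (0 < p)%R -> (0 <= lambda)%R -> (lambda < gamma)%R -> (0 <= alpha)%R ->
  (alpha < lambda)%R \/ alpha = 0%R ->
  measurable_fun [set: 'rV[R]_n] w -> (forall x, 0 < w x)%R ->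
  (forall f g, F (f, g) -> nonneg_measurable f /\ nonneg_measurable g) ->
  (0 < C0)%R ->
  (forall f g z r, F (f, g) -> (0 < r)%R ->
    \int[leb]_x (g x `^ p * (w x * radial_weight z r (- gamma) x)%:E) <=
    C0%:E * \int[leb]_x (f x `^ p * (w x * radial_weight z r (- gamma) x)%:E)) ->
  morrey_bound p lambda (fun x => enorm x `^ alpha * w x)%R F.
Proof.
move=> p0 l0 lg a0 al mw w0 hF C00 hyp.
have g0 : (0 <= gamma)%R by rewrite (le_trans l0)// ltW.
have [C1 C10 local] := morrey_local a0 al.
have [C2 C20 outer] := @radial_weight_outer R n _ _ g0 lg.
pose C := (2 `^ gamma * C0 * C1 * C2)%R.
have CC : (0 < C)%R by rewrite !mulr_gt0 ?powR_gt0.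
exists (C `^ p^-1)%R; first by rewrite powR_gt0.
move=> f g Ffg; have [[mf f0] [mg g0']] := hF _ _ Ffg.
set M := morrey_norm p lambda _ f.
have pw (h : 'rV[R]_n -> \bar R) : measurable_fun [set: 'rV[R]_n] h ->
    measurable_fun [set: 'rV[R]_n] (fun x => h x `^ p * (w x)%:E).
  move=> mh; apply: emeasurable_funM; first exact: measurable_poweR_comp.
  exact/measurable_EFinP.
have pw0 (h : 'rV[R]_n -> \bar R) x : 0 <= h x `^ p * (w x)%:E.
  by rewrite mule_ge0 ?poweR_ge0// lee_fin ltW.
have me s : measurable_fun [set: 'rV[R]_n] (fun x => (enorm x `^ s)%:E).
  by apply/measurable_EFinP; exact: measurable_enorm_pow.
have mr z r s : measurable_fun [set: 'rV[R]_n] (fun x => (radial_weight z r s x)%:E).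
  by apply/measurable_EFinP; exact: measurable_radial_weight.
have IE h x r : (forall y, 0 <= h y) ->
    \int[leb]_(y in eball x r) (`|h y| `^ p * (enorm y `^ alpha * w y)%:E) =
    \int[leb]_(y in eball x r) ((enorm y `^ alpha)%:E * (h y `^ p * (w y)%:E)).
  by move=> h0; apply: eq_integral => y _; rewrite gee0_abs// EFinM muleCA.
have M0 : 0 <= M.
  apply: le_ereal_sup_tmp; eexists; first by exists (0%R, 1%R); [exact: ltr01|reflexivity].
  exact: poweR_ge0.
have [->|] := eqVneq M +oo; first by rewrite gt0_muley ?leey// lte_fin powR_gt0.
rewrite -ltey => Mfin.
have [nu nu0 ME] : exists2 nu : R, (0 <= nu)%R & M = nu%:E.
  by move: M M0 Mfin => [nu| |]// nu0 _; exists nu.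
pose A := (nu `^ p)%R; have A0 : (0 <= A)%R by exact: powR_ge0.
have fA x r : (0 < r)%R -> \int[leb]_(y in eball x r)
    ((enorm y `^ alpha)%:E * (f y `^ p * (w y)%:E)) <= (A * r `^ lambda)%:E.
  move=> r0; rewrite -IE//; set I := \int[leb]_(y in _) _.
  have rl : (0 < r `^ lambda)%R by rewrite powR_gt0.
  have I0 : 0 <= I.
    by apply: integral_ge0 => y _; rewrite mule_ge0 ?poweR_ge0// lee_fin mulr_ge0 ?powR_ge0// ltW.
  have HI : ((r `^ lambda)^-1%:E * I) `^ p^-1 <= nu%:E.
    by rewrite -ME; apply: ereal_sup_ubound; exists (x, r).
  have J0 : 0 <= (r `^ lambda)^-1%:E * I by rewrite mule_ge0// lee_fin invr_ge0 powR_ge0.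
  have := le_poweR (ltW p0) (poweR_ge0 _ _) HI.
  rewrite poweRVK ?gt_eqF// poweR_EFin lee_pdivrMl//.
  by rewrite -EFinM mulrC.
rewrite ME -EFinM; apply: ge_ereal_sup => _ [[x r] /= r0 <-].
rewrite IE//.
have rx0 : (0 < r + enorm x)%R by rewrite ltr_pwDl ?enorm_ge0.
have r20 : (0 < 2 * r)%R by rewrite mulr_gt0.
have mB := measurable_eball x r.
have gI : \int[leb]_(y in eball x r) ((enorm y `^ alpha)%:E * (g y `^ p * (w y)%:E)) <=
    ((r + enorm x) `^ alpha * (2 * r) `^ gamma)%:E *
    \int[leb]_y (g y `^ p * (w y * radial_weight x r (- gamma) y)%:E).
  have mgw : measurable_fun [set: 'rV[R]_n]
      (fun y => g y `^ p * (w y * radial_weight x r (- gamma) y)%:E).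
    apply: emeasurable_funM; first exact: measurable_poweR_comp.
    apply/measurable_EFinP; apply: measurable_funM; first exact: mw.
    exact: measurable_radial_weight.
  have gw0 y : 0 <= g y `^ p * (w y * radial_weight x r (- gamma) y)%:E.
    by rewrite mule_ge0 ?poweR_ge0// lee_fin mulr_ge0 ?powR_ge0// ltW.
  rewrite -ge0_integralZl_EFin; [|exact: measurableT|by move=> y _; exact: gw0|exact: mgw|by rewrite mulr_ge0 ?powR_ge0].
  have c0 : (0 <= (r + enorm x) `^ alpha * (2 * r) `^ gamma)%R by rewrite mulr_ge0 ?powR_ge0.
  apply: (@le_trans _ _ (\int[leb]_(y in eball x r)
      (((r + enorm x) `^ alpha * (2 * r) `^ gamma)%:E *
      (g y `^ p * (w y * radial_weight x r (- gamma) y)%:E)))).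
    apply: ge0_le_integral; [exact: mB| | | |].
    - by move=> y _; rewrite mule_ge0// lee_fin powR_ge0.
    - by apply: measurable_funTS; apply: emeasurable_funM; [exact: me|exact: pw].
    - by apply: measurable_funTS; exact: measurable_funeM.
    move=> y xy; rewrite muleCA -EFinM [leRHS]muleCA -EFinM.
    rewrite lee_wpmul2l ?poweR_ge0// lee_fin.
    have ey : (enorm y `^ alpha <= (r + enorm x) `^ alpha)%R.
      rewrite ge0_ler_powR ?nnegrE ?enorm_ge0 ?(ltW rx0)//.
      rewrite -[y](subrK x); apply: (le_trans (ler_enormD _ _)).
      by rewrite lerD2r ltW.
    have vy : (1 <= (2 * r) `^ gamma * radial_weight x r (- gamma) y)%R.
      rewrite -ler_pdivrMl; last exact: powR_gt0.
      rewrite mulr1 -powRN; apply: ge_powRN; first exact: g0.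
        by rewrite ltr_pwDl ?enorm_ge0.
      by move: xy; rewrite /eball/=; lra.
    rewrite [leRHS](_ : _ = (r + enorm x) `^ alpha * (w y *
      ((2 * r) `^ gamma * radial_weight x r (- gamma) y)))%R; last by ring.
    apply: ler_pM; rewrite ?powR_ge0 ?(ltW (w0 y))//.
    by rewrite ler_peMr// ltW.
  apply: ge0_subset_integral; [exact: mB|exact: measurableT|exact: measurable_funeM| |exact: subsetT].
  by move=> y _; rewrite mule_ge0// lee_fin.
have FI : \int[leb]_y (f y `^ p * (w y * radial_weight x r (- gamma) y)%:E) <=
    (C2 * (C1 * A * (r + enorm x) `^ (- alpha)) * r `^ (lambda - gamma))%:E.
  rewrite (eq_integral (fun y => (radial_weight x r (- gamma) y)%:E *
      (f y `^ p * (w y)%:E))); last first.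
    by move=> y _; rewrite EFinM muleC -muleA muleCA [_%:E * f y `^ p]muleC muleA.
  apply: outer; [exact: pw|exact: pw0|exact: r0|by rewrite !mulr_ge0 ?powR_ge0// ltW|].
  move=> s rs; have s0 := lt_le_trans r0 rs.
  apply: le_trans (local _ A (pw _ mf) (pw0 f) A0 fA x s s0) _.
  rewrite lee_fin ler_wpM2r ?powR_ge0// ler_wpM2l ?mulr_ge0 ?(ltW C10)//.
  by apply: ge_powRN => //; rewrite lerD2r.
have HI : \int[leb]_(y in eball x r) ((enorm y `^ alpha)%:E * (g y `^ p * (w y)%:E)) <=
    (C * A * r `^ lambda)%:E.
  have FI' := le_trans (hyp _ _ x r Ffg r0) (lee_wpmul2l (ltW C00 : 0 <= C0%:E) FI).
  apply: (le_trans gI); apply: le_trans (lee_wpmul2l _ FI') _.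
    by rewrite lee_fin mulr_ge0 ?powR_ge0.
  rewrite -!EFinM lee_fin le_eqVlt; apply/orP; left; apply/eqP.
  have E1 : ((r + enorm x) `^ alpha * (r + enorm x) `^ (- alpha) = 1)%R.
    by rewrite powRN mulfV// gt_eqF// powR_gt0.
  have E2 : (r `^ gamma * r `^ (lambda - gamma) = r `^ lambda)%R.
    by rewrite -powRD ?(gt_eqF r0) ?implybT// addrC subrK.
  rewrite powRM ?(ltW r0)//.
  rewrite [LHS](_ : _ = C * A *
     ((r + enorm x) `^ alpha * (r + enorm x) `^ (- alpha)) *
     (r `^ gamma * r `^ (lambda - gamma)))%R; last by rewrite /C; ring.
  by rewrite E1 E2 mulr1.
have rl : (0 < r `^ lambda)%R by rewrite powR_gt0.
have CA : (C `^ p^-1 * nu = (C * A) `^ p^-1)%R.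
  by rewrite powRM ?(ltW CC)// -powRrM mulfV ?gt_eqF// powRr1.
rewrite CA -poweR_EFin; apply: le_poweR.
- by rewrite invr_ge0 ltW.
- apply: mule_ge0; first by rewrite lee_fin invr_ge0 ltW.
  by apply: integral_ge0 => y _; apply: mule_ge0 => //; rewrite lee_fin powR_ge0.
- by rewrite lee_pdivrMl// -EFinM [(r `^ _ * _)%R]mulrC.
Qed.

End morrey_spaces.

(** * Morrey bounds for general weights *)

Section morrey_extrapolation.
Context {R : realType} {n : nat}.
Hypothesis n_gt0 : (0 < n)%N.
Implicit Types (x y z : 'rV[R]_n) (r rho : R) (w : 'rV[R]_n -> R).
Local Notation leb := (@lebesgue_rV R n).
Local Notation vol := (@ball_volume R n).
Local Open Scope ereal_scope.
Variable F : set (('rV[R]_n -> \bar R) * ('rV[R]_n -> \bar R)).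
Hypothesis hF : forall f g, F (f, g) -> nonneg_measurable f /\ nonneg_measurable g.

Lemma intermediate_exponent (sigma lambda : R) : (1 < sigma)%R ->
  (0 <= lambda)%R -> (lambda < n%:R / conj_exp sigma)%R ->
  exists gamma : R, [/\ (0 <= gamma)%R, (lambda < gamma)%R &
    (gamma * conj_exp sigma < n%:R)%R].
Proof.
move=> s1 l0 ln; have t0 : (0 < conj_exp sigma)%R.
  by rewrite (lt_trans ltr01)// conj_exp_gt1.
exists ((lambda + n%:R / conj_exp sigma) / 2)%R; split; [|lra|].
  by rewrite divr_ge0// addr_ge0// divr_ge0// ltW.
by rewrite -ltr_pdivlMr//; lra.
Qed.

(** An exponent gamma between lambda and n / sigma' is at the same time large
    enough for the dyadic sums in the Morrey norm to converge, and small enough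
    for the products of w with the radial weights to be uniformly in A_p. *)
Lemma morrey_bound_ap (p0 p sigma lambda alpha K : R) w :
  (1 <= p0)%R -> weighted_bound p0 F -> (1 < p)%R -> (1 < sigma)%R ->
  (0 <= lambda)%R -> (lambda < n%:R / conj_exp sigma)%R ->
  (0 <= alpha)%R -> (alpha < lambda)%R \/ alpha = 0%R ->
  measurable_fun [set: 'rV[R]_n] w -> (forall x, 0 < w x)%R -> (0 < K)%R ->
  (forall y rho, (0 < rho)%R -> ap_rh_on p sigma K w y rho) ->
  morrey_bound p lambda (fun x => enorm x `^ alpha * w x)%R F.
Proof.
move=> p01 wF p1 s1 l0 ln a0 al mw w0 K0 apw.
have [gamma [g0 lg gn]] := intermediate_exponent s1 l0 ln.
have [K' K'0 HK] := ap_balls_mul_radial n_gt0 p1 s1 g0 gn K0.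
have [C0 C00 HC] := extrapolation_balls n_gt0 p01 hF wF p1 K'0.
apply: (morrey_of_radial n_gt0 (lt_trans ltr01 p1) l0 lg a0 al mw w0 hF C00).
move=> f g z r Ffg r0; exact: HC Ffg (HK w z r mw w0 apw r0).
Qed.

Lemma morrey_bound_a1 (sigma lambda alpha K : R) w :
  weighted_bound 1 F -> (1 < sigma)%R ->
  (0 <= lambda)%R -> (lambda < n%:R / conj_exp sigma)%R ->
  (0 <= alpha)%R -> (alpha < lambda)%R \/ alpha = 0%R ->
  measurable_fun [set: 'rV[R]_n] w -> (forall x, 0 < w x)%R -> (0 < K)%R ->
  (forall y rho, (0 < rho)%R -> exists b : R, [/\ (0 < b)%R,
      \int[leb]_(x in eball y rho) (w x `^ sigma)%:E = b%:E &
      {ae leb, forall x, eball y rho x ->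
        ((b / vol y rho) `^ sigma^-1 <= K * w x)%R}]) ->
  morrey_bound 1 lambda (fun x => enorm x `^ alpha * w x)%R F.
Proof.
move=> [phi [phi0 phi_nd hphi]] s1 l0 ln a0 al mw w0 K0 aw.
have [gamma [g0 lg gn]] := intermediate_exponent s1 l0 ln.
have [K' K'0 HK] := a1_balls_mul_radial n_gt0 s1 g0 gn K0.
pose M := Num.max 1%R K'.
have M1 : (1 <= M)%R by rewrite le_max lexx.
apply: (morrey_of_radial n_gt0 ltr01 l0 lg a0 al mw w0 hF (powR_gt0 1 (phi0 _ M1))).
move=> f g z r Ffg r0; have aW := HK w z r mw w0 aw r0.
have [muckW /andP[cW1 cWM]] := muckenhoupt_of_a1 n_gt0 aW.
have [_ W0 _] := aW.
apply: (integral_le_of_Lnorm_le (lexx _) (hF Ffg).1 (hF Ffg).2 (phi0 _ M1)) => //.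
apply: (le_trans (hphi _ _ _ Ffg muckW)); rewrite lee_wpmul2r ?poweR_ge0//.
by rewrite lee_fin phi_nd// le_max cWM orbT.
Qed.

Lemma morrey_bound_ae (p lambda : R) (u u' : 'rV[R]_n -> R) :
  measurable_fun [set: 'rV[R]_n] u -> measurable_fun [set: 'rV[R]_n] u' ->
  {ae leb, forall x, u x = u' x} ->
  morrey_bound p lambda u F -> morrey_bound p lambda u' F.
Proof.
move=> mu_ mu' uu' [C C0 HC]; exists C; first exact: C0.
move=> f g Ffg; have [[mf _] [mg _]] := hF Ffg.
have E h : measurable_fun [set: 'rV[R]_n] h ->
    morrey_norm p lambda u' h = morrey_norm p lambda u h.
  move=> mh; rewrite /morrey_norm; congr ereal_sup; apply: eq_imagel => -[x r] /= _.
  congr ((_ * _) `^ _).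
  have mI (v : 'rV[R]_n -> R) : measurable_fun [set: 'rV[R]_n] v ->
      measurable_fun (eball x r) (fun y => `|h y| `^ p * (v y)%:E).
    move=> mv; apply: measurable_funTS; apply: emeasurable_funM; last exact/measurable_EFinP.
    by apply: measurable_poweR_comp; exact: measurableT_comp.
  apply: ae_eq_integral; [exact: measurable_eball|exact: mI|exact: mI|].
  by apply: filterS uu' => y -> _.
rewrite (E _ mf) (E _ mg); exact: HC.
Qed.

(** A weight is positive only almost everywhere: changing it on a null set
    makes it positive. *)
Definition positive_weight w x : R := if (0 < w x)%R then w x else 1%R.

Lemma positive_weight_gt0 w x : (0 < positive_weight w x)%R.
Proof. by rewrite /positive_weight; case: ifP. Qed.

Lemma measurable_positive_weight w : measurable_fun [set: 'rV[R]_n] w ->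
  measurable_fun [set: 'rV[R]_n] (positive_weight w).
Proof.
move=> mw; apply: measurable_fun_ifT; [|exact: mw|exact: measurable_cst].
by apply: measurable_fun_ltr; [exact: measurable_cst|exact: mw].
Qed.

Lemma ae_positive_weight w : {ae leb, forall x, (0 < w x)%R} ->
  {ae leb, forall x, positive_weight w x = w x}.
Proof. by apply: filterS => x w0; rewrite /positive_weight w0. Qed.

Lemma avg_ae (u u' : 'rV[R]_n -> R) x r : measurable_fun [set: 'rV[R]_n] u ->
  measurable_fun [set: 'rV[R]_n] u' -> {ae leb, forall x, u x = u' x} ->
  avg u (eball x r) = avg u' (eball x r).
Proof.
move=> mu_ mu' uu'; rewrite /avg /mass; congr (_ / _).
apply: ae_eq_integral; [exact: measurable_eball| | |].
- by apply/measurable_EFinP; exact: measurable_funTS.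
- by apply/measurable_EFinP; exact: measurable_funTS.
- by apply: filterS uu' => y -> _.
Qed.

Lemma avg_gt0 (u : 'rV[R]_n -> R) x r : measurable_fun [set: 'rV[R]_n] u ->
  (forall x, 0 < u x)%R -> (0 < r)%R -> 0 < avg u (eball x r).
Proof.
move=> mu_ u0 r0; rewrite /avg /mass lebesgue_eballE// inver gt_eqF ?ball_volume_gt0//.
rewrite mule_gt0 ?lte_fin ?invr_gt0 ?ball_volume_gt0//.
exact: integral_gt0_of_pos (measurable_eball x r) mu_ u0 (eball_gt0 n_gt0 x r0).
Qed.

Lemma avg_fin (u : 'rV[R]_n -> R) x r : measurable_fun [set: 'rV[R]_n] u ->
  (forall x, 0 < u x)%R -> (0 < r)%R -> avg u (eball x r) < +oo ->
  exists m : R, [/\ (0 < m)%R, \int[leb]_(y in eball x r) (u y)%:E = m%:E &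
    avg u (eball x r) = (m / vol x r)%:E].
Proof.
move=> mu_ u0 r0.
have := integral_gt0_of_pos (measurable_eball x r) mu_ u0 (eball_gt0 n_gt0 x r0).
case E : (\int[leb]_(y in eball x r) (u y)%:E) => [m| |]// m0.
  by exists m; split => //; exact: avgE.
rewrite /avg /mass E lebesgue_eballE// inver gt_eqF ?ball_volume_gt0//.
by rewrite gt0_mulye ?lte_fin ?invr_gt0 ?ball_volume_gt0// ltxx.
Qed.

Lemma rh_avg (sigma : R) w : (0 < sigma)%R -> weight w -> reverse_hoelder sigma w ->
  exists2 c : R, (0 < c)%R & forall x r, (0 < r)%R ->
    avg (fun y => positive_weight w y `^ sigma)%R (eball x r) `^ sigma^-1 <=
    c%:E * avg (positive_weight w) (eball x r).
Proof.
move=> s0 ww [c Hc]; exists (Num.max 1 c)%R; first by rewrite lt_max ltr01.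
have [mw _ wpos] := ww; have mw' := measurable_positive_weight mw.
move=> x r r0; have wae := ae_positive_weight wpos.
have mpow (u : 'rV[R]_n -> R) : measurable_fun [set: 'rV[R]_n] u ->
  measurable_fun [set: 'rV[R]_n] (fun y => u y `^ sigma)%R by exact: measurable_pow_weight.
rewrite (@avg_ae _ (fun y => w y `^ sigma)%R _ _ (mpow _ mw') (mpow _ mw)); last first.
  by apply: filterS wae => y ->.
apply: (le_trans (Hc x r r0)); rewrite -(avg_ae _ _ mw' mw wae).
apply: lee_wpmul2r; first exact: ltW (avg_gt0 x mw' (positive_weight_gt0 w) r0).
by rewrite lee_fin le_max lexx orbT.
Qed.

Lemma rh_mass (sigma a c : R) w x r : (0 < sigma)%R ->
  measurable_fun [set: 'rV[R]_n] w -> (forall x, 0 < w x)%R -> (0 < r)%R ->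
  avg w (eball x r) = a%:E ->
  avg (fun y => w y `^ sigma)%R (eball x r) `^ sigma^-1 <=
    c%:E * avg w (eball x r) ->
  exists b : R, [/\ (0 < b)%R,
    \int[leb]_(y in eball x r) (w y `^ sigma)%:E = b%:E &
    ((b / vol x r) `^ sigma^-1 <= c * a)%R].
Proof.
move=> s0 mw w0 r0 -> H.
have wp0 y : (0 < w y `^ sigma)%R by rewrite powR_gt0.
have [|b [b0 bE avgB]] := avg_fin (x := x) (measurable_pow_weight sigma mw) wp0 r0.
  apply: (@lty_poweRy _ _ sigma^-1); first by rewrite invr_eq0 gt_eqF.
  by apply: (le_lt_trans H); rewrite -EFinM ltry.
exists b; split => //.
by move: H; rewrite avgB poweR_EFin -EFinM lee_fin.
Qed.

Lemma ap_rh_on_of_weight (p sigma : R) w : (1 < p)%R -> (0 < sigma)%R ->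
  muckenhoupt p w -> reverse_hoelder sigma w ->
  exists2 K : R, (0 < K)%R & forall y rho, (0 < rho)%R ->
    ap_rh_on p sigma K (positive_weight w) y rho.
Proof.
move=> p1 s0 [ww]; rewrite gt_eqF// => apw rhw.
have [c c0 Hc] := rh_avg s0 ww rhw.
have [mw _ wpos] := ww; have mw' := measurable_positive_weight mw.
set w' := positive_weight w in Hc mw' *.
have w'0 x : (0 < w' x)%R by exact: positive_weight_gt0.
have wae : {ae leb, forall x, w' x = w x} by exact: ae_positive_weight wpos.
have p10 : (0 < p - 1)%R by rewrite subr_gt0.
have md : measurable_fun [set: 'rV[R]_n] (dual_weight p w') by exact: measurable_dual_weight.
have d0 x : (0 < dual_weight p w' x)%R by exact: dual_weight_gt0.
have [K1 HK1] : exists K1 : R, forall y rho, (0 < rho)%R ->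
    avg w' (eball y rho) * avg (dual_weight p w') (eball y rho) `^ (p - 1) <= K1%:E.
  have H y rho : (0 < rho)%R -> avg w' (eball y rho) *
      avg (dual_weight p w') (eball y rho) `^ (p - 1) <= Ap_const p w.
    move=> rho0; rewrite (avg_ae _ _ mw' mw wae).
    rewrite (@avg_ae _ (dual_weight p w) _ _ md (measurable_dual_weight p mw)); last first.
      by apply: filterS wae => z; rewrite /dual_weight => ->.
    by apply: ereal_sup_ubound; exists (y, rho).
  exists (fine (Ap_const p w)) => y rho rho0; apply: (le_trans (H y rho rho0)).
  case: (Ap_const p w) apw H => [t|//|] _ H; first by [].
  exact: leNye.
exists (Num.max 1 (c * K1))%R; first by rewrite lt_max ltr01.
move=> y rho rho0; have := HK1 y rho rho0.
have A0 := avg_gt0 y mw' w'0 rho0; have S0 := avg_gt0 y md d0 rho0.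
have Afin : avg w' (eball y rho) < +oo.
  rewrite ltey; apply/negP => /eqP Ay; have := HK1 y rho rho0.
  by rewrite Ay gt0_mulye ?poweR_gt0// leNgt ltry.
have Sfin : avg (dual_weight p w') (eball y rho) < +oo.
  rewrite ltey; apply/negP => /eqP Sy; have := HK1 y rho rho0.
  by rewrite Sy poweRyr ?gt_eqF// gt0_muley// leNgt ltry.
have [a [a0 aE avgA]] := avg_fin mw' w'0 rho0 Afin.
have [s [s0' sE avgS]] := avg_fin md d0 rho0 Sfin.
have [b [b0 bE HB]] := rh_mass s0 mw' w'0 rho0 avgA (Hc y rho rho0).
rewrite avgA avgS poweR_EFin -EFinM lee_fin => HK.
exists b, s; split => //.
apply: (@le_trans _ _ (c * (a / vol y rho) * (s / vol y rho) `^ (p - 1))%R).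
  by rewrite ler_wpM2r ?powR_ge0.
by rewrite -mulrA le_max; apply/orP; right; rewrite ler_wpM2l// ltW.
Qed.

Lemma a1_rh_on_of_weight (sigma : R) w : (0 < sigma)%R ->
  muckenhoupt 1 w -> reverse_hoelder sigma w ->
  exists2 K : R, (0 < K)%R & forall y rho, (0 < rho)%R -> exists b : R, [/\ (0 < b)%R,
      \int[leb]_(x in eball y rho) (positive_weight w x `^ sigma)%:E = b%:E &
      {ae leb, forall x, eball y rho x ->
        ((b / vol y rho) `^ sigma^-1 <= K * positive_weight w x)%R}].
Proof.
move=> s0 [ww]; rewrite eqxx => -[c1 aw] rhw.
have [c c0 Hc] := rh_avg s0 ww rhw.
have [mw _ wpos] := ww; have mw' := measurable_positive_weight mw.
set w' := positive_weight w in Hc mw' *.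
have w'0 x : (0 < w' x)%R by exact: positive_weight_gt0.
have wae : {ae leb, forall x, w' x = w x} by exact: ae_positive_weight wpos.
exists (Num.max 1 (c * c1))%R; first by rewrite lt_max ltr01.
move=> y rho rho0.
have aw' : {ae leb, forall x, eball y rho x -> avg w' (eball y rho) <= (c1 * w' x)%:E}.
  rewrite (avg_ae _ _ mw' mw wae).
  by apply: filterS2 wae (aw y rho rho0) => x -> H xy; exact: H.
have Afin : avg w' (eball y rho) < +oo.
  have [x _] := ae_exists (measurable_eball y rho) (eball_gt0 n_gt0 y rho0) aw'.
  by move=> /le_lt_trans; apply; exact: ltry.
have [a [a0 aE avgA]] := avg_fin mw' w'0 rho0 Afin.
have [b [b0 bE HB]] := rh_mass s0 mw' w'0 rho0 avgA (Hc y rho rho0).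
exists b; split => //.
apply: filterS aw' => x /[apply]; rewrite avgA lee_fin => H.
apply: (le_trans HB); apply: (@le_trans _ _ (c * (c1 * w' x))%R).
  by rewrite ler_wpM2l// ltW.
by rewrite mulrA ler_wpM2r ?(ltW (w'0 x))// le_max lexx orbT.
Qed.

End morrey_extrapolation.

(** * Power weights *)

Section power_weights.
Context {R : realType} {n : nat}.
Hypothesis n_gt0 : (0 < n)%N.
Implicit Types (x y z : 'rV[R]_n) (r rho t : R).
Local Notation leb := (@lebesgue_rV R n).
Local Notation vol := (@ball_volume R n).
Local Open Scope ereal_scope.

(** The power |x|^t, except that the value at the origin is 1. *)
Definition power_weight t : 'rV[R]_n -> R := positive_weight (fun x => enorm x `^ t)%R.

Lemma power_weight_gt0 t x : (0 < power_weight t x)%R.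
Proof. exact: positive_weight_gt0. Qed.

Lemma measurable_power_weight t : measurable_fun [set: 'rV[R]_n] (power_weight t).
Proof. by apply: measurable_positive_weight; exact: measurable_enorm_pow. Qed.

Lemma ae_enorm_gt0 : {ae leb, forall x, (0 < enorm x)%R}.
Proof.
apply: filterS (ae_neq0 n_gt0) => x x0; rewrite lt0r enorm_ge0 andbT.
by apply: contra_neq x0; exact: enorm_eq0.
Qed.

Lemma ae_power_weight t : {ae leb, forall x, power_weight t x = (enorm x `^ t)%R}.
Proof.
by apply: ae_positive_weight; apply: filterS ae_enorm_gt0 => x x0; rewrite powR_gt0.
Qed.

Lemma power_weight_pow t (s : R) x :
  (power_weight t x `^ s = power_weight (t * s) x)%R.
Proof.
rewrite /power_weight /positive_weight powRrM.
have [t0|] := ltP 0%R (enorm x `^ t)%R; first by rewrite powR_gt0.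
rewrite le_eqVlt ltNge powR_ge0 orbF => /eqP ->; rewrite powR1.
by have [->|s0] := eqVneq s 0%R; rewrite ?powRr0 ?ltr01// powR0// ltxx.
Qed.

(** For t < 0 this is the case of a radial weight whose scale is 0. *)
Lemma enorm_pow_mass t : (- n%:R < t)%R -> exists2 C : R, (0 < C)%R &
  forall y rho, (0 < rho)%R -> \int[leb]_(x in eball y rho) (enorm x `^ t)%:E <=
    (C * (enorm y + rho) `^ t * vol y rho)%:E.
Proof.
move=> nt; have [t0|t0] := leP 0%R t.
  exists 1%R => // y rho rho0.
  have N0 : (0 <= enorm y + rho)%R by rewrite addr_ge0 ?enorm_ge0 ?ltW.
  apply: (@le_trans _ _ (\int[leb]_(x in eball y rho) ((enorm y + rho) `^ t)%:E)).
    apply: ge0_le_integral.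
    - exact: measurable_eball.
    - by move=> x _; rewrite lee_fin powR_ge0.
    - by apply/measurable_EFinP; apply: measurable_funTS; exact: measurable_enorm_pow.
    - exact: measurable_cst.
    move=> x xy; rewrite lee_fin ge0_ler_powR ?nnegrE ?enorm_ge0//.
    rewrite -[x](subrK y) addrC; apply: (le_trans (ler_enormD _ _)).
    by rewrite lerD2l ltW.
  rewrite integral_cst; last exact: measurable_eball.
  by rewrite mul1r EFinM -lebesgue_eballE.
have g0 : (0 <= - t)%R by rewrite oppr_ge0 ltW.
have gn : (- t < n%:R)%R by rewrite ltrNl.
have [C C0 HC] := @radial_weight_mass R n n_gt0 _ g0 gn.
exists (C / @ball_const R n)%R; first by rewrite divr_gt0 ?ball_const_gt0.
move=> y rho rho0; have := HC 0%R 0%R y rho (lexx _) rho0.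
rewrite opprK add0r subr0.
rewrite (eq_integral (fun x => (enorm x `^ t)%:E)); last first.
  by move=> x _; rewrite /radial_weight add0r subr0.
move=> H; apply: (le_trans H); rewrite lee_fin.
rewrite [leRHS](_ : _ = C * (enorm y + rho) `^ t * ((@ball_const R n)^-1 * vol y rho))%R; last by ring.
by rewrite ler_wpM2l ?mulr_ge0 ?powR_ge0 ?(ltW C0)//; exact: le_vol.
Qed.

Lemma power_weight_mass t : (- n%:R < t)%R -> exists2 C : R, (0 < C)%R &
  forall y rho, (0 < rho)%R -> exists b : R, [/\ (0 < b)%R,
    \int[leb]_(x in eball y rho) (power_weight t x)%:E = b%:E &
    (b / vol y rho <= C * (enorm y + rho) `^ t)%R].
Proof.
move=> nt; have [C C0 HC] := enorm_pow_mass nt; exists C => // y rho rho0.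
have := HC y rho rho0.
have <- : \int[leb]_(x in eball y rho) (power_weight t x)%:E =
    \int[leb]_(x in eball y rho) (enorm x `^ t)%:E.
  apply: ae_eq_integral; [exact: measurable_eball| | |].
  - by apply/measurable_EFinP; apply: measurable_funTS; exact: measurable_power_weight.
  - by apply/measurable_EFinP; apply: measurable_funTS; exact: measurable_enorm_pow.
  - by apply: filterS (ae_power_weight t) => x -> _.
have := integral_gt0_of_pos (measurable_eball y rho) (measurable_power_weight t)
  (power_weight_gt0 t) (eball_gt0 n_gt0 y rho0).
case: (\int[leb]_(x in eball y rho) _) => [b| |]// b0; rewrite lee_fin => Hb.
by exists b; split => //; rewrite ler_pdivrMr ?ball_volume_gt0.
Qed.

Lemma pow_mean_le (u C N a s : R) : (0 <= u)%R -> (0 <= C)%R -> (0 <= s)%R ->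
  (u <= C * N `^ a)%R -> (u `^ s <= C `^ s * N `^ (a * s))%R.
Proof.
move=> u0 C0 s0 H; rewrite powRrM -powRM ?powR_ge0//.
by rewrite ge0_ler_powR ?nnegrE ?mulr_ge0 ?powR_ge0.
Qed.

Lemma ap_rh_on_power_weight (p sigma g : R) : (1 < p)%R -> (1 < sigma)%R ->
  (- n%:R < g * sigma)%R -> (g < n%:R * (p - 1))%R ->
  exists2 K : R, (0 < K)%R & forall y rho, (0 < rho)%R ->
    ap_rh_on p sigma K (power_weight g) y rho.
Proof.
move=> p1 s1 gs gp; have p10 : (0 < p - 1)%R by rewrite subr_gt0.
have s0 : (0 < sigma)%R by rewrite (lt_trans ltr01).
have gd : (- n%:R < g * (1 - conj_exp p))%R.
  by rewrite subr1_conj_exp// mulrN ltrN2 ltr_pdivrMr.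
have [C1 C10 H1] := power_weight_mass gs.
have [C2 C20 H2] := power_weight_mass gd.
exists (C1 `^ sigma^-1 * C2 `^ (p - 1))%R; first by rewrite mulr_gt0 ?powR_gt0.
move=> y rho rho0; have [b [b0 bE bC]] := H1 y rho rho0.
have [s [s0' sE sC]] := H2 y rho rho0; exists b, s; split => //.
- by rewrite -bE; apply: eq_integral => x _; rewrite power_weight_pow.
- by rewrite -sE; apply: eq_integral => x _; rewrite /dual_weight power_weight_pow.
set N := (enorm y + rho)%R in bC sC.
have N0 : (0 < N)%R by rewrite ltr_wpDl ?enorm_ge0.
have V0 := ball_volume_gt0 n_gt0 y rho0.
have B : ((b / vol y rho) `^ sigma^-1 <= C1 `^ sigma^-1 * N `^ g)%R.
  have {1}-> : (g = g * sigma / sigma)%R by rewrite mulfK// gt_eqF.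
  by apply: pow_mean_le; rewrite ?invr_ge0 ?divr_ge0 ?(ltW s0) ?(ltW b0) ?(ltW V0) ?(ltW C10).
have S : ((s / vol y rho) `^ (p - 1) <= C2 `^ (p - 1) * N `^ (- g))%R.
  have -> : (- g = g * (1 - conj_exp p) * (p - 1))%R.
    by rewrite subr1_conj_exp// mulrN mulNr divfK// gt_eqF.
  by apply: pow_mean_le; rewrite ?divr_ge0 ?(ltW p10) ?(ltW s0') ?(ltW V0) ?(ltW C20).
apply: (le_trans (ler_pM (powR_ge0 _ _) (powR_ge0 _ _) B S)).
rewrite mulrACA -powRD ?subrr ?powRr0 ?mulr1//.
by rewrite (gt_eqF N0) implybT.
Qed.

Lemma a1_rh_on_power_weight (sigma g : R) : (1 < sigma)%R ->
  (- n%:R < g * sigma)%R -> (g <= 0)%R ->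
  exists2 K : R, (0 < K)%R & forall y rho, (0 < rho)%R -> exists b : R, [/\ (0 < b)%R,
      \int[leb]_(x in eball y rho) (power_weight g x `^ sigma)%:E = b%:E &
      {ae leb, forall x, eball y rho x ->
        ((b / vol y rho) `^ sigma^-1 <= K * power_weight g x)%R}].
Proof.
move=> s1 gs g0; have s0 : (0 < sigma)%R by rewrite (lt_trans ltr01).
have [C1 C10 H1] := power_weight_mass gs.
exists (C1 `^ sigma^-1)%R; first by rewrite powR_gt0.
move=> y rho rho0; have [b [b0 bE bC]] := H1 y rho rho0.
exists b; split => //.
  by rewrite -bE; apply: eq_integral => x _; rewrite power_weight_pow.
set N := (enorm y + rho)%R in bC.
have N0 : (0 < N)%R by rewrite ltr_wpDl ?enorm_ge0.
have V0 := ball_volume_gt0 n_gt0 y rho0.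
have B : ((b / vol y rho) `^ sigma^-1 <= C1 `^ sigma^-1 * N `^ g)%R.
  have {1}-> : (g = g * sigma / sigma)%R by rewrite mulfK// gt_eqF.
  by apply: pow_mean_le; rewrite ?invr_ge0 ?divr_ge0 ?(ltW s0) ?(ltW b0) ?(ltW V0) ?(ltW C10).
apply: filterS2 (ae_power_weight g) ae_enorm_gt0 => x -> x0 xy.
apply: (le_trans B); rewrite ler_wpM2l ?powR_ge0//.
rewrite -[g]opprK; apply: ge_powRN => //; first by rewrite oppr_ge0.
rewrite -[x](subrK y) addrC; apply: (le_trans (ler_enormD _ _)).
by rewrite lerD2l ltW.
Qed.

(** Any tau between max(0, - g) and n - lambda gives sigma = n / tau, for which
    n / sigma' = n - tau. *)
Lemma power_weight_exponent (lambda g : R) : (0 <= lambda)%R -> (lambda < n%:R)%R ->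
  (lambda - n%:R < g)%R -> exists sigma : R, [/\ (1 < sigma)%R,
    (- n%:R < g * sigma)%R & (lambda < n%:R / conj_exp sigma)%R].
Proof.
move=> l0 ln lg; have n0 : (0 < n%:R :> R)%R by rewrite ltr0n.
have [tau [t0 gt tl]] : exists tau : R,
    [/\ (0 < tau)%R, (- g < tau)%R & (tau < n%:R - lambda)%R].
  have [g0|g0] := leP 0%R g.
    by exists ((n%:R - lambda) / 2)%R; split; lra.
  by exists ((n%:R - lambda - g) / 2)%R; split; lra.
exists (n%:R / tau)%R; split.
- by rewrite ltr_pdivlMr// mul1r; lra.
- rewrite mulrA ltr_pdivlMr// mulNr -mulrN [ltRHS]mulrC ltr_pM2l//.
  by rewrite ltrNl.
rewrite /conj_exp (_ : n%:R / _ = n%:R - tau)%R; last first.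
  by field; rewrite !gt_eqF ?subr_gt0//; lra.
lra.
Qed.

Variable F : set (('rV[R]_n -> \bar R) * ('rV[R]_n -> \bar R)).
Hypothesis hF : forall f g, F (f, g) -> nonneg_measurable f /\ nonneg_measurable g.

Lemma morrey_bound_power_weight (p lambda alpha g : R) :
  morrey_bound p lambda (fun x => enorm x `^ alpha * power_weight g x)%R F ->
  morrey_bound p lambda (fun x => enorm x `^ (alpha + g))%R F.
Proof.
apply: morrey_bound_ae; first exact: hF.
- by apply: measurable_funM; [exact: measurable_enorm_pow|exact: measurable_power_weight].
- exact: measurable_enorm_pow.
apply: filterS2 (ae_power_weight g) ae_enorm_gt0 => x -> x0.
by rewrite powRD// (gt_eqF x0) implybT.
Qed.

(** The exponent beta is split as alpha + g, where |x|^g is an A_p weight, and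
    where |x|^alpha is a factor that the Morrey norms can bear. *)
Lemma morrey_bound_power_ap (p0 p lambda beta : R) :
  (1 <= p0)%R -> weighted_bound p0 F -> (1 < p)%R ->
  (0 <= lambda)%R -> (lambda < n%:R)%R ->
  (lambda - n%:R < beta)%R -> (beta < lambda + n%:R * (p - 1))%R ->
  morrey_bound p lambda (fun x => enorm x `^ beta)%R F.
Proof.
move=> p01 wF p1 l0 ln lb bl; have n0 : (0 < n%:R :> R)%R by rewrite ltr0n.
have np : (0 < n%:R * (p - 1) :> R)%R by rewrite mulr_gt0// subr_gt0.
have [m mE] : exists m : R, m = (n%:R * (p - 1))%R by eexists.
rewrite -mE in bl np.
have [alpha [g [-> a0 al lg gp]]] : exists alpha g : R, [/\ beta = (alpha + g)%R,
    (0 <= alpha)%R, (alpha < lambda)%R \/ alpha = 0%R, (lambda - n%:R < g)%R &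
    (g < m)%R].
  have [bm|mb] := ltP beta m; first by exists 0%R, beta; rewrite add0r; split => //; right.
  have [bl'|lb'] := leP beta lambda.
    exists (beta - m / 2)%R, (m / 2)%R; split; [by ring|lra|left; lra|lra|lra].
  exists ((beta - m + lambda) / 2)%R, ((beta + m - lambda) / 2)%R.
  by split; [field|lra|left; lra|lra|lra].
have [sigma [s1 gs ls]] := power_weight_exponent l0 ln lg.
rewrite mE in gp.
have [K K0 HK] := ap_rh_on_power_weight p1 s1 gs gp.
apply: morrey_bound_power_weight.
apply: (morrey_bound_ap n_gt0 hF p01 wF p1 s1 l0 ls a0 al _ _ K0 HK).
- exact: measurable_power_weight.
- exact: power_weight_gt0.
Qed.

Lemma morrey_bound_power_a1 (lambda beta : R) : weighted_bound 1 F ->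
  (0 <= lambda)%R -> (lambda < n%:R)%R ->
  (lambda - n%:R < beta)%R -> (beta < lambda)%R ->
  morrey_bound 1 lambda (fun x => enorm x `^ beta)%R F.
Proof.
move=> wF l0 ln lb bl.
have [alpha [g [-> a0 al lg g0]]] : exists alpha g : R, [/\ beta = (alpha + g)%R,
    (0 <= alpha)%R, (alpha < lambda)%R \/ alpha = 0%R, (lambda - n%:R < g)%R &
    (g <= 0)%R].
  have [b0|b0] := leP beta 0%R; first by exists 0%R, beta; rewrite add0r; split => //; right.
  by exists beta, 0%R; rewrite addr0 subr_lt0; split => //; [exact: ltW|left].
have [sigma [s1 gs ls]] := power_weight_exponent l0 ln lg.
have [K K0 HK] := a1_rh_on_power_weight s1 gs g0.
apply: morrey_bound_power_weight.
apply: (morrey_bound_a1 n_gt0 hF wF s1 l0 ls a0 al _ _ K0 HK).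
- exact: measurable_power_weight.
- exact: power_weight_gt0.
Qed.

End power_weights.

(** * Extrapolation to Morrey spaces *)

Theorem theorem1p1 (R : realType) (n : nat) (n_gt0 : (0 < n)%N)
    (p0 : R) (hp0 : 1 <= p0)
    (F : set (('rV[R]_n -> \bar R) * ('rV[R]_n -> \bar R)))
    (hF : forall f g, F (f, g) -> nonneg_measurable f /\ nonneg_measurable g)
    (hp0F : weighted_bound p0 F) :
  (forall (p sigma lambda alpha : R) (w : 'rV[R]_n -> R),
      1 < p -> 1 < sigma -> muckenhoupt p w -> reverse_hoelder sigma w ->
      0 <= lambda -> lambda < n%:R / conj_exp sigma ->
      0 <= alpha -> alpha < lambda ->
      morrey_bound p lambda (fun x => enorm x `^ alpha * w x) F)
  /\ (forall p lambda beta : R,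
      1 < p -> 0 <= lambda -> lambda < n%:R ->
      lambda - n%:R < beta -> beta < lambda + n%:R * (p - 1) ->
      morrey_bound p lambda (fun x => enorm x `^ beta) F)
  /\ (weighted_bound 1 F ->
      (forall (sigma lambda alpha : R) (w : 'rV[R]_n -> R),
          1 < sigma -> muckenhoupt 1 w -> reverse_hoelder sigma w ->
          0 <= lambda -> lambda < n%:R / conj_exp sigma ->
          0 <= alpha -> alpha < lambda ->
          morrey_bound 1 lambda (fun x => enorm x `^ alpha * w x) F)
      /\ (forall lambda beta : R,
          0 <= lambda -> lambda < n%:R ->
          lambda - n%:R < beta -> beta < lambda ->
          morrey_bound 1 lambda (fun x => enorm x `^ beta) F)).
Proof.
have of_positive p lambda alpha w : weight w ->
    morrey_bound p lambda (fun x => enorm x `^ alpha * positive_weight w x) F ->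
    morrey_bound p lambda (fun x => enorm x `^ alpha * w x) F.
  move=> [mw _ w0]; apply: (morrey_bound_ae hF).
  - apply: measurable_funM; first exact: measurable_enorm_pow.
    exact: measurable_positive_weight.
  - by apply: measurable_funM; first exact: measurable_enorm_pow.
  - by apply: filterS (ae_positive_weight w0) => x ->.
split; [|split].
- move=> p sigma lambda alpha w p1 s1 [ww aw] rw l0 ls a0 al.
  have [K K0 HK] := ap_rh_on_of_weight n_gt0 p1 (lt_trans ltr01 s1) (conj ww aw) rw.
  have [mw _ _] := ww; apply: of_positive ww _.
  apply: (morrey_bound_ap n_gt0 hF hp0 hp0F p1 s1 l0 ls a0 (or_introl al) _ _ K0 HK).
    exact: measurable_positive_weight.
  exact: positive_weight_gt0.
- move=> p lambda beta p1 l0 ln lb bl.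
  exact: (morrey_bound_power_ap n_gt0 hF hp0 hp0F p1 l0 ln lb bl).
move=> h1F; split.
- move=> sigma lambda alpha w s1 [ww aw] rw l0 ls a0 al.
  have [K K0 HK] := a1_rh_on_of_weight n_gt0 (lt_trans ltr01 s1) (conj ww aw) rw.
  have [mw _ _] := ww; apply: of_positive ww _.
  apply: (morrey_bound_a1 n_gt0 hF h1F s1 l0 ls a0 (or_introl al) _ _ K0 HK).
    exact: measurable_positive_weight.
  exact: positive_weight_gt0.
- move=> lambda beta l0 ln lb bl.
  exact: (morrey_bound_power_a1 n_gt0 hF h1F l0 ln lb bl).
Qed.
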